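(* Let $S$ be a separable $\Bbbk$-algebra over a field $\Bbbk$ and let $A$ denote a graded quotient of a quadratic $S$-ring $T$. Assume that $R\subseteq T^{\ge2}$ is a bimodule of relations for $A$ and that $R_P=R$, for some $S$-subbimodule $P\subseteq T$. Then $P$ is of PBW-type if and only if either $c(A)=-1$ or $P$ satisfies the Jacobi conditions $(\mathcal J_n)$ for $1\le n\le c(A)$.
   Context: $S$-bimodules are left modules over $S\otimes_{\Bbbk}S^{op}$; $S$ is separable if it is projective as an $S$-bimodule. A quadratic $S$-ring is a graded connected $S$-ring of the form $T=T_S(T^1)/\langle\mathcal K_0\rangle$, with $T^1$ an $S$-bimodule and $\mathcal K_0$ an $S$-subbimodule of $T^1\otimes_ST^1$. $p^n:T\to T^n$ is the projection, $T^{\le n}=\bigoplus_{m\le n}T^m$, $T^{\ge n}=\bigoplus_{m\ge n}T^m$, $X^{\le n}=X\cap T^{\le n}$, $\langle X\rangle$ the two-sided ideal generated by $X$. Write $A=T/I$ with $I$ a graded ideal. A bimodule of relations for $A=T/I$ (relative to $T$) is a graded $S$-subbimodule $R\subseteq I$ with $I=R\oplus(T^1I+IT^1)$ (it then generates $I$). For an $S$-subbimodule $P\subseteq T$: $R_P:=\bigoplus_np^n(P^{\le n})$; $U(P):=T/\langle P\rangle$, filtered by the images of $T^{\le n}$. $P$ is of PBW-type if the graded $S$-ring map $\Phi_P:T/\langle R_P\rangle\to\operatorname{gr}U(P)$, $x+\langle R_P\rangle\mapsto(x+\langle P\rangle)+U(P)^{\le n-1}$ ($x\in T^n$), is an isomorphism.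 $(\mathcal J_n)$: $P_{n+1}\cap T^{\le n}\subseteq P_n$, where $P_n:=\sum_{i+j+k=n}T^{\le i}P^{\le j}T^{\le k}$. $c(A)=-1$ if $\operatorname{Tor}_3^A(S,S)=0$, otherwise $c(A)=\sup\{n-1\mid\operatorname{Tor}^A_{3,n}(S,S)\ne0\}$, with $n$ the internal degree (if $c(A)=\infty$ all $(\mathcal J_n)$, $n\ge1$, are required). *)

(* Defs.v *)
From HB Require Import structures.
From mathcomp Require Import all_boot all_order all_algebra.
From mathcomp Require Import boolp classical_sets functions constructive_ereal.
From mathcomp.multinomials Require Import freeg.

Set Implicit Arguments.
Unset Strict Implicit.
Unset Printing Implicit Defensive.

Import Order.TTheory GRing.Theory Num.Theory.
Local Open Scope ring_scope.
Local Open Scope classical_set_scope.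
Local Open Scope quotient_scope.

Definition is_subgroup (V : zmodType) (X : set V) : Prop :=
  X 0 /\ forall x y, X x -> X y -> X (x - y).

Definition gen (V : zmodType) (X : set V) : set V := smallest (@is_subgroup V) X.

Lemma gen_subgroup (V : zmodType) (X : set V) : is_subgroup (gen X).
Proof.
split; first by move=> Y [[Y0 _] _].
move=> x y gx gy Y YP; have [[_ YB] _] := YP.
by apply: YB; [apply: gx | apply: gy].
Qed.

Section Quotient.
Variables (V : zmodType) (X : set V).

Definition gen_pred : {pred V} := fun x => `[< gen X x >].

Lemma gen_pred_zmod_closed : zmod_closed gen_pred.
Proof.
have [g0 gB] := gen_subgroup X.
split=> [|x y]; rewrite !unfold_in; first exact/asboolP.
by move=> /asboolP gx /asboolP gy; apply/asboolP; exact: gB.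
Qed.

HB.instance Definition _ := GRing.isZmodClosed.Build V gen_pred
  gen_pred_zmod_closed.

(* The quotient V / X when X is a subgroup; for an arbitrary subset X it is
   the quotient by the subgroup generated by X. *)
Definition zquot : zmodType := Quotient.quot gen_pred.

Definition zproj (x : V) : zquot := \pi_(Quotient.quot gen_pred) x.

Lemma zproj_is_zmod_morphism : zmod_morphism zproj.
Proof. exact: raddfB. Qed.

HB.instance Definition _ :=
  GRing.isZmodMorphism.Build V zquot zproj zproj_is_zmod_morphism.

Lemma zproj_eqE x y : zproj x = zproj y <-> gen X (x - y).
Proof.
split=> [/eqP|gxy].
  by rewrite /zproj -Quotient.idealrBE => /asboolP.
by apply/eqP; rewrite /zproj -Quotient.idealrBE; apply/asboolP.
Qed.

End Quotient.

(* A grading V = (+)_n V^n is given by its projections p n : V -> V^n. *)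
Definition is_grading (V : zmodType) (p : nat -> {additive V -> V}) : Prop :=
  (forall m n x, p m (p n x) = if m == n then p n x else 0) /\
  (forall x, exists N, x = \sum_(i < N) p i x).

Definition homog (V : zmodType) (p : nat -> {additive V -> V}) (n : nat)
  : set V := [set x | p n x = x].

(* N (x)_A M, for a right A-module N and a left A-module M given by their
   actions: the free abelian group on N x M modulo the usual relations. *)
Section Tensor.
Variables (A : Type) (N M : zmodType) (ra : N -> A -> N) (la : A -> M -> M).

Let e (n : N) (m : M) : {freeg (N * M) / int} := << (n, m) >>.

Definition tensor_rels : set {freeg (N * M) / int} :=
  [set z | (exists n n' m, z = e (n + n') m - e n m - e n' m) \/
           (exists n m m', z = e n (m + m') - e n m - e n m') \/
           (exists n a m, z = e (ra n a) m - e n (la a m))].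

Definition tensor : zmodType := zquot tensor_rels.

Definition tens (n : N) (m : M) : tensor := zproj tensor_rels (e n m).

Lemma tensDl n n' m : tens (n + n') m = tens n m + tens n' m.
Proof.
rewrite /tens -raddfD; apply/zproj_eqE; apply: sub_gen_smallest.
by left; exists n, n', m; rewrite opprD addrA.
Qed.

Lemma tensDr n m m' : tens n (m + m') = tens n m + tens n m'.
Proof.
rewrite /tens -raddfD; apply/zproj_eqE; apply: sub_gen_smallest.
by right; left; exists n, m, m'; rewrite opprD addrA.
Qed.

Lemma tens_bal n a m : tens (ra n a) m = tens n (la a m).
Proof.
apply/zproj_eqE; apply: sub_gen_smallest.
by right; right; exists n, a, m.
Qed.

(* The map n (x) m |-> b n m, for b additive in each variable and balanced; it
   is computed on a representative, see tensor_liftE. *)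
Definition tensor_lift (X : zmodType) (b : N -> M -> X) (t : tensor) : X :=
  fglift (fun nm => b nm.1 nm.2 : zmodule X)
    (repr (t : Quotient.quot (gen_pred tensor_rels))).

Section Lift.
Variables (X : zmodType) (b : N -> M -> X).
Hypothesis bDl : forall n n' m, b (n + n') m = b n m + b n' m.
Hypothesis bDr : forall n m m', b n (m + m') = b n m + b n m'.
Hypothesis b_bal : forall n a m, b (ra n a) m = b n (la a m).

Lemma tensor_lift_proj (z : {freeg (N * M) / int}) :
  tensor_lift b (zproj tensor_rels z) = fglift (fun nm => b nm.1 nm.2 : zmodule X) z.
Proof.
set L := fglift _.
have LD x y : L (x - y) = L x - L y by exact: lift_is_additive.
have Le n m : L (e n m) = b n m by rewrite /L liftU scale1r.
suff ker : gen tensor_rels `<=` [set w | L w = 0].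
  apply/eqP; rewrite -subr_eq0 -/L /tensor_lift -/L -LD; apply/eqP/ker.
  by apply/zproj_eqE; rewrite /zproj reprK.
apply: smallest_sub.
  split=> [|x y /= Lx Ly]; last by rewrite LD Lx Ly subr0.
  by rewrite /= -(subrr 0) LD subrr.
move=> _ [[n [n' [m ->]]]|[[n [m [m' ->]]]|[n [a [m ->]]]]] /=.
- by rewrite !LD !Le bDl -addrA -opprD subrr.
- by rewrite !LD !Le bDr -addrA -opprD subrr.
- by rewrite !LD !Le b_bal subrr.
Qed.

Lemma tensor_liftE n m : tensor_lift b (tens n m) = b n m.
Proof. by rewrite tensor_lift_proj liftU scale1r. Qed.

Lemma tensor_liftB x y :
  tensor_lift b (x - y) = tensor_lift b x - tensor_lift b y.
Proof.
have projK (z : tensor) : zproj tensor_rels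
    (repr (z : Quotient.quot (gen_pred tensor_rels))) = z.
  by rewrite /zproj reprK.
rewrite -(projK x) -(projK y) -raddfB !tensor_lift_proj.
exact: (@lift_is_additive _ _ (zmodule X)).
Qed.

End Lift.

End Tensor.

Section SRings.
Variables (k : fieldType) (S : algType k).

(* An S-bimodule is a left module over S (x)_k S^op: a k-vector space with
   commuting left and right k-bilinear actions of S. *)
Record bimodule := Bimodule {
  bm_sort :> lmodType k;
  lact : S -> bm_sort -> bm_sort;
  ract : bm_sort -> S -> bm_sort;
  lactDl : forall s t m, lact (s + t) m = lact s m + lact t m;
  lactDr : forall s m n, lact s (m + n) = lact s m + lact s n;
  lactZl : forall c s m, lact (c *: s) m = c *: lact s m;
  lactZr : forall c s m, lact s (c *: m) = c *: lact s m;
  lact1 : forall m, lact 1 m = m;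
  lactM : forall s t m, lact (s * t) m = lact s (lact t m);
  ractDl : forall m n s, ract (m + n) s = ract m s + ract n s;
  ractDr : forall m s t, ract m (s + t) = ract m s + ract m t;
  ractZl : forall c m s, ract (c *: m) s = c *: ract m s;
  ractZr : forall c m s, ract m (c *: s) = c *: ract m s;
  ract1 : forall m, ract m 1 = m;
  ractM : forall m s t, ract m (s * t) = ract (ract m s) t;
  lractA : forall s m t, lact s (ract m t) = ract (lact s m) t
}.

Definition is_bimodule_map (M N : bimodule) (f : {linear M -> N}) : Prop :=
  (forall s m, f (lact s m) = lact s (f m)) /\
  (forall m s, f (ract m s) = ract (f m) s).

Definition regular_bimodule : bimodule.
Proof.
apply: (@Bimodule S (fun s m => s * m) (fun m s => m * s)).
- exact: mulrDl.
- exact: mulrDr.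
- by move=> c s m; rewrite scalerAl.
- by move=> c s m; rewrite scalerAr.
- exact: mul1r.
- by move=> s t m; rewrite mulrA.
- exact: mulrDl.
- exact: mulrDr.
- by move=> c m s; rewrite scalerAl.
- by move=> c m s; rewrite scalerAr.
- exact: mulr1.
- by move=> m s t; rewrite mulrA.
- by move=> s m t; rewrite mulrA.
Defined.

Definition projective_bimodule (Q : bimodule) : Prop :=
  forall (M N : bimodule) (g : {linear M -> N}) (f : {linear Q -> N}),
    is_bimodule_map g -> is_bimodule_map f -> (forall y, exists x, g x = y) ->
    exists h : {linear Q -> M}, is_bimodule_map h /\ forall x, g (h x) = f x.

Definition separable_algebra : Prop := projective_bimodule regular_bimodule.

(* An S-ring over k is the same thing as a k-algebra with a morphism of
   k-algebras from S. *)
Record sring := SRing {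
  sr_sort :> algType k;
  sr_unit : {lrmorphism S -> sr_sort}
}.

(* The augmentation sr_aug is the inverse of S -> T^0 on T^0 and zero in
   positive degrees; it is determined by the other data. *)
Record gsring := GSRing {
  gs_sring :> sring;
  pr : nat -> {additive gs_sring -> gs_sring};
  pr_grading : is_grading pr;
  pr_mul : forall m n x y, homog pr m x -> homog pr n y ->
    homog pr (m + n) (x * y);
  sr_aug : gs_sring -> S;
  sr_unitK : cancel (sr_unit gs_sring) sr_aug;
  sr_augK : forall x, sr_unit gs_sring (sr_aug x) = pr 0 x
}.

Definition subbimodule (B : sring) (P : set B) : Prop :=
  is_subgroup P /\
  forall s x, P x -> P (sr_unit B s * x) /\ P (x * sr_unit B s).

Definition two_sided_ideal (B : sring) (J : set B) : Prop :=
  is_subgroup J /\ forall a x, J x -> J (a * x) /\ J (x * a).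

Definition ideal_gen (B : sring) (X : set B) : set B :=
  smallest (@two_sided_ideal B) X.

Definition is_ring_bimodule_map (V : bimodule) (B : sring) (f : {linear V -> B})
  : Prop :=
  (forall s v, f (lact s v) = sr_unit B s * f v) /\
  (forall v s, f (ract v s) = f v * sr_unit B s).

Definition is_sring_map (B C : sring) (f : {lrmorphism B -> C}) : Prop :=
  forall s, f (sr_unit B s) = sr_unit C s.

Definition is_gsring_map (B C : gsring) (f : {lrmorphism B -> C}) : Prop :=
  is_sring_map f /\ forall n x, f (pr B n x) = pr C n (f x).

(* T_S(V) is characterised, up to isomorphism, by its universal property. *)
Definition is_tensor_ring (V : bimodule) (TT : sring) (j : {linear V -> TT})
  : Prop :=
  is_ring_bimodule_map j /\
  forall (B : sring) (f : {linear V -> B}), is_ring_bimodule_map f ->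
    (exists g : {lrmorphism TT -> B}, is_sring_map g /\ forall v, g (j v) = f v)
    /\ forall g g' : {lrmorphism TT -> B},
         is_sring_map g -> is_sring_map g' ->
         (forall v, g (j v) = f v) -> (forall v, g' (j v) = f v) -> g =1 g'.

(* T = T_S(T^1) / <K0>, where V is T^1 as a bimodule, q is the canonical
   projection and V (x)_S V is identified with the degree two component of
   T_S(V), which is spanned by the products j v * j w. *)
Definition quadratic (T : gsring) : Prop :=
  exists (V : bimodule) (TT : sring) (j : {linear V -> TT})
         (q : {lrmorphism TT -> T}) (K0 : set TT),
    [/\ is_tensor_ring j,
        is_sring_map q /\ set_bij setT (homog (pr T) 1) (q \o j),
        subbimodule K0 /\
        K0 `<=` gen [set x | exists v w, x = j v * j w],
        (forall y, exists x, q x = y)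
      & [set x | q x = 0] = ideal_gen K0].

Section Graded.
Variable T : gsring.

Definition deg_lt (n : nat) : set T := [set x | forall m, (n <= m)%N -> pr T m x = 0].
Definition deg_le (n : nat) : set T := [set x | forall m, (n < m)%N -> pr T m x = 0].
Definition deg_ge (n : nat) : set T := [set x | forall m, (m < n)%N -> pr T m x = 0].

Definition graded_subset (X : set T) : Prop := forall n x, X x -> X (pr T n x).

(* T^1 I + I T^1 *)
Definition decomposables (I : set T) : set T :=
  gen [set z | exists t x, [/\ homog (pr T) 1 t, I x & z = t * x \/ z = x * t]].

Definition is_relation_bimodule (I R : set T) : Prop :=
  [/\ subbimodule R, graded_subset R, R `<=` I,
      I = [set z | exists r d, [/\ R r, decomposables I d & z = r + d]]
    & R `&` decomposables I `<=` [set 0]].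

(* R_P = (+)_n p^n (P^{<= n}) *)
Definition lead_part (P : set T) : set T :=
  [set x | forall n, (pr T n @` (P `&` deg_le n)) (pr T n x)].

(* P_n = \sum_(i + j + l = n) T^{<= i} P^{<= j} T^{<= l} *)
Definition filt (P : set T) (n : nat) : set T :=
  gen [set z | exists i j l, (i + j + l)%N = n /\ exists a x b,
         [/\ deg_le i a, P x /\ deg_le j x, deg_le l b & z = a * x * b]].

Definition jacobi (P : set T) (n : nat) : Prop :=
  filt P n.+1 `&` deg_le n `<=` filt P n.

Definition U_quot (P : set T) : zmodType := zquot (ideal_gen P).
Definition U_proj (P : set T) : T -> U_quot P := zproj (ideal_gen P).

Definition U_le (P : set T) (n : nat) : set (U_quot P) := U_proj P @` deg_le n.
(* U(P)^{<= n - 1}, which is 0 for n = 0 *)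
Definition U_lt (P : set T) (n : nat) : set (U_quot P) := U_proj P @` deg_lt n.

Arguments U_le P n : clear implicits.
Arguments U_lt P n : clear implicits.

(* The degree n component U(P)^{<= n} / U(P)^{<= n - 1} of gr U(P), as the set
   of cosets u + U(P)^{<= n - 1} with u in U(P)^{<= n}. *)
Definition gr_U (P : set T) (n : nat) : set (zquot (U_lt P n)) :=
  zproj (U_lt P n) @` U_le P n.

Arguments gr_U P n : clear implicits.

Definition lead_quot (P : set T) : zmodType := zquot (ideal_gen (lead_part P)).
Definition lead_proj (P : set T) : T -> lead_quot P :=
  zproj (ideal_gen (lead_part P)).

(* phi is the degree n component of Phi_P, and the formula determines it; a
   morphism of graded S-rings is invertible iff it is bijective in each
   degree. *)
Definition PBW_type (P : set T) : Prop :=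
  forall n, exists phi : lead_quot P -> zquot (U_lt P n),
    (forall x, homog (pr T) n x ->
       phi (lead_proj P x) = zproj (U_lt P n) (U_proj P x)) /\
    set_bij (lead_proj P @` homog (pr T) n) (gr_U P n) phi.

End Graded.

Section Tor.
Variable A : gsring.

Definition projective_module (Q : lmodType A) : Prop :=
  forall (M N : lmodType A) (g : {linear M -> N}) (f : {linear Q -> N}),
    (forall y, exists x, g x = y) ->
    exists h : {linear Q -> M}, forall x, g (h x) = f x.

(* A resolution of the left A-module S (through the augmentation, in degree 0)
   by graded projective left A-modules, with differentials of degree 0. *)
Record resolution := Resolution {
  rs_mod : nat -> lmodType A;
  rs_pr : forall i, nat -> {additive rs_mod i -> rs_mod i};
  rs_grading : forall i, is_grading (rs_pr i);
  rs_scale : forall i m n a x, homog (pr A) m a -> homog (rs_pr i) n x ->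
    homog (rs_pr i) (m + n) (a *: x);
  rs_projective : forall i, projective_module (rs_mod i);
  rs_d : forall i, {linear rs_mod i.+1 -> rs_mod i};
  rs_d_pr : forall i n x, rs_d i (rs_pr i.+1 n x) = rs_pr i n (rs_d i x);
  rs_eps : {additive rs_mod 0 -> S};
  rs_eps_lin : forall a x, rs_eps (a *: x) = sr_aug a * rs_eps x;
  rs_eps_pr : forall n x, rs_eps (rs_pr 0 n x) = if n == 0%N then rs_eps x else 0;
  rs_eps_surj : forall s, exists x, rs_eps x = s;
  rs_exact0 : forall x, rs_eps x = 0 <-> exists y, x = rs_d 0 y;
  rs_exact : forall i x, rs_d i x = 0 <-> exists y, x = rs_d i.+1 y
}.

Definition S_ract (s : S) (a : A) : S := s * sr_aug a.

Section Homology.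
Variable Q : resolution.

Definition cpx (i : nat) : zmodType :=
  tensor S_ract (fun (a : A) (x : rs_mod Q i) => a *: x).

Definition cpx_tens (i : nat) (s : S) (x : rs_mod Q i) : cpx i := tens _ _ s x.

Definition cpx_deg (i n : nat) : set (cpx i) :=
  gen [set z | exists s x, homog (rs_pr Q i) n x /\ z = cpx_tens s x].

Arguments cpx_deg i n : clear implicits.

(* id_S (x) d : S (x)_A Q_{i+1} -> S (x)_A Q_i *)
Definition cpx_d (i : nat) : cpx i.+1 -> cpx i :=
  tensor_lift (fun s x => cpx_tens s (rs_d Q i x)).

Lemma cpx_dE i s x : cpx_d (cpx_tens s x) = cpx_tens s (rs_d Q i x).
Proof.
rewrite /cpx_d /cpx_tens tensor_liftE // => [t t' y|t y y'|t a y].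
- exact: tensDl.
- by rewrite raddfD; exact: tensDr.
- by rewrite linearZ; exact: (tens_bal S_ract (fun (a : A) x => a *: x)).
Qed.

Definition boundaries3 : set (cpx 3) := range (@cpx_d 3).

(* The degree n component of H_3 (S (x)_A Q), as the set of homology classes of
   the 3-cycles of degree n. *)
Definition Tor3_at (n : nat) : set (zquot boundaries3) :=
  zproj boundaries3 @` [set x | cpx_deg 3 n x /\ cpx_d x = 0 :> cpx 2].

End Homology.

Arguments Tor3_at Q n : clear implicits.

(* Tor^A_{3,n}(S,S) is computed by an arbitrary graded projective resolution;
   up to isomorphism the choice does not matter. *)
Definition Tor3_neq0 (n : nat) : Prop := exists Q, Tor3_at Q n <> [set 0].

(* c(A), in the integers extended by -oo and +oo. *)
Definition c_inv : \bar int :=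
  if `[< forall n, ~ Tor3_neq0 n >] then (-1)%:E
  else supremum (-1)%:E [set (n%:Z - 1)%:E | n in Tor3_neq0].

End Tor.
End SRings.

Arguments U_le {k S T} P n _ : rename.
Arguments U_lt {k S T} P n _ : rename.
Arguments gr_U {k S T} P n _ : rename.
Arguments cpx_deg {k S A} Q i n _ : rename.
Arguments Tor3_at {k S A} Q n _ : rename.

(* Main.v *)
Require Import Defs.
From HB Require Import structures.
From mathcomp Require Import all_boot all_order all_algebra.
From mathcomp Require Import boolp classical_sets functions constructive_ereal.
From mathcomp.multinomials Require Import freeg.

Set Implicit Arguments.
Unset Strict Implicit.
Unset Printing Implicit Defensive.

Import Order.TTheory GRing.Theory Num.Theory.
Local Open Scope ring_scope.
Local Open Scope classical_set_scope.

(* Write T = F / K with F = T_S(V) a tensor ring, so that A = F / J; let F_+ be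
   the augmentation ideal of F. P is of PBW-type iff the leading terms of the
   elements of <P> lie in <R>, that is, iff <P> meets T^(<= n) in P_n for all n,
   that is, iff all (J_n) hold. So it suffices that (J_(n-1)) and
   Tor_(3,n+1) = 0 imply (J_n).

   Let Phi_n be the preimage of P_n in F^(<= n). Up to P_n, an element of
   P_(n+1) of degree <= n is the image of x1 + x2 with x1 in V Phi_n, x2 in
   Phi_n V and opposite components w, - w of degree n+1. Then w lies in both
   F_+ J and J F_+, hence in F_+ J F_+ + J^2 by Govorov's formula
   Tor_3 = (J F_+ /\ F_+ J) / (F_+ J F_+ + J^2). An element of
   F_+ J F_+ + J^2 of degree n+1 lifts to w1 in V Phi_n and to w2 in Phi_n V
   with w1 - w2 in Phi_n, by lifting either factor of a product. Finally
   x1 - w1 and x2 + w2 lie in Phi_n because F_+ = V (x)_S F = F (x)_S V and by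
   (J_(n-1)).

   Govorov's formula comes from comparing a free resolution of S with the
   Gruenberg resolution J/J^2 -> F_+/JF_+ -> A. Separability is used to average
   k-linear sections into S-linear ones. The universal property of F is used
   through representations: a map to End_k(X) is an action of F on X. *)

(** * Subgroups and linear sections *)

(** The passage to F is forced by the comparison of top components: the multiplication V (x)_S T ->
    T_+ need not be injective, so in T an element of V P_n without component of degree n+1 is not
    under control, whereas in F it is. The price is ker q = K: a sum x1 + x2 whose component of
    degree n+1 vanishes in T has in F a component in K. Since T is quadratic, K in degree n+1 >= 3
    is V K^n + K^n V, which lies in V Phi_n + Phi_n V and can be subtracted. This fails for n = 1,
    so (J_1) has an argument of its own. The condition (J_n) is decided in degree n+1, hence by
    Tor_(3,n+1); this is the shift by one in c(A). F is known through its universal property alone,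
    and V has no basis over S. Its freeness is therefore expressed by maps: for S-linear t, the rule
    v y |-> v t(y) is well defined on F_+. Such maps D replace computations in tensor products, and
    averaging over S supplies the maps t. Tor refers to arbitrary resolutions, so its vanishing may
    be applied to one whose generators in the first two steps come with lifts to F. *)

Section Subgroups.
Implicit Types V W : zmodType.

Lemma subgroupN V (X : set V) x : is_subgroup X -> X x -> X (- x).
Proof. by move=> [X0 XB] Xx; rewrite -[- x]add0r; exact: XB. Qed.

Lemma subgroupD V (X : set V) x y : is_subgroup X -> X x -> X y -> X (x + y).
Proof.
move=> XP Xx Xy; rewrite -[y]opprK; apply: XP.2 => //; exact: subgroupN.
Qed.

Lemma subgroup_sum V (X : set V) (I : Type) (r : seq I) (P : pred I) (f : I -> V) :
  is_subgroup X -> (forall i, P i -> X (f i)) -> X (\sum_(i <- r | P i) f i).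
Proof.
move=> XP Xf; apply: big_ind => //; first exact: XP.1.
by move=> x y; exact: subgroupD.
Qed.

Lemma subgroup_setI V (X Y : set V) :
  is_subgroup X -> is_subgroup Y -> is_subgroup (X `&` Y).
Proof.
move=> XP YP; split; first by split; [exact: XP.1|exact: YP.1].
by move=> x y [Xx Yx] [Xy Yy]; split; [exact: XP.2|exact: YP.2].
Qed.

Lemma subgroup_preimage V W (f : V -> W) (Y : set W) :
  zmod_morphism f -> is_subgroup Y -> is_subgroup (f @^-1` Y).
Proof.
move=> fB YP; split=> [|x y Yx Yy]; rewrite /preimage /=.
  by rewrite -(subrr (0 : V)) fB subrr; exact: YP.1.
by rewrite fB; exact: YP.2.
Qed.

Lemma subgroup_set0 V : is_subgroup [set 0 : V].
Proof. by split=> // x y -> ->; rewrite /= subr0. Qed.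

Lemma sub_gen V (X : set V) : X `<=` gen X.
Proof. exact: sub_gen_smallest. Qed.

Lemma gen_min V (X Y : set V) : is_subgroup Y -> X `<=` Y -> gen X `<=` Y.
Proof. exact: smallest_sub. Qed.

Lemma gen_id V (X : set V) : is_subgroup X -> gen X = X.
Proof. by move=> XP; apply/seteqP; split; [exact: gen_min|exact: sub_gen]. Qed.

Lemma gen_morph V W (f : V -> W) (X : set V) (Y : set W) :
  zmod_morphism f -> is_subgroup Y -> (forall x, X x -> Y (f x)) ->
  forall x, gen X x -> Y (f x).
Proof.
by move=> fB YP XY; apply: gen_min; first exact: subgroup_preimage.
Qed.

Definition sums V (X Y : set V) : set V :=
  [set z | exists x y, [/\ X x, Y y & z = x + y]].

Lemma sums_subgroup V (X Y : set V) :
  is_subgroup X -> is_subgroup Y -> is_subgroup (sums X Y).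
Proof.
move=> XP YP; split; first by exists 0, 0; rewrite addr0; split => //;
  [exact: XP.1|exact: YP.1].
move=> _ _ [x [y [Xx Yy ->]]] [x' [y' [Xx' Yy' ->]]].
by exists (x - x'), (y - y'); split; [exact: XP.2|exact: YP.2|rewrite opprD addrACA].
Qed.

Lemma sumsl V (X Y : set V) : is_subgroup Y -> X `<=` sums X Y.
Proof. by move=> YP x Xx; exists x, 0; rewrite addr0; split=> //; exact: YP.1. Qed.

Lemma sumsr V (X Y : set V) : is_subgroup X -> Y `<=` sums X Y.
Proof. by move=> XP y Yy; exists 0, y; rewrite add0r; split=> //; exact: XP.1. Qed.

Lemma zproj_surj V (X : set V) (y : zquot X) : exists x, zproj X x = y.
Proof. by exists (repr (y : Quotient.quot (gen_pred X))); rewrite /zproj reprK. Qed.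

Lemma zproj_eq V (X : set V) x y :
  is_subgroup X -> zproj X x = zproj X y <-> X (x - y).
Proof. by move=> XP; rewrite zproj_eqE gen_id. Qed.

Lemma zproj_eq0 V (X : set V) x : is_subgroup X -> zproj X x = 0 <-> X x.
Proof. by move=> XP; rewrite -(raddf0 (zproj X)) zproj_eq// subr0. Qed.

Lemma zmod_morphD V W (f : V -> W) :
  (forall x y, f (x + y) = f x + f y) -> zmod_morphism f.
Proof. by move=> fD x y; have := fD (x - y) y; rewrite subrK => ->; rewrite addrK. Qed.

End Subgroups.

Section Products.
Variable B : nzRingType.

Definition prods (X Y : set B) : set B :=
  gen [set z | exists x y, [/\ X x, Y y & z = x * y]].

Lemma prods_subgroup X Y : is_subgroup (prods X Y).
Proof. exact: gen_subgroup. Qed.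

Lemma mem_prods (X Y : set B) x y : X x -> Y y -> prods X Y (x * y).
Proof. by move=> Xx Yy; apply: sub_gen; exists x, y. Qed.

Lemma prods_min (X Y Z : set B) :
  is_subgroup Z -> (forall x y, X x -> Y y -> Z (x * y)) -> prods X Y `<=` Z.
Proof. by move=> ZP XYZ; apply: gen_min => // _ [x [y [Xx Yy ->]]]; exact: XYZ. Qed.

Lemma prods_morph (W : zmodType) (f : B -> W) (X Y : set B) (Z : set W) :
  zmod_morphism f -> is_subgroup Z ->
  (forall x y, X x -> Y y -> Z (f (x * y))) -> forall z, prods X Y z -> Z (f z).
Proof.
move=> fB ZP XYZ; apply: gen_morph => // _ [x [y [Xx Yy ->]]]; exact: XYZ.
Qed.

Lemma subgroup_mull (a : B) (X : set B) :
  is_subgroup X -> is_subgroup [set x | X (a * x)].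
Proof. by move=> XP; apply: (@subgroup_preimage _ _ (fun x => a * x)) => // x y;
  rewrite mulrBr. Qed.

Lemma subgroup_mulr (a : B) (X : set B) :
  is_subgroup X -> is_subgroup [set x | X (x * a)].
Proof. by move=> XP; apply: (@subgroup_preimage _ _ (fun x => x * a)) => // x y;
  rewrite mulrBl. Qed.

End Products.

Section LinearSections.
Variables (k : fieldType) (Y X : lmodType k).

Section Relation.
Variable D : Y -> X -> Prop.
Hypothesis D_lin : forall c y x y' x', D y x -> D y' x' -> D (c *: y + y') (c *: x + x').

Let partial_section (G : set (Y * X)) : Prop :=
  [/\ forall c u v, G u -> G v -> G (c *: u + v),
      forall x, G (0, x) -> x = 0
    & forall y x x', G (y, x) -> D y x' -> D y x].

(* Zorn's lemma for the partial linear sections whose graph respects D. *)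
Lemma linear_section : exists t : Y -> X,
  (forall c y y', t (c *: y + y') = c *: t y + t y') /\
  forall y x, D y x -> D y (t y).
Proof.
have [F FP Ftot|G [[Glin Gfun GD] Gmax]] := @Zorn_bigcup _ partial_section.
  split=> [c u v [G FG Gu] [H FH Hv]|x [G FG Gx]|y x x' [G FG Gx]].
  - have [GH|HG] := Ftot _ _ FG FH.
    + by exists H => //; have [Hl _ _] := FP _ FH; apply: Hl => //; exact: GH.
    + by exists G => //; have [Gl _ _] := FP _ FG; apply: Gl => //; exact: HG.
  - by have [_ + _] := FP _ FG; apply.
  - by have [_ _ +] := FP _ FG; apply; exact: Gx.
have G0 : G (0, 0).
  apply: contrapT => nG0; have [[u Gu]|GE] := pselect (exists u, G u).
    by apply: nG0; have := Glin (-1) _ _ Gu Gu; rewrite scaleN1r addNr.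
  apply: (Gmax [set (0, 0)]).
    split; last by move=> /(_ (0, 0) erefl).
    by move=> u Gu; case: GE; exists u.
  split=> [c u v -> ->|x [->]//|y x x' [-> ->] Dx'].
    by rewrite /= scaler0 addr0.
  by have := D_lin (-1) Dx' Dx'; rewrite !scaleN1r !addNr.
have GB u v : G u -> G v -> G (u - v).
  by move=> Gu Gv; rewrite addrC -scaleN1r; exact: Glin.
have GZ c u : G u -> G (c *: u) by move=> Gu; rewrite -[_ *: _]addr0; exact: Glin.
have Gtot y0 : exists x, G (y0, x).
  apply: contrapT => ny0.
  (* One translate y + y0 in the domain of [D] determines a good value at y0; any other differs from
     it by an element of the domain of G, where G already respects [D]. *)
  have [x0 x0P] : exists x0, forall y x, G (y, x) -> (exists x', D (y + y0) x') ->
      D (y + y0) (x + x0).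
    have [[y [x [Gyx [x' Dx']]]]|nD] :=
      pselect (exists y x, G (y, x) /\ exists x', D (y + y0) x').
      exists (x' - x) => y1 x1 G1 [x2 D2].
      have DB : D (y1 - y) (x1 - x).
        apply: (GD _ _ (x2 - x')); first exact: (GB (_, _) (_, _)).
        have := D_lin (-1) Dx' D2.
        by rewrite !scaleN1r addrC opprD addrACA subrr addr0 [_ + x2]addrC.
      have := D_lin 1 DB Dx'; rewrite !scale1r.
      by rewrite addrA subrK addrAC -addrA.
    by exists 0 => y x Gyx Dy; exfalso; apply: nD; exists y, x.
  pose H := [set u | exists c, G (u - c *: (y0, x0))].
  have GH : G `<=` H by move=> u Gu; exists 0; rewrite scale0r subr0.
  have uniqc c x : G (0 - c *: y0, x) -> c = 0.
    move=> Gc; apply: contrapT => /eqP c0; apply: ny0; exists (- c^-1 *: x).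
    have := GZ (- c^-1) _ Gc; congr G; congr pair.
    by rewrite /= sub0r scalerN scaleNr opprK scalerA mulVf// scale1r.
  apply: (Gmax H).
    split=> // HG; apply: ny0; exists x0; apply: HG.
    by exists 1; rewrite scale1r subrr.
  split=> [c u v [a Ga] [b Gb]|x [c Gc]|y x x' [c Gc] Dx'].
  - exists (c * a + b); have := Glin c _ _ Ga Gb; congr G.
    by rewrite scalerBr scalerA addrACA -opprD -scalerDl.
  - have c0 := uniqc _ _ Gc; move: Gc; rewrite c0 scale0r subr0; exact: Gfun.
  - have [c0|c0] := eqVneq c 0.
      by move: Gc; rewrite c0 scale0r subr0 => Gyx; exact: GD Dx'.
    have D0 : D 0 0 by have := D_lin (-1) Dx' Dx'; rewrite !scaleN1r !addNr.
    (* Dividing by c makes the coefficient of y0 equal to 1, the case covered by the choice of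
       x0. *)
    have yE : c^-1 *: y = c^-1 *: (y - c *: y0) + y0.
      by rewrite scalerBr scalerA mulVf// scale1r subrK.
    have xE : c^-1 *: x = c^-1 *: (x - c *: x0) + x0.
      by rewrite scalerBr scalerA mulVf// scale1r subrK.
    have : D (c^-1 *: y) (c^-1 *: x).
      rewrite yE xE; apply: x0P; first exact: GZ Gc.
      exists (c^-1 *: x'); rewrite -yE.
      by have := D_lin c^-1 Dx' D0; rewrite !addr0.
    move=> /(D_lin c) /(_ D0); rewrite !addr0 !scalerA mulfV// !scale1r.
    exact.
have [t tP] := choice Gtot.
have tE y x : G (y, x) -> t y = x.
  move=> Gyx; apply/eqP; rewrite -subr_eq0; apply/eqP/Gfun.
  by rewrite -(subrr y); exact: (GB (_, _) (_, _)).
exists t; split=> [c y y'|y x Dx]; last exact: GD Dx.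
by apply: tE; exact: (Glin c (_, _) (_, _)).
Qed.

End Relation.
End LinearSections.

Definition mk_additive (U V : zmodType) (f : U -> V) (fB : zmod_morphism f) :
  {additive U -> V} := HB.pack f (GRing.isZmodMorphism.Build U V f fB).

Definition mk_linear (R : nzRingType) (U V : lmodType R) (f : U -> V)
    (fB : zmod_morphism f) (fZ : scalable f) : {linear U -> V} :=
  HB.pack f (GRing.isZmodMorphism.Build U V f fB) (GRing.isScalable.Build R U V *:%R f
    fZ).

(** * Separability *)

Section TensorInduction.
Variables (A : Type) (N M : zmodType) (ra : N -> A -> N) (la : A -> M -> M).

Lemma tensor_ind (Y : set (tensor ra la)) :
  is_subgroup Y -> (forall n m, Y (tens ra la n m)) -> forall t, Y t.
Proof.
move=> YP Yt t; have [z <-] := zproj_surj t.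
rewrite -(freeg_sumE z) raddf_sum; apply: subgroup_sum => // p _; case: p => n m.
rewrite -[coeff _ _]intz -freegU_mulz raddfMz.
have Ynat i : Y (zproj (tensor_rels ra la) << (n, m) >> *+ i).
  by elim: i => [|i IH]; [exact: YP.1|rewrite mulrS; apply: subgroupD => //; exact: Yt].
case: (coeff _ _) => i; first by rewrite -pmulrn; exact: Ynat.
by rewrite NegzE mulrNz -pmulrn; apply: subgroupN => //; exact: Ynat.
Qed.

Lemma tensor_ext (X : zmodType) (f g : tensor ra la -> X) :
  zmod_morphism f -> zmod_morphism g ->
  (forall n m, f (tens ra la n m) = g (tens ra la n m)) -> f =1 g.
Proof.
move=> fB gB fg t; apply: (@tensor_ind [set t | f t = g t]) => //.
split=> [|x y /= fgx fgy]; last by rewrite /= fB gB fgx fgy.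
by rewrite /= -(subrr (0 : tensor ra la)) fB gB !subrr.
Qed.

Lemma tens0l m : tens ra la 0 m = 0.
Proof. by apply: (addrI (tens ra la 0 m)); rewrite -tensDl !addr0. Qed.

Lemma tensNl n m : tens ra la (- n) m = - tens ra la n m.
Proof. by apply/eqP; rewrite -addr_eq0 -tensDl addNr tens0l. Qed.

Lemma tens_sumE (t : tensor ra la) :
  exists e : seq (N * M), t = \sum_(p <- e) tens ra la p.1 p.2.
Proof.
apply: (@tensor_ind [set t | exists e :
  seq (N * M), t = \sum_(p <- e) tens ra la p.1 p.2]).
  split=> [|_ _ [e ->] [e' ->]]; first by exists [::]; rewrite big_nil.
  exists (e ++ [seq (- p.1, p.2) | p <- e']); rewrite big_cat big_map -sumrN.
  by congr (_ + _); apply: eq_bigr => p _; rewrite tensNl.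
by move=> n m; exists [:: (n, m)]; rewrite big_seq1.
Qed.

End TensorInduction.

Section SeparabilityIdempotent.
Variables (k : fieldType) (S : algType k).

Local Notation ra := (fun (s : S) (c : k) => c *: s).
Local Notation la := (fun (c : k) (s : S) => c *: s).

(** S (x)_k S under a name of its own, to which its k-module structure is attached. *)
Definition SkS : Type := tensor ra la.
HB.instance Definition _ := GRing.Zmodule.on SkS.

Local Notation "a (x) b" := (tens ra la a b : SkS) (at level 30).

Definition SkS_map (f g : {linear S -> S}) : SkS -> SkS :=
  tensor_lift (fun a b => f a (x) g b).

Lemma SkS_mapE f g a b : SkS_map f g (a (x) b) = f a (x) g b.
Proof.
rewrite /SkS_map tensor_liftE // => [n n' m|n m m'|n c m].
- by rewrite raddfD; exact: tensDl.
- by rewrite raddfD; exact: tensDr.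
- by rewrite !linearZ; exact: tens_bal.
Qed.

Lemma SkS_mapB f g : zmod_morphism (SkS_map f g).
Proof.
move=> x y; rewrite /SkS_map tensor_liftB // => [n n' m|n m m'|n c m].
- by rewrite raddfD; exact: tensDl.
- by rewrite raddfD; exact: tensDr.
- by rewrite !linearZ; exact: tens_bal.
Qed.

Lemma SkS_mapD f g x y : SkS_map f g (x + y) = SkS_map f g x + SkS_map f g y.
Proof.
have N z : SkS_map f g (- z) = - SkS_map f g z.
  by rewrite -[- z]sub0r SkS_mapB -(subrr (0 : SkS)) SkS_mapB subrr sub0r.
by rewrite -{1}[y]opprK SkS_mapB N opprK.
Qed.

Lemma zmod_morphism_comp (U V W : zmodType) (f : V -> W) (g : U -> V) :
  zmod_morphism f -> zmod_morphism g -> zmod_morphism (f \o g).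
Proof. by move=> fB gB x y; rewrite /= gB fB. Qed.

Lemma zmod_morphism_add (U V : zmodType) (f g : U -> V) :
  zmod_morphism f -> zmod_morphism g -> zmod_morphism (fun x => f x + g x).
Proof. by move=> fB gB x y; rewrite fB gB opprD addrACA. Qed.

(** Each bimodule axiom of S (x)_k S is an identity between maps f (x) g. The resulting factors are
    prescribed by their values, so that it does not matter how they are presented as linear maps. *)
Lemma SkS_map_comp (f g f' g' f'' g'' : {linear S -> S}) x :
  (forall a, f (f' a) = f'' a) -> (forall a, g (g' a) = g'' a) ->
  SkS_map f g (SkS_map f' g' x) = SkS_map f'' g'' x.
Proof.
move=> ff gg; apply: (tensor_ext (f := SkS_map f g \o SkS_map f' g')).
- by apply: zmod_morphism_comp; exact: SkS_mapB.
- exact: SkS_mapB.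
- by move=> a b; rewrite /= !SkS_mapE ff gg.
Qed.

Lemma SkS_map_addl (f f' f'' g : {linear S -> S}) x :
  (forall a, f a + f' a = f'' a) -> SkS_map f g x + SkS_map f' g x = SkS_map f'' g x.
Proof.
move=> ff; apply: (tensor_ext (f := fun x => SkS_map f g x + SkS_map f' g x)).
- by apply: zmod_morphism_add; exact: SkS_mapB.
- exact: SkS_mapB.
- by move=> a b; rewrite !SkS_mapE -ff; symmetry; exact: tensDl.
Qed.

Lemma SkS_map_addr (f g g' g'' : {linear S -> S}) x :
  (forall a, g a + g' a = g'' a) -> SkS_map f g x + SkS_map f g' x = SkS_map f g'' x.
Proof.
move=> gg; apply: (tensor_ext (f := fun x => SkS_map f g x + SkS_map f g' x)).
- by apply: zmod_morphism_add; exact: SkS_mapB.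
- exact: SkS_mapB.
- by move=> a b; rewrite !SkS_mapE -gg; symmetry; exact: tensDr.
Qed.

Lemma SkS_map_id (f g : {linear S -> S}) x :
  (forall a, f a = a) -> (forall a, g a = a) -> SkS_map f g x = x.
Proof.
move=> ff gg; apply: (tensor_ext (f := SkS_map f g) (g := id)) => //.
  exact: SkS_mapB.
by move=> a b; rewrite SkS_mapE ff gg.
Qed.

Lemma SkS_mapZ c (f g f' g' : {linear S -> S}) x :
  (forall a, f' a = c *: f a) -> (forall a, c *: g a = g' a) ->
  SkS_map f' g x = SkS_map f g' x.
Proof.
move=> ff gg; apply: tensor_ext => [||a b]; [exact: SkS_mapB|exact: SkS_mapB|].
by rewrite !SkS_mapE ff -gg; exact: tens_bal.
Qed.

Let idl : {linear S -> S} := idfun.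
Let scl (c : k) : {linear S -> S} := c \*: idfun.
Let mull (s : S) : {linear S -> S} := s \*o idfun.
Let mulr (s : S) : {linear S -> S} := s \o* idfun.

Let scale (c : k) : SkS -> SkS := SkS_map (scl c) idl.

Let scaleA a b v : scale a (scale b v) = scale (a * b) v.
Proof. by apply: SkS_map_comp => // x /=; rewrite scalerA. Qed.

Let scale1 : left_id 1 scale.
Proof. by move=> v; apply: SkS_map_id => // x /=; rewrite scale1r. Qed.

Let scaleDr : right_distributive scale +%R.
Proof. by move=> c x y; exact: SkS_mapD. Qed.

Let scaleDl v : {morph scale^~ v : a b / a + b}.
Proof. by move=> a b; symmetry; apply: SkS_map_addl => x /=; rewrite scalerDl. Qed.

HB.instance Definition _ :=
  GRing.Zmodule_isLmodule.Build k SkS scaleA scale1 scaleDr scaleDl.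

Definition SkS_bimodule : bimodule S.
Proof.
pose l (s : S) (m : SkS) : SkS := SkS_map (mull s) idl m.
pose r (m : SkS) (s : S) : SkS := SkS_map idl (mulr s) m.
unshelve eapply (@Bimodule k S (SkS : lmodType k) l r).
- by move=> s t m; symmetry; apply: SkS_map_addl => a /=; rewrite mulrDl.
- by move=> s m n; exact: SkS_mapD.
- move=> c s m; symmetry; apply: SkS_map_comp => // a /=; by rewrite scalerAl.
- move=> c s m; rewrite [LHS](@SkS_map_comp _ _ _ _ (mull (c *: s)) idl)// => [|a /=];
    last by rewrite -scalerAr scalerAl.
  symmetry; apply: SkS_map_comp => // a /=; by rewrite scalerAl.
- by move=> m; apply: SkS_map_id => // a /=; rewrite mul1r.
- by move=> s t m; symmetry; apply: SkS_map_comp => // a /=; rewrite mulrA.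
- by move=> m n s; exact: SkS_mapD.
- by move=> m s t; symmetry; apply: SkS_map_addr => a /=; rewrite mulrDr.
- move=> c m s; rewrite [LHS](@SkS_map_comp _ _ _ _ (scl c) (mulr s))//.
  by symmetry; apply: SkS_map_comp.
- move=> c m s; rewrite [RHS](@SkS_map_comp _ _ _ _ (scl c) (mulr s))//.
  by symmetry; apply: (@SkS_mapZ c) => // a /=; rewrite scalerAr.
- by move=> m; apply: SkS_map_id => // a /=; rewrite mulr1.
- by move=> m s t; symmetry; apply: SkS_map_comp => // a /=; rewrite mulrA.
- move=> s m t; rewrite [LHS](@SkS_map_comp _ _ _ _ (mull s) (mulr t))//.
  by symmetry; apply: SkS_map_comp.
Defined.

(** Projectivity splits the multiplication S (x)_k S -> S by a bimodule map h; e represents h 1, and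
    s h(1) = h(s) = h(1) s. Centrality is tested against k-balanced maps b, which is how the
    averages use it. *)
Lemma separability_idempotent : separable_algebra S ->
  exists e : seq (S * S), \sum_(p <- e) p.1 * p.2 = 1 /\
  forall (X : zmodType) (b : S -> S -> X),
    (forall x x' y, b (x + x') y = b x y + b x' y) ->
    (forall x y y', b x (y + y') = b x y + b x y') ->
    (forall c x y, b (c *: x) y = b x (c *: y)) ->
    forall s, \sum_(p <- e) b (s * p.1) p.2 = \sum_(p <- e) b p.1 (p.2 * s).
Proof.
move=> /(_ SkS_bimodule (regular_bimodule S)) sepS.
pose mu : SkS -> S := tensor_lift (fun a b => a * b).
have muE a b : mu (a (x) b) = a * b.
  by rewrite /mu tensor_liftE// => *; rewrite ?mulrDl ?mulrDr// -scalerAl scalerAr.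
have muB : zmod_morphism mu.
  by move=> x y; rewrite /mu tensor_liftB// => *;
    rewrite ?mulrDl ?mulrDr// -scalerAl scalerAr.
have mu_map (f g h : {linear S -> S}) x : (forall a b, f a * g b = h (a * b)) ->
    mu (SkS_map f g x) = h (mu x).
  move=> fgh; apply: (tensor_ext (f := mu \o SkS_map f g) (g := h \o mu)).
  - by apply: zmod_morphism_comp => //; exact: SkS_mapB.
  - by apply: zmod_morphism_comp => //; exact: raddfB.
  - by move=> a b; rewrite /= SkS_mapE !muE.
have muZ : scalable (mu : SkS -> S).
  by move=> c x; apply: (mu_map _ _ (scl c)) => a b /=; rewrite scalerAl.
pose mul : {linear SkS_bimodule -> regular_bimodule S} :=
  mk_linear muB muZ.
have mul_bim : is_bimodule_map mul.
  by split=> [s m|m s];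
    [apply: (mu_map _ _ (mull s))|apply: (mu_map _ _ (mulr s))] => a b /=; rewrite mulrA.
have id_bim : is_bimodule_map (idl : {linear regular_bimodule S -> regular_bimodule S}).
  by split.
have mul_surj y : exists x, mul x = y by exists (y (x) 1); rewrite [LHS]muE mulr1.
have [h [[hl hr] hmu]] := sepS mul idl mul_bim id_bim mul_surj.
have [e hE] := tens_sumE (h 1 : SkS).
exists e; split.
  have := hmu 1; rewrite /= => <-; rewrite [RHS](_ : _ = mu (h 1))// hE.
  rewrite -[mu _]/((mul : {additive _ -> _}) _) raddf_sum.
  by apply: eq_bigr => p _; rewrite [RHS]muE.
move=> X b bDl bDr bZ s.
pose B : SkS -> X := tensor_lift b.
have BB : zmod_morphism B by move=> x y; exact: tensor_liftB.
have BE x y : B (x (x) y) = b x y by exact: tensor_liftE.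
have Bsum (f : SkS -> X) : zmod_morphism f -> f (h 1) = \sum_(p <- e) f (p.1 (x) p.2).
  move=> fB; rewrite hE -[f]/(GRing.Additive.sort (mk_additive fB)).
  by rewrite raddf_sum.
have hs : SkS_map (mull s) idl (h 1) = SkS_map idl (mulr s) (h 1).
  apply: etrans (esym (hl s 1)) (etrans _ (hr 1 s)).
  by congr (h _); rewrite /= mulr1 mul1r.
have := congr1 B hs.
have BmapB f g : zmod_morphism (B \o SkS_map f g).
  by apply: zmod_morphism_comp => //; exact: SkS_mapB.
rewrite -/((B \o SkS_map (mull s) idl) (h 1)) (Bsum _ (BmapB _ _)).
rewrite -/((B \o SkS_map idl (mulr s)) (h 1)) (Bsum _ (BmapB _ _)).
under eq_bigr do rewrite /= SkS_mapE BE.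
by under [RHS]eq_bigr do rewrite /= SkS_mapE BE.
Qed.

End SeparabilityIdempotent.

(** * Averaging linear sections over S *)

Section EquivariantSections.
Variables (k : fieldType) (S : algType k).

Definition kbilinear (U V W : lmodType k) (f : U -> V -> W) : Prop :=
  (forall c u u' v, f (c *: u + u') v = c *: f u v + f u' v) /\
  (forall c u v v', f u (c *: v + v') = c *: f u v + f u v').

Section Averaging.
(* mul is the product of S or of its opposite. *)
Variables (mul : S -> S -> S) (e : seq (S * S)).
Hypothesis e1 : \sum_(p <- e) mul p.1 p.2 = 1.
Hypothesis eC : forall (X : zmodType) (b : S -> S -> X),
    (forall x x' y, b (x + x') y = b x y + b x' y) ->
    (forall x y y', b x (y + y') = b x y + b x y') ->
    (forall c x y, b (c *: x) y = b x (c *: y)) ->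
    forall s, \sum_(p <- e) b (mul s p.1) p.2 = \sum_(p <- e) b p.1 (mul p.2 s).

Variables (Y X : lmodType k) (aY : S -> Y -> Y) (aX : S -> X -> X).
Hypotheses (aY_lin : kbilinear aY) (aX_lin : kbilinear aX).
Hypotheses (aY1 : forall y, aY 1 y = y).
Hypotheses (aYM : forall s t y, aY (mul s t) y = aY s (aY t y)).
Hypotheses (aXM : forall s t x, aX (mul s t) x = aX s (aX t x)).
Variable D : Y -> X -> Prop.
Hypothesis D_lin : forall c y x y' x', D y x -> D y' x' -> D (c *: y + y') (c *: x + x').
Hypothesis D_act : forall s y x, D y x -> D (aY s y) (aX s x).

Lemma averaged_section : exists t : Y -> X,
  [/\ forall c y y', t (c *: y + y') = c *: t y + t y',
      forall s y, t (aY s y) = aX s (t y)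
    & forall y x, D y x -> D y (t y)].
Proof.
have [t0 [t0_lin t0D]] := linear_section D_lin.
have [aYl aYr] := aY_lin; have [aXl aXr] := aX_lin.
have aYD s s' y : aY (s + s') y = aY s y + aY s' y by have := aYl 1 s s' y;
  rewrite !scale1r.
have aXD s s' y : aX (s + s') y = aX s y + aX s' y by have := aXl 1 s s' y;
  rewrite !scale1r.
have aY0s y : aY 0 y = 0 by apply: (addrI (aY 0 y)); rewrite -aYD !addr0.
have aX0s y : aX 0 y = 0 by apply: (addrI (aX 0 y)); rewrite -aXD !addr0.
have aX0 s : aX s 0 = 0.
  by have := aXr 1 s 0 0; rewrite !scale1r addr0 => /(canLR (addKr _)); rewrite addNr.
have aXDr s x x' : aX s (x + x') = aX s x + aX s x'.
  by have := aXr 1 s x x'; rewrite !scale1r.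
have t0D' y y' : t0 (y + y') = t0 y + t0 y' by have := t0_lin 1 y y'; rewrite !scale1r.
have t00 : t0 0 = 0 by apply: (addrI (t0 0)); rewrite -t0D' !addr0.
have aXsum s (F : S * S -> X) : aX s (\sum_(p <- e) F p) = \sum_(p <- e) aX s (F p).
  by apply: (big_morph (aX s)) => // x y; exact: aXDr.
exists (fun y => \sum_(p <- e) aX p.1 (t0 (aY p.2 y))); split=> [c y y'|s y|y x Dyx].
- rewrite scaler_sumr -big_split; apply: eq_bigr => p _.
  by rewrite aYr t0_lin aXr.
- rewrite aXsum; symmetry; under eq_bigr do rewrite -aXM.
  under [RHS]eq_bigr do rewrite -aYM.
  apply: (eC (b := fun a b => aX a (t0 (aY b y)))) => [a a' b|a b b'|c a b].
  + exact: aXD.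
  + by rewrite aYD t0D' aXDr.
  + rewrite -[c *: a]addr0 aXl aX0s addr0 -[c *: b]addr0 aYl aY0s addr0.
    by rewrite -[c *: aY b y]addr0 t0_lin t00 addr0 -[c *: t0 _]addr0 aXr aX0 addr0.
- have D0 : D 0 0 by have := D_lin (-1) Dyx Dyx; rewrite !scaleN1r !addNr.
  have {1}-> : y = \sum_(p <- e) aY p.1 (aY p.2 y).
    under eq_bigr do rewrite -aYM.
    rewrite -[LHS]aY1 -e1; apply: (big_morph (aY^~ y)) => // a b; exact: aYD.
  apply: (big_rec2 D) => // p y1 x1 _ D1; rewrite -[aY _ _]scale1r -[aX _ _]scale1r.
  by apply: D_lin => //; apply: D_act; apply: t0D; exact: D_act Dyx.
Qed.

End Averaging.

Hypothesis sepS : separable_algebra S.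

Lemma left_section (Y X : lmodType k) (aY : S -> Y -> Y) (aX : S -> X -> X)
    (D : Y -> X -> Prop) :
  kbilinear aY -> kbilinear aX -> (forall y, aY 1 y = y) ->
  (forall s t y, aY (s * t) y = aY s (aY t y)) ->
  (forall s t x, aX (s * t) x = aX s (aX t x)) ->
  (forall c y x y' x', D y x -> D y' x' -> D (c *: y + y') (c *: x + x')) ->
  (forall s y x, D y x -> D (aY s y) (aX s x)) ->
  exists t : Y -> X,
  [/\ forall c y y', t (c *: y + y') = c *: t y + t y',
      forall s y, t (aY s y) = aX s (t y)
    & forall y x, D y x -> D y (t y)].
Proof.
have [e [e1 eC]] := separability_idempotent sepS.
by move=> *; apply: (averaged_section e1 eC).
Qed.

(** A right S-module is a left module over the opposite algebra, whose separability idempotent is e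
    with its factors exchanged. *)
Lemma right_section (Y X : lmodType k) (aY : S -> Y -> Y) (aX : S -> X -> X)
    (D : Y -> X -> Prop) :
  kbilinear aY -> kbilinear aX -> (forall y, aY 1 y = y) ->
  (forall s t y, aY (t * s) y = aY s (aY t y)) ->
  (forall s t x, aX (t * s) x = aX s (aX t x)) ->
  (forall c y x y' x', D y x -> D y' x' -> D (c *: y + y') (c *: x + x')) ->
  (forall s y x, D y x -> D (aY s y) (aX s x)) ->
  exists t : Y -> X,
  [/\ forall c y y', t (c *: y + y') = c *: t y + t y',
      forall s y, t (aY s y) = aX s (t y)
    & forall y x, D y x -> D y (t y)].
Proof.
have [e [e1 eC]] := separability_idempotent sepS.
move=> *; apply: (averaged_section (mul := fun s t =>
  t * s) (e := [seq (p.2, p.1) | p <- e])) => //.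
  by rewrite big_map.
move=> Z b bl br bZ s; rewrite !big_map /=; symmetry.
by apply: (eC _ (fun x y => b y x)).
Qed.

End EquivariantSections.

(** * Actions of a tensor ring *)

Section LinearFunctions.
Variables (k : fieldType) (X Y : lmodType k).

Definition lin_pred : {pred (X -> Y)} := fun f => `[< linear f >].

Lemma lin_pred_submod : submod_closed lin_pred.
Proof.
split=> [|c f g]; rewrite !unfold_in.
  by apply/asboolP => a x y /=; rewrite scaler0 addr0.
move=> /asboolP fl /asboolP gl; apply/asboolP => a x y.
change (c *: f (a *: x + y) + g (a *: x + y) = a *: (c *: f x + g x) + (c *: f y + g y)).
by rewrite fl gl !scalerDr !scalerA [c * a]mulrC addrACA.
Qed.

HB.instance Definition _ :=
  GRing.isSubmodClosed.Build k (X -> Y) lin_pred lin_pred_submod.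

Record linmap := Linmap { linmap_fun : X -> Y; _ : linmap_fun \in lin_pred }.

HB.instance Definition _ := [isSub for linmap_fun].
HB.instance Definition _ := [Choice of linmap by <:].
HB.instance Definition _ := [SubChoice_isSubLmodule of linmap by <:].

Definition mk_linmap (f : X -> Y) (fl : linear f) :
  linmap := Linmap (introT (asboolP _) fl).

Lemma linmap_linear (f : linmap) : linear (linmap_fun f).
Proof. exact/asboolP/(valP f). Qed.

Lemma linmapP (f g : linmap) : linmap_fun f =1 linmap_fun g -> f = g.
Proof. by move=> fg; apply/val_inj/funext. Qed.

End LinearFunctions.

Section Endomorphisms.
Variables (k : fieldType) (X : lmodType k) (x0 : X).

(* The argument guarantees 1 != 0, which algType requires. *)
Definition endo of x0 != 0 : Type := linmap X X.

Variable x0_neq0 : x0 != 0.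
Local Notation E := (endo x0_neq0).

HB.instance Definition _ := GRing.Lmodule.on E.

Definition endo_one : E := mk_linmap (fun c x y =>
  erefl : id (c *: x + y) = c *: id x + id y).

Lemma endo_comp_linear (f g : E) : linear (linmap_fun f \o linmap_fun g).
Proof. by move=> c x y; rewrite /= !linmap_linear. Qed.

Definition endo_mul (f g : E) : E := mk_linmap (@endo_comp_linear f g).

Lemma endoP (f g : E) : (forall x, linmap_fun f x = linmap_fun g x) -> f = g.
Proof. exact: linmapP. Qed.

Lemma endo_mulA : associative endo_mul. Proof. by move=> f g h; exact: endoP. Qed.
Lemma endo_mul1l : left_id endo_one endo_mul. Proof. by move=> f; exact: endoP. Qed.
Lemma endo_mul1r : right_id endo_one endo_mul. Proof. by move=> f; exact: endoP. Qed.
Lemma endo_mulDl : left_distributive endo_mul +%R.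
Proof. by move=> f g h; exact: endoP. Qed.
Lemma endo_mulDr : right_distributive endo_mul +%R.
Proof.
move=> f g h; apply: endoP => x /=.
by have := linmap_linear f 1 (linmap_fun g x) (linmap_fun h x); rewrite !scale1r.
Qed.
Lemma endo_one_neq0 : endo_one != 0.
Proof.
apply/eqP => /(congr1 (fun f : E => linmap_fun f x0)) /= /eqP.
by rewrite (negPf x0_neq0).
Qed.

HB.instance Definition _ := GRing.Zmodule_isNzRing.Build E
  endo_mulA endo_mul1l endo_mul1r endo_mulDl endo_mulDr endo_one_neq0.

Lemma endo_scaleAl (c : k) (f g : E) : c *: (f * g) = (c *: f) * g.
Proof. exact: endoP. Qed.

HB.instance Definition _ := GRing.Lmodule_isLalgebra.Build k E endo_scaleAl.

Lemma endo_scaleAr (c : k) (f g : E) : c *: (f * g) = f * (c *: g).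
Proof.
apply: endoP => x /=;
  change (c *: linmap_fun f (linmap_fun g x) = linmap_fun f (c *: linmap_fun g x)).
have f0 : linmap_fun f 0 = 0.
  by have := linmap_linear f (-1) 0 0; rewrite scaler0 addr0 scaleN1r addNr.
by have := linmap_linear f c (linmap_fun g x) 0; rewrite f0 !addr0.
Qed.

HB.instance Definition _ := GRing.Lalgebra_isAlgebra.Build k E endo_scaleAr.

End Endomorphisms.

Section TensorRingActions.
Variables (k : fieldType) (S : algType k) (V : bimodule S) (F : sring S).
Variables (j : {linear V -> F}) (Fj : is_tensor_ring j).

(** [aS] turns End_k(X) into an S-ring and [aV] is a bimodule map from V to it, so the universal
    property yields an S-ring map F -> End_k(X). *)
Lemma tensor_ring_action (X : lmodType k) (x0 : X) (aS : S -> X -> X) (aV : V -> X -> X) :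
  x0 != 0 -> kbilinear aS -> kbilinear aV -> (forall x, aS 1 x = x) ->
  (forall s t x, aS (s * t) x = aS s (aS t x)) ->
  (forall s v x, aV (lact s v) x = aS s (aV v x)) ->
  (forall v s x, aV (ract v s) x = aV v (aS s x)) ->
  exists a : F -> X -> X,
  [/\ (forall z, zmod_morphism (a^~ z)) /\ (forall y, zmod_morphism (a y)),
      forall z, a 1 z = z,
      forall x y z, a (x * y) z = a x (a y z),
      forall s z, a (sr_unit F s) z = aS s z
    & forall v z, a (j v) z = aV v z].
Proof.
move=> x0_neq0 [aSl aSr] [aVl aVr] aS1 aSM aVl_act aVr_act.
have eS_lin s : linear (aS s) by move=> c u v; exact: aSr.
have eV_lin v : linear (aV v) by move=> c u w; exact: aVr.
pose eS s : endo x0_neq0 := mk_linmap (eS_lin s).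
pose eV v : endo x0_neq0 := mk_linmap (eV_lin v).
have aSB z : zmod_morphism (aS^~ z).
  by apply: zmod_morphD => s t; have := aSl 1 s t z; rewrite !scale1r.
have aVB z : zmod_morphism (aV^~ z).
  by apply: zmod_morphD => s t; have := aVl 1 s t z; rewrite !scale1r.
have aSZ c s z : aS (c *: s) z = c *: aS s z.
  have a0 : aS 0 z = 0 by rewrite -(subrr (0 : S)) aSB subrr.
  by have := aSl c s 0 z; rewrite a0 !addr0.
have aVZ c s z : aV (c *: s) z = c *: aV s z.
  have a0 : aV 0 z = 0 by rewrite -(subrr (0 : V)) aVB subrr.
  by have := aVl c s 0 z; rewrite a0 !addr0.
have eSB : zmod_morphism eS.
  by move=> s t; apply: endoP => x /=; rewrite aSB.
have eSZ : scalable eS.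
  by move=> c s; apply: endoP => x /=; rewrite aSZ.
have eSM : monoid_morphism eS.
  split; first by apply: endoP => x /=; rewrite aS1.
  by move=> s t; apply: endoP => x /=; rewrite aSM.
pose u : {lrmorphism S -> endo x0_neq0} := HB.pack eS
  (GRing.isZmodMorphism.Build _ _ eS eSB) (GRing.isScalable.Build _ _ _ _ eS eSZ)
  (GRing.isMonoidMorphism.Build _ _ eS eSM).
have eVB : zmod_morphism eV.
  by move=> s t; apply: endoP => x /=; rewrite aVB.
have eVZ : scalable eV.
  by move=> c s; apply: endoP => x /=; rewrite aVZ.
have [_ univ] := Fj.
have [|[g [gS gV]] _] := univ (SRing u) (mk_linear eVB eVZ : {linear V -> SRing u}).
  split=> [s v|v s]; apply: endoP => x /=; first exact: aVl_act.
  exact: aVr_act.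
exists (fun x => linmap_fun (g x : endo x0_neq0)); split.
- split=> [z x y|y x z]; first by rewrite raddfB.
  have := linmap_linear (g y : endo x0_neq0) (-1) z x.
  by rewrite !scaleN1r [- z + x]addrC => ->; rewrite addrC.
- by move=> z; rewrite rmorph1.
- by move=> x y z; rewrite rmorphM.
- by move=> s z; rewrite gS.
- by move=> v z; rewrite gV.
Qed.

End TensorRingActions.

(** * Graded rings *)

Section Gradings.
Variables (V : zmodType) (p : nat -> {additive V -> V}) (pP : is_grading p).

Lemma proj_proj m n x : p m (p n x) = if m == n then p n x else 0.
Proof. exact: pP.1. Qed.

Lemma homog_proj n x : homog p n (p n x).
Proof. by rewrite /homog /= proj_proj eqxx. Qed.

Lemma homog_subgroup n : is_subgroup (homog p n).
Proof. by split=> [|x y]; rewrite /homog /= ?raddf0// raddfB => -> ->. Qed.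

Lemma proj_homog m n x : homog p n x -> p m x = if m == n then x else 0.
Proof. by rewrite /homog /= => xn; rewrite -xn proj_proj. Qed.

Lemma sum_proj N x : (forall m, (N <= m)%N -> p m x = 0) -> x = \sum_(i < N) p i x.
Proof.
move=> xN; have [M xM] := pP.2 x.
have e n : (N <= n)%N -> \sum_(i < N) p i x = \sum_(i < n) p i x.
  move=> Nn; rewrite -!(big_mkord xpredT (fun i => p i x)) (big_cat_nat (leq0n N) Nn)//=.
  by rewrite [X in _ + X]big_nat_cond [X in _ + X]big1 ?addr0// => i /andP[/andP[/xN]].
rewrite (e (maxn N M)) ?leq_maxl// {1}xM.
have eM n : (M <= n)%N -> \sum_(i < M) p i x = \sum_(i < n) p i x.
  move=> Mn; rewrite -!(big_mkord xpredT (fun i => p i x)) (big_cat_nat (leq0n M) Mn)//=.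
  rewrite [X in _ + X]big_nat_cond [X in _ + X]big1 ?addr0// => i /andP[/andP[Mi _] _].
  rewrite xM raddf_sum big1// => l _; rewrite proj_proj.
  by case: eqP => // il; move: (ltn_ord l); rewrite -il ltnNge Mi.
by rewrite -eM// leq_maxr.
Qed.

Lemma proj_finite x : exists N, forall m, (N <= m)%N -> p m x = 0.
Proof.
have [N xN] := pP.2 x; exists N => m Nm; rewrite xN raddf_sum big1// => l _.
rewrite proj_proj; case: eqP => // ml.
by move: (ltn_ord l); rewrite -ml ltnNge Nm.
Qed.

Lemma proj_eq0 x : (forall n, p n x = 0) -> x = 0.
Proof. by move=> x0; rewrite (@sum_proj 0 x)// big_ord0. Qed.

Lemma proj_ext x y : (forall n, p n x = p n y) -> x = y.
Proof.
move=> xy; apply/eqP; rewrite -subr_eq0; apply/eqP/proj_eq0 => n.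
by rewrite raddfB xy subrr.
Qed.

Lemma graded_ind (Y : set V) : is_subgroup Y ->
  (forall n x, homog p n x -> Y x) -> forall x, Y x.
Proof.
move=> YP Yh x; have [N /sum_proj ->] := proj_finite x.
by apply: subgroup_sum => // i _; apply: (Yh i); exact: homog_proj.
Qed.

End Gradings.

(* act stands for products as well as for module actions. *)
Section GradedActions.
Variables (A V W : zmodType) (pA : nat -> {additive A -> A})
  (pV : nat -> {additive V -> V}) (pW : nat -> {additive W -> W}).
Variable act : A -> V -> W.
Hypotheses (pAP : is_grading pA) (pVP : is_grading pV) (pWP : is_grading pW).
Hypothesis actBl : forall x, zmod_morphism (act^~ x).
Hypothesis actBr : forall a, zmod_morphism (act a).
Hypothesis act_homog : forall m n a x, homog pA m a -> homog pV n x ->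
  homog pW (m + n) (act a x).

Lemma proj_act_homogl m n a x : homog pA m a ->
  pW n (act a x) = if (m <= n)%N then act a (pV (n - m) x) else 0.
Proof.
move=> am; pose Y := [set x |
  pW n (act a x) = if (m <= n)%N then act a (pV (n - m) x) else 0].
have act0 : act a 0 = 0 by rewrite -(subrr 0) actBr subrr.
apply: (graded_ind pVP (Y := Y)); rewrite /Y.
  split=> [|y z] /=; first by rewrite !raddf0 !act0 raddf0 if_same.
  by rewrite actBr !raddfB => -> ->; case: ifP => _; rewrite ?actBr ?subr0.
move=> i y yi /=; rewrite (proj_homog pWP _ (act_homog am yi)) (proj_homog pVP _ yi).
case: leqP => mn; last by rewrite ltn_eqF// ltn_addr.
rewrite -{1}(subnKC mn) eqn_add2l; case: ifP => // _; by rewrite act0.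
Qed.

Lemma proj_act_homogr m n a x : homog pV m x ->
  pW n (act a x) = if (m <= n)%N then act (pA (n - m) a) x else 0.
Proof.
move=> xm; pose Y := [set a |
  pW n (act a x) = if (m <= n)%N then act (pA (n - m) a) x else 0].
have act0 : act 0 x = 0 by rewrite -(subrr (0 : A)) (actBl x) subrr.
apply: (graded_ind pAP (Y := Y)); rewrite /Y.
  split=> [|y z] /=; first by rewrite !raddf0 !act0 raddf0 if_same.
  by rewrite (actBl x) !raddfB => -> ->; case: ifP => _; rewrite ?(actBl x) ?subr0.
move=> i y yi /=; rewrite (proj_homog pWP _ (act_homog yi xm)) (proj_homog pAP _ yi).
case: leqP => mn; last by rewrite ltn_eqF// ltn_addl.
by rewrite -{1}(subnK mn) eqn_add2r; case: ifP => // _; rewrite act0.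
Qed.

Lemma proj_act n a x : pW n (act a x) = \sum_(i < n.+1) act (pA i a) (pV (n - i) x).
Proof.
pose Y := [set a | pW n (act a x) = \sum_(i < n.+1) act (pA i a) (pV (n - i) x)].
have act0 y : act 0 y = 0 by rewrite -(subrr (0 : A)) (actBl y) subrr.
apply: (graded_ind pAP (Y := Y)); rewrite /Y.
  split=> [|y z] /=; first by rewrite act0 raddf0 big1// => i _; rewrite raddf0.
  rewrite (actBl x) raddfB => -> ->; rewrite -sumrB; apply: eq_bigr => i _.
  by rewrite raddfB (actBl _).
move=> m b bm /=; rewrite (proj_act_homogl _ _ bm).
case: leqP => mn; last first.
  rewrite big1// => i _; rewrite (proj_homog pAP _ bm); case: eqP => // im.
  by move: (ltn_ord i); rewrite im ltnS leqNgt mn.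
rewrite (bigD1 (Ordinal (mn :
  (m < n.+1)%N)))//= (proj_homog pAP _ bm) eqxx big1 ?addr0// => i.
rewrite -val_eqE /= => im; rewrite (proj_homog pAP _ bm) (negPf im); exact: act0.
Qed.

End GradedActions.

Section GradedRings.
Variables (k : fieldType) (S : algType k) (T : gsring S).
Local Notation u := (sr_unit T).
Local Notation p := (pr T).
Local Notation hom := (homog (pr T)).
Implicit Types (a b x y : T) (s : S).

Let TP := pr_grading T.
Let mulBl x : zmod_morphism (fun a => a * x). Proof. by move=> a b; rewrite mulrBl. Qed.
Let mulBr a : zmod_morphism (fun x => a * x). Proof. by move=> x y; rewrite mulrBr. Qed.

Lemma pr_mull m n a x :
  hom m a -> p n (a * x) = if (m <= n)%N then a * p (n - m) x else 0.
Proof. exact: (proj_act_homogl TP TP mulBr (@pr_mul _ _ T)). Qed.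

Lemma pr_mulr m n a x :
  hom m x -> p n (a * x) = if (m <= n)%N then p (n - m) a * x else 0.
Proof. exact: (proj_act_homogr TP TP mulBl (@pr_mul _ _ T)). Qed.

Lemma prM n a x : p n (a * x) = \sum_(i < n.+1) p i a * p (n - i) x.
Proof. exact: (proj_act TP TP TP mulBl mulBr (@pr_mul _ _ T)). Qed.

Lemma homog_pr n x : hom n (p n x). Proof. exact: homog_proj. Qed.

Lemma pr_homog m n x : hom n x -> p m x = if m == n then x else 0.
Proof. exact: proj_homog. Qed.

Lemma prK m n x : p m (p n x) = if m == n then p n x else 0.
Proof. exact: TP.1. Qed.

Lemma homog_unit s : hom 0 (u s).
Proof. by rewrite /homog /= -sr_augK sr_unitK. Qed.

Lemma homog0E x : hom 0 x -> x = u (sr_aug x).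
Proof. by move=> x0; rewrite sr_augK x0. Qed.

Lemma sr_unit_inj : injective u.
Proof. exact: can_inj (@sr_unitK _ _ T). Qed.

Lemma sr_augB : zmod_morphism (@sr_aug _ _ T).
Proof. by move=> x y; apply: sr_unit_inj; rewrite sr_augK !raddfB /= !sr_augK. Qed.

Lemma sr_aug_eq0 x : sr_aug x = 0 <-> p 0 x = 0.
Proof.
rewrite -sr_augK; split=> [->|]; first by rewrite raddf0.
by move=> x0; apply: sr_unit_inj; rewrite x0 raddf0.
Qed.

Lemma sr_augM x y : sr_aug (x * y) = sr_aug x * sr_aug y.
Proof. by apply: sr_unit_inj; rewrite rmorphM /= !sr_augK prM big_ord1. Qed.

Lemma unit_alg c : u (c%:A) = c%:A.
Proof. by rewrite linearZ rmorph1. Qed.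

Lemma unit_mulZ c x : c *: x = u (c%:A) * x.
Proof. by rewrite unit_alg -scalerAl mul1r. Qed.

Lemma pr_unitl n s x : p n (u s * x) = u s * p n x.
Proof. by rewrite (pr_mull _ _ (homog_unit s)) leq0n subn0. Qed.

Lemma pr_unitr n s x : p n (x * u s) = p n x * u s.
Proof. by rewrite (pr_mulr _ _ (homog_unit s)) leq0n subn0. Qed.

Lemma deg_le_subgroup n : is_subgroup (deg_le (T := T) n).
Proof.
split=> [m _|x y xn yn m nm]; first by rewrite raddf0.
by rewrite raddfB xn// yn// subr0.
Qed.

Lemma deg_lt_subgroup n : is_subgroup (deg_lt (T := T) n).
Proof.
split=> [m _|x y xn yn m nm]; first by rewrite raddf0.
by rewrite raddfB xn// yn// subr0.
Qed.

Lemma homog_deg_le n x : hom n x -> deg_le n x.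
Proof. by move=> xn m nm; rewrite (pr_homog _ xn) gtn_eqF. Qed.

Lemma deg_leW m n : (m <= n)%N -> deg_le m `<=` deg_le (T := T) n.
Proof. by move=> mn x xm i ni; apply: xm; exact: leq_ltn_trans ni. Qed.

Lemma deg_leM m n x y : deg_le m x -> deg_le n y -> deg_le (m + n) (x * y).
Proof.
move=> xm yn l ml; rewrite prM big1// => i _.
have [mi|im] := ltnP m i; first by rewrite xm// mul0r.
rewrite yn ?mulr0// ltn_subRL; apply: leq_ltn_trans ml.
by rewrite leq_add2r.
Qed.

Lemma pr_leM m n x y : deg_le m x -> deg_le n y -> p (m + n) (x * y) = p m x * p n y.
Proof.
move=> xm yn; rewrite prM.
have mS : (m < (m + n).+1)%N by rewrite ltnS leq_addr.
rewrite (bigD1 (Ordinal mS))//= addKn big1 ?addr0// => i.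
rewrite -val_eqE /= neq_ltn => /orP[im|mi]; last by rewrite xm// mul0r.
by rewrite yn ?mulr0// ltn_subRL ltn_add2r.
Qed.

Lemma deg_le_unit s : deg_le 0 (u s).
Proof. by apply: homog_deg_le; exact: homog_unit. Qed.

Lemma deg_le1 : deg_le 0 (1 : T).
Proof. by rewrite -(rmorph1 u); exact: deg_le_unit. Qed.

Lemma deg_le0E x : deg_le 0 x -> x = u (sr_aug x).
Proof.
move=> x0; rewrite sr_augK; apply: (proj_ext TP) => n; rewrite prK.
by case: eqP => [->//|/eqP]; rewrite -lt0n => /x0.
Qed.

Lemma deg_lt0 x : deg_lt 0 x -> x = 0.
Proof. by move=> x0; apply: (proj_eq0 TP) => n; exact: x0. Qed.

Lemma deg_le_lt n x : deg_le n x -> p n x = 0 -> deg_lt n x.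
Proof. by move=> xn x0 m; rewrite leq_eqVlt => /predU1P[<-//|]; exact: xn. Qed.

Lemma deg_lt_le n x : deg_lt n x -> deg_le n x.
Proof. by move=> xn m /ltnW; exact: xn. Qed.

Lemma pr_deg_le n x : deg_le n (p n x).
Proof. by apply: homog_deg_le; exact: homog_pr. Qed.

Lemma deg_le_subpr n x : deg_le n x -> deg_lt n (x - p n x).
Proof.
move=> xn; apply: deg_le_lt; last by rewrite raddfB /= prK eqxx subrr.
by apply: (deg_le_subgroup n).2 => //; exact: pr_deg_le.
Qed.

Lemma deg_finite x : exists n, deg_le n x.
Proof. by have [N xN] := proj_finite TP x; exists N => m Nm; apply: xN; exact: ltnW. Qed.

Definition generated_in_degree1 : Prop :=
  forall Y : set T, is_subgroup Y -> (forall s, Y (u s)) ->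
    (forall t x, hom 1 t -> Y x -> Y (t * x)) -> forall x, Y x.

Hypothesis T1 : generated_in_degree1.

(** The least subgroup W that contains S and is stable under right multiplication by T^1 is also
    stable on the left: for t of degree one, the y with t y in W form another such subgroup. *)
Lemma generated_ind_right (Y : set T) : is_subgroup Y -> (forall s, Y (u s)) ->
  (forall x t, hom 1 t -> Y x -> Y (x * t)) -> forall x, Y x.
Proof.
move=> YP Yu Yt.
pose closed_right (Z : set T) := [/\ is_subgroup Z, forall s, Z (u s)
  & forall x t, hom 1 t -> Z x -> Z (x * t)].
pose W := [set x | forall Z, closed_right Z -> Z x].
have WP : is_subgroup W.
  split=> [Z [ZP _ _]|x y Wx Wy Z Zc]; first exact: ZP.1.
  by have [ZP _ _] := Zc; apply: ZP.2; [exact: Wx|exact: Wy].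
have Wu s : W (u s) by move=> Z [_ Zu _].
have Wr x t : hom 1 t -> W x -> W (x * t).
  by move=> t1 Wx Z Zc; have [_ _ Zt] := Zc; apply: Zt => //; exact: Wx.
suff Wall x : W x by move=> x; apply: Wall.
apply: (T1 WP Wu) => t y t1 Wy.
apply: (Wy [set y | W (t * y)]); split; first exact: subgroup_mull.
(* The product t s has degree one, so it enters W as a right multiple of 1. *)
- move=> s; rewrite /=; have -> : t * u s = u 1 * (t * u s) by rewrite rmorph1 mul1r.
  apply: Wr => //.
  by have := pr_mul t1 (homog_unit s); rewrite addn0.
- by move=> z t' t'1 Wz; rewrite /= mulrA; exact: Wr.
Qed.

(** Induction over products of degree one elements does not preserve a bound on the degree. It is
    carried out for the single components of degree at most n+1 instead, where projecting t y
    truncates y to degree at most n. *)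
Lemma deg_leS_left n x : deg_le n.+1 x ->
  exists s y, prods (hom 1) (deg_le n) y /\ x = u s + y.
Proof.
move=> xn; pose Y := [set x | forall m, (m <= n.+1)%N ->
  exists s y, prods (hom 1) (deg_le n) y /\ p m x = u s + y].
have PP := prods_subgroup (hom 1) (deg_le (T := T) n).
suff Yx : Y x.
  rewrite (sum_proj TP (N := n.+2) (x := x)); last by move=> m; exact: xn.
  apply: (big_ind (fun x => exists s y, prods (hom 1) (deg_le n) y /\ x = u s + y)).
  - by exists 0, 0; rewrite raddf0 addr0; split=> //; exact: PP.1.
  - move=> _ _ [s [y [Py ->]]] [s' [y' [Py' ->]]]; exists (s + s'), (y + y').
    by split; [exact: (subgroupD PP)|rewrite raddfD addrACA].
  - by move=> i _; have := Yx i; apply; rewrite -ltnS.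
apply: T1; rewrite /Y.
- split=> [m _|y z Yy Yz m mn].
    by exists 0, 0; rewrite !raddf0 addr0; split=> //; exact: PP.1.
  have [s [y' [Py' ey]]] := Yy m mn; have [s' [z' [Pz' ez]]] := Yz m mn.
  exists (s - s'), (y' - z'); split; first exact: PP.2.
  by rewrite !raddfB /= ey ez opprD addrACA.
- move=> s m _; exists (if m == 0%N then s else 0), 0; split; first exact: PP.1.
  by rewrite (pr_homog _ (homog_unit s)); case: eqP => _; rewrite ?raddf0 addr0.
- move=> t y t1 _ m mn; exists 0; exists (p m (t * y)); split;
    last by rewrite raddf0 add0r.
  rewrite (pr_mull _ _ t1); case: ifP => [m1|_]; last exact: PP.1.
  apply: mem_prods => //; apply: (@deg_leW (m - 1)); first by rewrite leq_subLR.
  exact: pr_deg_le.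
Qed.

Lemma deg_leS_right n x : deg_le n.+1 x ->
  exists s y, prods (deg_le n) (hom 1) y /\ x = u s + y.
Proof.
move=> xn; pose Y := [set x | forall m, (m <= n.+1)%N ->
  exists s y, prods (deg_le n) (hom 1) y /\ p m x = u s + y].
have PP := prods_subgroup (deg_le (T := T) n) (hom 1).
suff Yx : Y x.
  rewrite (sum_proj TP (N := n.+2) (x := x)); last by move=> m; exact: xn.
  apply: (big_ind (fun x => exists s y, prods (deg_le n) (hom 1) y /\ x = u s + y)).
  - by exists 0, 0; rewrite raddf0 addr0; split=> //; exact: PP.1.
  - move=> _ _ [s [y [Py ->]]] [s' [y' [Py' ->]]]; exists (s + s'), (y + y').
    by split; [exact: (subgroupD PP)|rewrite raddfD addrACA].
  - by move=> i _; have := Yx i; apply; rewrite -ltnS.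
apply: generated_ind_right; rewrite /Y.
- split=> [m _|y z Yy Yz m mn].
    by exists 0, 0; rewrite !raddf0 addr0; split=> //; exact: PP.1.
  have [s [y' [Py' ey]]] := Yy m mn; have [s' [z' [Pz' ez]]] := Yz m mn.
  exists (s - s'), (y' - z'); split; first exact: PP.2.
  by rewrite !raddfB /= ey ez opprD addrACA.
- move=> s m _; exists (if m == 0%N then s else 0), 0; split; first exact: PP.1.
  by rewrite (pr_homog _ (homog_unit s)); case: eqP => _; rewrite ?raddf0 addr0.
- move=> y t t1 _ m mn; exists 0; exists (p m (y * t)); split;
    last by rewrite raddf0 add0r.
  rewrite (pr_mulr _ _ t1); case: ifP => [m1|_]; last exact: PP.1.
  apply: mem_prods => //; apply: (@deg_leW (m - 1)); first by rewrite leq_subLR.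
  exact: pr_deg_le.
Qed.

End GradedRings.

(** * Tensor rings as free graded rings *)

Section TensorRing.
Variables (k : fieldType) (S : algType k) (V : bimodule S) (F : sring S).
Variables (j : {linear V -> F}) (Fj : is_tensor_ring j).
Local Notation u := (sr_unit F).

Let jl s v : j (lact s v) = u s * j v. Proof. exact: Fj.1.1. Qed.
Let jr v s : j (ract v s) = j v * u s. Proof. exact: Fj.1.2. Qed.
Let uZ c (x : F) : c *: x = u c%:A * x.
Proof. by rewrite linearZ rmorph1 -scalerAl mul1r. Qed.

Section Generation.
Variable Y : set F.
Hypotheses (YP : is_subgroup Y) (Yu : forall s, Y (u s)).
Hypothesis Yj : forall v y, Y y -> Y (j v * y).

Let closed (Z : set F) := [/\ is_subgroup Z, forall s, Z (u s)
  & forall v y, Z y -> Z (j v * y)].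
(** Y need not be stable under S on the left. The least closed set is, since s (v y) = (s v) y. *)
Let W : set F := [set x | forall Z, closed Z -> Z x].

Let WP : is_subgroup W.
Proof.
split=> [Z [ZP _ _]|x y Wx Wy Z Zc]; first exact: ZP.1.
by have [ZP _ _] := Zc; apply: ZP.2; [exact: Wx|exact: Wy].
Qed.

Let Wu s : W (u s). Proof. by move=> Z [_ Zu _]. Qed.

Let Wj v y : W y -> W (j v * y).
Proof. by move=> Wy Z Zc; have [_ _ Zj] := Zc; apply: Zj; exact: Wy. Qed.

Let Wul s y : W y -> W (u s * y).
Proof.
move=> Wy; suff [] : W y /\ W (u s * y) by [].
apply: (Wy [set y | W y /\ W (u s * y)]); split.
- exact: (subgroup_setI WP (subgroup_mull (u s) WP)).
- by move=> t; split; [|rewrite -rmorphM]; exact: Wu.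
- by move=> v z [Wz _]; split; [|rewrite mulrA -jl]; exact: Wj.
Qed.

Let stab : {pred F} := fun x => `[< forall y, W y -> W (x * y) >].

Let stab_subalg : subalg_closed stab.
Proof.
split=> [|c x y|x y]; rewrite !unfold_in.
- by apply/asboolP => y; rewrite mul1r.
- move=> /asboolP Wx /asboolP Wy; apply/asboolP => z Wz; rewrite mulrDl.
  by rewrite uZ -mulrA; apply: (subgroupD WP); [apply: Wul; exact: Wx|exact: Wy].
- move=> /asboolP Wx /asboolP Wy; apply/asboolP => z Wz.
  by rewrite -mulrA; apply: Wx; exact: Wy.
Qed.

HB.instance Definition _ := GRing.isSubalgClosed.Build k F stab stab_subalg.

Let B := {x : F | x \in stab}.
HB.instance Definition _ := SubType.on B.
HB.instance Definition _ := [Choice of B by <:].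
HB.instance Definition _ := [SubChoice_isSubAlgebra of B by <:].

Let stab_unit s : u s \in stab.
Proof. by rewrite unfold_in; apply/asboolP => y; exact: Wul. Qed.

Let stab_j v : j v \in stab.
Proof. by rewrite unfold_in; apply/asboolP => y; exact: Wj. Qed.

Let uB s : B := exist _ (u s) (stab_unit s).
Let jB v : B := exist _ (j v) (stab_j v).

(* The elements that stabilise W form a subalgebra containing S and V, which is
   everything by the uniqueness part of the universal property. *)
Lemma tensor_ring_ind x : Y x.
Proof.
have uBB : zmod_morphism uB by move=> s t; apply: val_inj; rewrite /= !raddfB.
have uBZ : scalable uB by move=> c s; apply: val_inj; rewrite /= !linearZ.
have uBM : monoid_morphism uB.
  by split=> [|s t]; apply: val_inj; rewrite /= ?rmorph1 ?rmorphM.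
pose uB' : {lrmorphism S -> B} := HB.pack uB
  (GRing.isZmodMorphism.Build _ _ uB uBB) (GRing.isScalable.Build _ _ _ _ uB uBZ)
  (GRing.isMonoidMorphism.Build _ _ uB uBM).
have jBB : zmod_morphism jB by move=> s t; apply: val_inj; rewrite /= !raddfB.
have jBZ : scalable jB by move=> c s; apply: val_inj; rewrite /= !linearZ.
have [_ univ] := Fj.
have [|[g [gS gV]] _] := univ (SRing uB') (mk_linear jBB jBZ : {linear V -> SRing uB'}).
  by split=> [s v|v s]; apply: val_inj; rewrite /= ?jl ?jr.
have iB : zmod_morphism (\val : B -> F) by [].
have iZ : scalable (\val : B -> F) by [].
have iM : monoid_morphism (\val : B -> F) by [].
pose inc : {lrmorphism SRing uB' -> F} := HB.pack (\val : B -> F)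
  (GRing.isZmodMorphism.Build _ _ _ iB) (GRing.isScalable.Build _ _ _ _ _ iZ)
  (GRing.isMonoidMorphism.Build _ _ _ iM).
have [_ uniq_g] := univ F j Fj.1.
have <- : inc (g x) = x.
  apply: (uniq_g (inc \o g : {lrmorphism F -> F}) idfun) => // [s|v].
    by rewrite /= gS.
  by rewrite /= gV.
suff Wx : W (inc (g x)) by exact: Wx.
rewrite -[inc _]mulr1 -(rmorph1 u).
have /asboolP gx : inc (g x) \in stab by exact: (valP (g x : B)).
by apply: gx; exact: Wu.
Qed.

End Generation.

(* F acts on Q (+) S by v (z, w) = (v z + s (v w), 0), and D x is the first
   component of x (0, 1). *)
Lemma tensor_ring_derivation (Q : lmodType k) (act : F -> Q -> Q) (s : F -> Q) :
  kbilinear act -> (forall z, act 1 z = z) ->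
  (forall x y z, act (x * y) z = act x (act y z)) ->
  (forall c x y, s (c *: x + y) = c *: s x + s y) ->
  (forall t x, s (u t * x) = act (u t) (s x)) ->
  exists D : F -> Q, zmod_morphism D /\ forall y v, D (y * j v) = act y (s (j v)).
Proof.
move=> [actl actr] act1 actM s_lin s_unit.
have actBl z : zmod_morphism (act^~ z).
  by apply: zmod_morphD => x y; have := actl 1 x y z; rewrite !scale1r.
have actBr x : zmod_morphism (act x).
  by apply: zmod_morphD => y z; have := actr 1 x y z; rewrite !scale1r.
have actD x y z : act x (y + z) = act x y + act x z.
  by have := actr 1 x y z; rewrite !scale1r.
have s0 : s 0 = 0.
  by have := s_lin (-1) 0 0; rewrite scaler0 addr0 scaleN1r addNr.
have act0l z : act 0 z = 0 by rewrite -(subrr (0 : F)) actBl subrr.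
have act0r x : act x 0 = 0 by apply: (addrI (act x 0)); rewrite -actD !addr0.
pose aS t (z : Q * S) : Q * S := (act (u t) z.1, t * z.2).
pose aV v (z : Q * S) : Q * S := (act (j v) z.1 + s (j v * u z.2), 0).
have [|||||||a [[aBl aBr] a1 aM au aj]] := @tensor_ring_action k S V F j Fj (Q * S)%type
  (0, 1) aS aV.
- by apply/eqP => /(congr1 snd) e0; have := oner_neq0 S; rewrite (e0 : 1 = 0) eqxx.
- split=> [c t t' [z w]|c t [z w] [z' w']]; congr (_, _) => /=.
  + by rewrite linearP actl.
  + by rewrite mulrDl scalerAl.
  + by rewrite actr.
  + by rewrite mulrDr scalerAr.
- split=> [c t t' [z w]|c t [z w] [z' w']]; congr (_, _) => /=.
  + by rewrite linearP actl mulrDl -scalerAl s_lin scalerDr addrACA.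
  + by rewrite scaler0 addr0.
  + by rewrite actr linearP mulrDr -scalerAr s_lin scalerDr addrACA.
  + by rewrite scaler0 addr0.
- by move=> [z w]; congr (_, _) => /=; rewrite ?rmorph1 ?act1 ?mul1r.
- by move=> t t' [z w]; congr (_, _) => /=; rewrite ?rmorphM ?actM ?mulrA.
- move=> t v [z w]; congr (_, _) => /=; rewrite ?mulr0//.
  by rewrite actD jl actM -mulrA s_unit.
- by move=> v t [z w]; congr (_, _) => /=; rewrite jr actM rmorphM mulrA.
have aQ y z : a y (z, 0) = (act y z, 0).
  move: z; apply: (@tensor_ring_ind [set y | forall z, a y (z, 0) = (act y z, 0)]).
  - split=> [z|x x' ax ax' z] /=; first by rewrite act0l -(subrr (0 : F)) aBl subrr.
    by rewrite aBl ax ax' actBl; congr (_, _) => /=; rewrite subrr.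
  - by move=> t z; rewrite au /aS /= mulr0.
  - by move=> v x ax z; rewrite aM ax aj actM /aV /= raddf0 mulr0 s0 addr0.
exists (fun x => (a x (0, 1)).1); split=> [x y|y v]; first by rewrite aBl.
by rewrite aM aj /aV /= act0r add0r rmorph1 mulr1 aQ.
Qed.

(* As above with F acting on F (+) F by v (y, z) = (v t(z), v z). *)
Lemma tensor_ring_left (t : F -> F) :
  (forall c x y, t (c *: x + y) = c *: t x + t y) ->
  (forall s x, t (u s * x) = u s * t x) ->
  exists D : F -> F, zmod_morphism D /\ forall v y, D (j v * y) = j v * t y.
Proof.
move=> t_lin t_unit.
pose aS s (z : F * F) : F * F := (u s * z.1, u s * z.2).
pose aV v (z : F * F) : F * F := (j v * t z.2, j v * z.2).
have [|||||||a [[aBl aBr] a1 aM au aj]] := @tensor_ring_action k S V F j Fj (F * F)%type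
  (0, 1) aS aV.
- by apply/eqP => /(congr1 snd) e0; have := oner_neq0 F; rewrite (e0 : 1 = 0) eqxx.
- split=> [c s s' [z w]|c s [z w] [z' w']]; congr (_, _) => /=;
    by rewrite ?linearP ?mulrDl ?mulrDr -?scalerAl -?scalerAr.
- split=> [c v v' [z w]|c v [z w] [z' w']]; congr (_, _) => /=;
    by rewrite ?t_lin ?linearP ?mulrDl ?mulrDr -?scalerAl -?scalerAr.
- by move=> [z w]; rewrite /aS rmorph1 !mul1r.
- by move=> s s' [z w]; rewrite /aS rmorphM !mulrA.
- by move=> s v [z w]; rewrite /aS /aV jl !mulrA.
- by move=> v s [z w]; rewrite /aS /aV /= jr t_unit !mulrA.
have a2 y : (a y (0, 1)).2 = y.
  apply: (@tensor_ring_ind [set y | (a y (0, 1)).2 = y]).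
  - split=> [|x x' /= ax ax'] /=.
      by have := aBl (0, 1) 0 0; rewrite !subrr => ->.
    by rewrite aBl /= ax ax'.
  - by move=> s; rewrite /= au /aS /= mulr1.
  - by move=> v x /= ax; rewrite aM aj /aV /= ax.
exists (fun x => (a x (0, 1)).1); split=> [x y|v y]; first by rewrite aBl.
by rewrite aM aj /aV /= a2.
Qed.

(* tensor_ring_derivation with Q = End_k(F), (x f)(a) = f (a x), and
   s x = (a |-> t(a) x), evaluated at 1. *)
Lemma tensor_ring_right (t : F -> F) :
  (forall c x y, t (c *: x + y) = c *: t x + t y) ->
  (forall s x, t (x * u s) = t x * u s) ->
  exists D : F -> F, zmod_morphism D /\ forall y v, D (y * j v) = t y * j v.
Proof.
move=> t_lin t_unit.
have act_lin x (f : linmap F F) : linear (fun a => linmap_fun f (a * x)).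
  by move=> c a b; rewrite mulrDl -scalerAl linmap_linear.
pose act x f : linmap F F := mk_linmap (act_lin x f).
have s_lin x : linear (fun a => t a * x).
  by move=> c a b; rewrite t_lin mulrDl -scalerAl.
pose s x : linmap F F := mk_linmap (s_lin x).
have [|||||D [DB Dj]] := @tensor_ring_derivation (linmap F F) act s.
- split=> [c x y f|c x f g]; apply: linmapP => a //.
  change (linmap_fun f (a * (c *: x + y)) = c *: linmap_fun f (a * x) + linmap_fun f (a
    * y)).
  by rewrite mulrDr -scalerAr linmap_linear.
- by move=> f; apply: linmapP => a /=; rewrite mulr1.
- by move=> x y f; apply: linmapP => a /=; rewrite mulrA.
- move=> c x y; apply: linmapP => a.
  change (t a * (c *: x + y) = c *: (t a * x) + t a * y).
  by rewrite mulrDr -scalerAr.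
- by move=> c x; apply: linmapP => a /=; rewrite t_unit mulrA.
exists (fun x => linmap_fun (D x) 1); split=> [x y|y v]; first by rewrite DB.
by rewrite Dj /= mul1r.
Qed.

(** F acts on sequences in F, S termwise and V by multiplication followed by a shift; [d n x] is the
    n-th term of x applied to (1, 0, 0, ...), that is, the degree n component of x. *)
Lemma tensor_ring_grading : exists d : nat -> F -> F,
  [/\ forall n, zmod_morphism (d n),
      forall n s, d n (u s) = if n == 0%N then u s else 0,
      forall n s x, d n (u s * x) = u s * d n x
    & forall n v x, d n (j v * x) = if n is m.+1 then j v * d m x else 0].
Proof.
pose aS s (f : nat -> F) : nat -> F := fun n => u s * f n.
pose aV v (f : nat -> F) : nat -> F := fun n => if n is m.+1 then j v * f m else 0.
pose e n : F := if n == 0%N then 1 else 0.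
have [|||||||a [[aBl aBr] a1 aM au aj]] := @tensor_ring_action k S V F j Fj (nat -> F) e
  aS aV.
- apply/eqP => /(congr1 (@^~ 0%N)) e0; have := oner_neq0 F.
  by rewrite (e0 : 1 = 0) eqxx.
- split=> [c s s' f|c s f g]; apply/funext => n.
    change (u (c *: s + s') * f n = c *: (u s * f n) + u s' * f n).
    by rewrite linearP mulrDl -scalerAl.
  change (u s * (c *: f n + g n) = c *: (u s * f n) + u s * g n).
  by rewrite mulrDr -scalerAr.
- split=> [c s s' f|c s f g]; apply/funext => -[|n].
  + by change (0 = c *: 0 + 0 :> F); rewrite scaler0 addr0.
  + change (j (c *: s + s') * f n = c *: (j s * f n) + j s' * f n).
    by rewrite linearP mulrDl -scalerAl.
  + by change (0 = c *: 0 + 0 :> F); rewrite scaler0 addr0.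
  + change (j s * (c *: f n + g n) = c *: (j s * f n) + j s * g n).
    by rewrite mulrDr -scalerAr.
- by move=> f; apply/funext => n; rewrite /aS rmorph1 mul1r.
- by move=> s s' f; apply/funext => n; rewrite /aS rmorphM mulrA.
- by move=> s v f; apply/funext => -[|n]; rewrite /aS /aV ?mulr0// jl mulrA.
- by move=> v s f; apply/funext => -[|n]; rewrite /aS /aV// jr mulrA.
exists (fun n x => a x e n); split=> [n x y|n s|n s x|n v x].
- by rewrite aBl.
- by rewrite au /aS /e; case: eqP; rewrite ?mulr1 ?mulr0.
- by rewrite aM au.
- by rewrite aM aj.
Qed.

End TensorRing.

(** * Free graded rings covering quadratic rings *)

Section FreeGradedRings.
Variables (k : fieldType) (S : algType k).

(* F is generated by S and V = F^1, and the multiplication maps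
   V (x)_S F -> F_+ and F (x)_S V -> F_+ are injective: maps given on pure
   tensors are well defined on F_+. The last clause allows an arbitrary left
   F-module as the target. *)
Definition free_gsring (F : gsring S) : Prop :=
  [/\ generated_in_degree1 F,
      forall t : F -> F, (forall c x y, t (c *: x + y) = c *: t x + t y) ->
        (forall s x, t (sr_unit F s * x) = sr_unit F s * t x) ->
        exists D : F -> F, zmod_morphism D /\
          forall v y, homog (pr F) 1 v -> D (v * y) = v * t y,
      forall t : F -> F, (forall c x y, t (c *: x + y) = c *: t x + t y) ->
        (forall s x, t (x * sr_unit F s) = t x * sr_unit F s) ->
        exists D : F -> F, zmod_morphism D /\
          forall y v, homog (pr F) 1 v -> D (y * v) = t y * v
    & forall (Q : lmodType k) (act : F -> Q -> Q) (s : F -> Q),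
        kbilinear act -> (forall z, act 1 z = z) ->
        (forall x y z, act (x * y) z = act x (act y z)) ->
        (forall c x y, s (c *: x + y) = c *: s x + s y) ->
        (forall t x, s (sr_unit F t * x) = act (sr_unit F t) (s x)) ->
        exists D : F -> Q, zmod_morphism D /\
          forall y v, homog (pr F) 1 v -> D (y * v) = act y (s v)].

(** F is T_S(V) with its degree grading and with the augmentation of T composed with q. The last
    clause is where T being quadratic enters: the relations are generated in degree 2, so nothing
    new arises from degree 3 on. *)
Lemma quadratic_cover (T : gsring S) : quadratic T ->
  exists (F : gsring S) (q : {lrmorphism F -> T}),
  [/\ free_gsring F, is_gsring_map q, forall y, exists x, q x = y
    & forall n x, (1 < n)%N -> homog (pr F) n.+1 x -> q x = 0 ->
      let K := [set x | homog (pr F) n x /\ q x = 0] in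
      sums (prods (homog (pr F) 1) K) (prods K (homog (pr F) 1)) x].
Proof.
move=> [V [TT [j [q [K0 [TTj [qS qbij] [_ K0V] q_surj qK]]]]]].
have [d [dB d_unit d_mulu d_mulj]] := tensor_ring_grading TTj.
have ind := tensor_ring_ind TTj.
have q1 v : homog (pr T) 1 (q (j v)).
  by case: qbij => qf _ _; exact: (qf v).
have d0 n : d n 0 = 0 by have := dB n 0 0; rewrite !subrr.
have d_proj m n x : d m (d n x) = if m == n then d n x else 0.
  move: x m n; apply: (ind [set x |
    forall m n, d m (d n x) = if m == n then d n x else 0]).
  - split=> [m n|x y /= dx dy m n]; first by rewrite !d0 if_same.
    by rewrite !dB dx dy; case: eqP; rewrite ?subr0.
  - by move=> s m n; rewrite d_unit; case: (n =P 0%N) => [->|];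
      rewrite ?d_unit// d0 if_same.
  - move=> v y dy m n; rewrite d_mulj.
    case: n => [|n]; first by rewrite d0 if_same.
    rewrite d_mulj; case: m => [|m] //; rewrite dy eqSS.
    by case: eqP; rewrite ?mulr0.
have d_sum x : exists N, forall M, (N <= M)%N -> x = \sum_(i < M) d i x.
  move: x; apply: (ind [set x |
    exists N, forall M, (N <= M)%N -> x = \sum_(i < M) d i x]).
  - split=> [|x y [N xN] [M yM]]; first by exists 0%N => M _; rewrite big1.
    exists (maxn N M) => L; rewrite geq_max => /andP[NL ML].
    rewrite {1}(xN L)// {1}(yM L)// -sumrB; apply: eq_bigr => i _; by rewrite dB.
  - by move=> s; exists 1%N => -[//|M] _;
      rewrite big_ord_recl d_unit/= big1 ?addr0// => i _; rewrite d_unit.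
  - move=> v y [N yN]; exists N.+1 => -[//|M]; rewrite ltnS => NM.
    rewrite big_ord_recl d_mulj add0r {1}(yN M)// mulr_sumr.
    by apply: eq_bigr => i _; rewrite d_mulj.
have d_fin x : exists N, x = \sum_(i < N) d i x.
  by have [N xN] := d_sum x; exists N; exact: xN.
have q_d n x : q (d n x) = pr T n (q x).
  move: x n; apply: (ind [set x | forall n, q (d n x) = pr T n (q x)]).
  - split=> [n|x y /= dx dy n]; first by rewrite d0 !raddf0.
    by rewrite dB !rmorphB /= dx dy raddfB.
  - move=> s n; rewrite d_unit qS (pr_homog _ (homog_unit T s)).
    by case: eqP => _; rewrite ?qS ?raddf0.
  - move=> v y dy n; rewrite d_mulj rmorphM (pr_mull _ _ (q1 v)).
    case: n => [|n]; first by rewrite raddf0.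
    by rewrite rmorphM /= dy subn1.
pose p n : {additive TT -> TT} := mk_additive (dB n).
have pP : is_grading p by split.
have d_mul m n x y : d n y = y -> d m (x * y) = if (n <= m)%N then d (m - n)%N x * y
  else 0.
  move=> yn; move: x m;
    apply: (ind [set x | forall m, d m (x * y) = if (n <= m)%N then d (m - n)%N x * y
      else 0]).
  - split=> [m|x z /= dx dz m]; first by rewrite mul0r !d0 mul0r if_same.
    by rewrite mulrBl !dB dx dz; case: ifP; rewrite ?subr0// mulrBl.
  - move=> s m; rewrite d_mulu -{1}yn d_proj d_unit subn_eq0.
    by case: (ltngtP m n) => _; rewrite ?mulr0 ?mul0r ?yn.
  - move=> v z dz m; rewrite -mulrA d_mulj; case: m => [|m].
      by rewrite sub0n d_mulj mul0r if_same.
    rewrite dz; case: (ltngtP n m.+1) => nm.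
    + by rewrite -ltnS nm subSn// d_mulj mulrA.
    + by rewrite leqNgt ltnW// mulr0.
    + by rewrite nm ltnn subnn d_mulj mul0r mulr0.
have p_mul m n x y : homog p m x -> homog p n y -> homog p (m + n) (x * y).
  rewrite /homog /= => xm yn.
  by rewrite (d_mul _ _ _ _ yn) leq_addl addnK xm.
pose aug x := sr_aug (q x).
have augK : cancel (sr_unit TT) aug by move=> s; rewrite /aug qS sr_unitK.
have aug0 x : sr_unit TT (aug x) = p 0%N x.
  move: x; apply: (ind [set x | sr_unit TT (aug x) = p 0%N x]).
  - split=> [|y z /= dy dz].
      by rewrite /aug /= d0 raddf0 -(raddf0 (sr_unit T)) sr_unitK raddf0.
    rewrite /= dB -dy -dz.
    have -> : aug (y - z) = aug y - aug z by rewrite /aug rmorphB sr_augB.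
    by rewrite rmorphB.
  - by move=> s; rewrite /= augK d_unit.
  - move=> v y _; rewrite /= d_mulj /aug.
    have -> : sr_aug (q (j v * y)) = 0.
      by apply/sr_aug_eq0; rewrite rmorphM (pr_mull _ _ (q1 v)).
    by rewrite raddf0.
pose F : gsring S := GSRing pP p_mul augK aug0.
have F1 v : homog (pr F) 1 (j v).
  by have := d_mulj 1%N v 1; rewrite mulr1 -(rmorph1 (sr_unit TT)) d_unit/= rmorph1 mulr1.
have F1E x : homog (pr F) 1 x -> exists v, x = j v.
  have dj y : exists v, d 1%N y = j v.
    apply: (ind [set y | exists v, d 1%N y = j v]).
    - split=> [|x1 x2 [v1 e1] [v2 e2]]; first by exists 0; rewrite d0 raddf0.
      by exists (v1 - v2); rewrite dB e1 e2 raddfB.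
    - by move=> s; exists 0; rewrite d_unit raddf0.
    - move=> v z _; exists (ract v (aug z)); rewrite d_mulj.
      by rewrite TTj.1.2 (aug0 z).
  by move=> x1; have [v e] := dj x; exists v; rewrite -e; exact: (esym x1).
have F_gen : generated_in_degree1 F.
  by move=> Y YP Yu Yt; apply: ind => // v y; apply: Yt; exact: F1.
exists F, q; split=> //.
- split=> //.
  + move=> t tl tu; have [D [DB Dj]] := tensor_ring_left TTj tl tu.
    by exists D; split=> // v y /F1E[w ->]; exact: Dj.
  + move=> t tl tu; have [D [DB Dj]] := tensor_ring_right TTj tl tu.
    by exists D; split=> // y v /F1E[w ->]; exact: Dj.
  + move=> Q act s act_bil act1 actM sl su.
    have [D [DB Dj]] := tensor_ring_derivation TTj act_bil act1 actM sl su.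
    by exists D; split=> // y v /F1E[w ->]; exact: Dj.
pose K m := [set x : F | homog (pr F) m x /\ q x = 0].
pose N m := sums (prods (homog (pr F) 1) (K m)) (prods (K m) (homog (pr F) 1)).
have NP m : is_subgroup (N m) by apply: sums_subgroup; exact: prods_subgroup.
(* Z consists of the elements of ker q with the wanted components in degrees at least 3. It is an
   ideal containing K0, hence all of ker q. *)
pose Z := [set x : TT | q x = 0 /\ forall m, (1 < m)%N -> N m (d m.+1 x)].
have ZP : is_subgroup Z.
  split=> [|x y [qx Zx] [qy Zy]].
    by split=> [|m _]; rewrite ?raddf0// d0; exact: (NP m).1.
  split=> [|m m1]; first by rewrite rmorphB /= qx qy subr0.
  by rewrite dB; apply: (NP m).2; [exact: Zx|exact: Zy].
have K_d m x : q x = 0 -> K m (d m x).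
  by move=> qx; split; [rewrite /homog /= d_proj eqxx|rewrite q_d qx raddf0].
have N_unitl m s x : N m x -> N m (sr_unit F s * x).
  move=> [y [z [y1 z1 ->]]]; rewrite mulrDr.
  exists (sr_unit F s * y), (sr_unit F s * z); split=> //.
    apply: (prods_morph (f := fun y => sr_unit F s * y) _ _ _ y1) => [a b||a b a1 Kb];
      first by rewrite mulrBr.
      exact: prods_subgroup.
    rewrite mulrA; apply: mem_prods => //.
    exact: (pr_mul (homog_unit F s) a1).
  apply: (prods_morph (f := fun y => sr_unit F s * y) _ _ _ z1) =>
    [a b||a b [a1 qa] Kb]; first by rewrite mulrBr.
    exact: prods_subgroup.
  rewrite mulrA; apply: mem_prods => //; split.
    exact: (pr_mul (homog_unit F s) a1).
  by rewrite rmorphM /= qa mulr0.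
have N_unitr m s x : N m x -> N m (x * sr_unit F s).
  move=> [y [z [y1 z1 ->]]]; rewrite mulrDl.
  exists (y * sr_unit F s), (z * sr_unit F s); split=> //.
    apply: (prods_morph (f := fun y => y * sr_unit F s) _ _ _ y1) =>
      [a b||a b a1 [b1 qb]]; first by rewrite mulrBl.
      exact: prods_subgroup.
    rewrite -mulrA; apply: mem_prods => //; split.
      by have := pr_mul b1 (homog_unit F s); rewrite addn0.
    by rewrite rmorphM /= qb mul0r.
  apply: (prods_morph (f := fun y => y * sr_unit F s) _ _ _ z1) => [a b||a b Ka b1];
    first by rewrite mulrBl.
    exact: prods_subgroup.
  rewrite -mulrA; apply: mem_prods => //.
  by have := pr_mul b1 (homog_unit F s); rewrite addn0.
have Zl a x : Z x -> Z (a * x).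
  move: x; apply: (ind [set a | forall x, Z x -> Z (a * x)]).
  - split=> [x _|b c /= Zb Zc x Zx]; first by rewrite mul0r; exact: ZP.1.
    by rewrite mulrBl; apply: ZP.2; [exact: Zb|exact: Zc].
  - move=> s x [qx Zx]; split=> [|m m1]; first by rewrite rmorphM /= qx mulr0.
    by rewrite d_mulu; apply: N_unitl; exact: Zx.
  (* The degree m+1 component of v (y x) is v times a component of y x, so it is enough that q (y x)
     = 0. *)
  - move=> v y Zy x Zx; have [qz _] := Zy x Zx.
    split=> [|m m1]; first by rewrite -mulrA rmorphM /= qz mulr0.
    rewrite -mulrA d_mulj; apply: sumsl; first exact: prods_subgroup.
    by apply: mem_prods; [exact: F1|exact: K_d].
have Zr a x : Z x -> Z (x * a).
  move: x; apply: (generated_ind_right F_gen (Y := [set a | forall x, Z x -> Z (x * a)])).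
  - split=> [x _|b c /= Zb Zc x Zx]; first by rewrite mulr0; exact: ZP.1.
    by rewrite mulrBr; apply: ZP.2; [exact: Zb|exact: Zc].
  - move=> s x [qx Zx]; split=> [|m m1]; first by rewrite rmorphM /= qx mul0r.
    have -> : d m.+1 (x * sr_unit TT s) = d m.+1 x * sr_unit TT s by exact: (pr_unitr (T
      := F)).
    by apply: N_unitr; exact: Zx.
  - move=> y t t1 Zy x Zx; have [qz _] := Zy x Zx.
    split=> [|m m1]; first by rewrite mulrA rmorphM /= qz mul0r.
    rewrite mulrA (d_mul _ _ _ _ t1) subn1; apply: sumsr; first exact: prods_subgroup.
    by apply: mem_prods; [exact: K_d|].
have KZ : ideal_gen K0 `<=` Z.
  apply: smallest_sub => [|x K0x]; first by split=> // a x Zx; split;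
    [exact: Zl|exact: Zr].
  split=> [|m m1].
    suff : [set x | q x = 0] x by [].
    by rewrite qK; apply: sub_gen_smallest.
  (* K0 lies in degree 2, while m + 1 is at least 3. *)
  rewrite (_ : d m.+1 x = 0); first exact: (NP m).1.
  move: (K0V _ K0x); apply: (gen_morph (Y := [set 0])); [exact: dB|exact: subgroup_set0|].
  move=> _ [v [w ->]]; rewrite /= d_mulj -[j w]mulr1 d_mulj.
  case: m m1 => [//|m m0]; rewrite -(rmorph1 (sr_unit TT)) d_unit.
  by case: eqP m0 => [->//|_ _]; rewrite !mulr0.
move=> n x n1 xn qx.
have : Z x by apply: KZ; rewrite -qK.
by move=> [_ /(_ n n1)]; rewrite [d _ x]xn.
Qed.

End FreeGradedRings.

(** * Free graded resolutions *)

Section FreeModules.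
Variables (R : nzRingType) (X : choiceType).
Local Notation M := {freeg X / R}.

Lemma freeg_ind (Y : set M) :
  is_subgroup Y -> (forall a x, Y << a *g x >>) -> forall D, Y D.
Proof. by move=> YP Yx D; rewrite -(freeg_sumE D); exact: subgroup_sum. Qed.

Lemma freegZ (a b : R) (x : X) : a *: << b *g x >> = << a * b *g x >> :> M.
Proof. by apply/eqP/freeg_eqP => y; rewrite coeffZ !coeffU mulrA. Qed.

Lemma freegZ1 (a : R) (x : X) : << a *g x >> = a *: << x >> :> M.
Proof. by rewrite freegZ mulr1. Qed.

Section AdditiveLift.
Variables (N : zmodType) (phi : X -> R -> N).
Hypothesis phiB : forall x, zmod_morphism (phi x).

Let phi0 x : phi x 0 = 0. Proof. by have := phiB x 0 0; rewrite !subrr. Qed.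

(** Coefficients pass through maps that are additive only: graded projections, or choices of lifts
    from A to F taken modulo a submodule. *)
Definition freeg_alift (D : M) : N := \sum_(x <- dom D) phi x (coeff x D).

Let sum_dom s (D : M) : uniq s -> {subset dom D <= s} ->
  freeg_alift D = \sum_(x <- s) phi x (coeff x D).
Proof.
move=> us Ds; rewrite [RHS](bigID (mem (dom D)))/= [X in _ + X]big1 ?addr0; last first.
  by move=> x /coeff_outdom ->; rewrite phi0.
rewrite -big_filter; apply: perm_big; apply: uniq_perm.
- exact: uniq_dom.
- exact: filter_uniq.
by move=> x; rewrite mem_filter; case: (boolP (x \in dom D)) => //= /Ds ->.
Qed.

Lemma freeg_alift_is_additive : zmod_morphism freeg_alift.
Proof.
move=> D E; pose s := undup (dom D ++ dom E).
have us : uniq s by exact: undup_uniq.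
rewrite (@sum_dom s (D - E))//; last by move=> x /domB; rewrite mem_undup.
rewrite (@sum_dom s D)//; last by move=> x xD; rewrite mem_undup mem_cat xD.
rewrite (@sum_dom s E)//; last by move=> x xE; rewrite mem_undup mem_cat xE orbT.
by rewrite -sumrB; apply: eq_bigr => x _; rewrite coeffB phiB.
Qed.

Lemma freeg_aliftU a x : freeg_alift << a *g x >> = phi x a.
Proof.
rewrite (@sum_dom [:: x])//; first by rewrite big_seq1 coeffU eqxx mulr1.
move=> y; rewrite mem_dom coeffU mem_seq1; apply: contra_neqT.
by rewrite eq_sym => /negPf ->; rewrite mulr0.
Qed.

End AdditiveLift.

Section LinearLift.
Variables (N : lmodType R) (e : X -> N).

Lemma fglift_is_scalable : scalable (fglift e : M -> N).
Proof.
move=> c D; apply: (@freeg_ind [set D | fglift e (c *: D) = c *: fglift e D]).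
  split=> [|D1 D2 /= e1 e2]; last by rewrite scalerBr !lift_is_additive e1 e2 scalerBr.
  have e0 : fglift e (0 : M) = 0 by have := lift_is_additive e 0 0; rewrite !subrr.
  by rewrite /= scaler0 e0 scaler0.
by move=> a x /=; rewrite freegZ !liftU scalerA.
Qed.

Definition freeg_lift : {linear M -> N} :=
  mk_linear (lift_is_additive e) fglift_is_scalable.

Lemma freeg_liftU a x : freeg_lift << a *g x >> = a *: e x.
Proof. exact: liftU. Qed.

End LinearLift.

Lemma freeg_linear_ext (N : lmodType R) (f g : {linear M -> N}) :
  (forall x, f << x >> = g << x >>) -> f =1 g.
Proof.
move=> fg; apply: (@freeg_ind [set D | f D = g D]).
  split=> [|D E /= fD fE]; first by rewrite /= !raddf0.
  by rewrite !raddfB /= fD fE.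
by move=> a x /=; rewrite freegZ1 !linearZ fg.
Qed.

End FreeModules.

Section GradedModules.
Variables (k : fieldType) (S : algType k) (A : gsring S).

Record gpmod := GPMod {
  gp_sort :> lmodType A;
  gp_pr : nat -> {additive gp_sort -> gp_sort};
  gp_grading : is_grading gp_pr;
  gp_scale : forall m n a x, homog (pr A) m a -> homog gp_pr n x ->
    homog gp_pr (m + n) (a *: x);
  gp_projective : projective_module gp_sort
}.

Lemma regular_projective : projective_module (A^o : lmodType A).
Proof.
move=> M N g f g_surj; have [x gx] := g_surj (f 1).
have hB : zmod_morphism (fun a : A^o => a *: x) by move=> a b; rewrite scalerBl.
have hZ : scalable (fun a : A^o => a *: x) by move=> a b; rewrite scalerA.
exists (mk_linear hB hZ) => a.
by rewrite /= linearZ gx -linearZ; congr (f _); exact: mulr1.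
Qed.

Definition regular_gpmod : gpmod :=
  @GPMod A^o (pr A) (pr_grading A) (@pr_mul _ _ A) regular_projective.

Section Free.
Variables (X : choiceType) (deg : X -> nat).
Local Notation M := {freeg X / A}.

Lemma free_projective : projective_module (M : lmodType A).
Proof.
move=> N1 N2 g f g_surj.
have [c cP] := choice (fun x : X => g_surj (f << x >>)).
exists (freeg_lift c).
apply: (@freeg_linear_ext _ _ _ (g \o freeg_lift c : {linear _ -> _}) f) => x.
by rewrite /= liftU scale1r.
Qed.

(** The generator x sits in degree [deg x], so its coefficient contributes degree n - [deg x]; the
    test guards against truncated subtraction. *)
Let pr_free n (x : X) (a : A) : M :=
  if (deg x <= n)%N then << pr A (n - deg x) a *g x >> else 0.

Let pr_freeB n x : zmod_morphism (pr_free n x).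
Proof.
move=> a b; rewrite /pr_free; case: ifP => _; last by rewrite subr0.
by rewrite raddfB freegUB.
Qed.

Definition free_pr n : {additive M -> M} :=
  mk_additive (freeg_alift_is_additive (pr_freeB n)).

Lemma free_prU n a x : free_pr n << a *g x >> =
  if (deg x <= n)%N then << pr A (n - deg x) a *g x >> else 0.
Proof. exact: freeg_aliftU. Qed.
Opaque free_pr.

Lemma free_pr_grading : is_grading free_pr.
Proof.
split=> [m n D|D].
  apply: (@freeg_ind _ _ [set D |
    free_pr m (free_pr n D) = if m == n then free_pr n D else 0]).
    split=> [|D1 D2 /= e1 e2]; first by rewrite /= !raddf0 if_same.
    by rewrite !raddfB /= e1 e2; case: eqP; rewrite ?subr0.
  move=> a x /=; rewrite free_prU; case: leqP => xn; last by rewrite raddf0 if_same.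
  rewrite free_prU prK; case: leqP => xm.
    rewrite -(eqn_add2r (deg x) (m - _)) !subnK//; case: eqP => // _.
    exact: freegU0.
  by rewrite ltn_eqF// (leq_trans xm).
pose Y := [set D | exists N, forall M, (N <= M)%N -> D = \sum_(i < M) free_pr i D].
suff [N DN] : Y D by exists N; exact: DN.
apply: freeg_ind; rewrite /Y.
  split=> [|D1 D2 [N1 e1] [N2 e2]].
    by exists 0%N => N _; rewrite big1// => i _; rewrite raddf0.
  exists (maxn N1 N2) => N; rewrite geq_max => /andP[/e1 f1 /e2 f2].
  by rewrite {1}f1 {1}f2 -sumrB; apply: eq_bigr => i _; rewrite raddfB.
move=> a x; have [N aN] := proj_finite (pr_grading A) a.
exists (deg x + N)%N => L NL.
rewrite -(big_mkord xpredT (fun i => free_pr i << a *g x >>)).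
have xL : (deg x <= L)%N by apply: leq_trans NL; exact: leq_addr.
rewrite (big_cat_nat (leq0n _) xL)//= [X in X + _]big_nat_cond [X in X + _]big1.
  rewrite add0r -{1}[deg x]add0n big_addn big_mkord.
  under eq_bigr => i _ do rewrite free_prU leq_addl addnK.
  rewrite {1}(sum_proj (pr_grading A) (N := (L - deg x)%N) (x := a)).
    by apply: (big_morph (fun a => << a *g x >>)) => [b c|]; rewrite ?freegU0 ?freegUD.
  by move=> m Lm; apply: aN; apply: leq_trans Lm; rewrite leq_subRL.
by move=> i /andP[/andP[_ ix] _]; rewrite free_prU leqNgt ix.
Qed.

Lemma free_scale m n a (D : M) : homog (pr A) m a -> homog free_pr n D ->
  homog free_pr (m + n) (a *: D).
Proof.
move=> am Dn; suff e i :
  free_pr i (a *: D) = if (m <= i)%N then a *: free_pr (i - m) D else 0.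
  by rewrite /homog /= e leq_addr addKn Dn.
apply: (@freeg_ind _ _ [set D |
  free_pr i (a *: D) = if (m <= i)%N then a *: free_pr (i - m) D else 0]).
  split=> [|D1 D2 /= e1 e2]; first by rewrite /= scaler0 !raddf0 if_same.
  by rewrite scalerBr !raddfB /= e1 e2; case: ifP; rewrite ?subr0// scalerBr.
move=> b x /=; rewrite freegZ !free_prU (pr_mull _ _ am).
have [xi|xi] := leqP (deg x) i; have [mi|mi] := leqP m i.
- rewrite !leq_subRL// addnC; case: leqP => _; last by rewrite freegU0 scaler0.
  by rewrite freegZ subnAC.
- by rewrite leqNgt (leq_ltn_trans _ mi) ?leq_subr// freegU0.
- by rewrite leqNgt (leq_ltn_trans _ xi) ?leq_subr// scaler0.
- by [].
Qed.

Definition free_gpmod : gpmod :=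
  GPMod free_pr_grading free_scale free_projective.

Lemma free_homogU x : homog free_pr (deg x) << x >>.
Proof.
rewrite /homog /= free_prU leqnn subnn; congr << _ *g _ >>.
by have := homog_unit A 1; rewrite rmorph1.
Qed.

Variables (N : gpmod) (e : X -> N).
Hypothesis eP : forall x, homog (gp_pr N) (deg x) (e x).

Definition free_map : {linear free_gpmod -> N} := freeg_lift e.
Opaque free_map.

Lemma free_map_pr n D : free_map (gp_pr free_gpmod n D) = gp_pr N n (free_map D).
Proof.
apply: (@freeg_ind _ _ [set D | free_map (free_pr n D) = gp_pr N n (free_map D)]).
  split=> [|D1 D2 /= e1 e2]; first by rewrite /= !raddf0.
  by rewrite !raddfB /= e1 e2.
move=> a x /=; rewrite free_prU [free_map << a *g x >>]freeg_liftU.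
rewrite (proj_act_homogr (pr_grading A) (gp_grading N) _ (@gp_scale N) _ _ (eP x));
  last first.
  by move=> y b c; rewrite scalerBl.
by case: ifP => _; [exact: freeg_liftU|exact: raddf0].
Qed.

End Free.

End GradedModules.

(** * Construction of a resolution by stages *)

Section Resolutions.
Variables (k : fieldType) (S : algType k) (A : gsring S).

(** The datum of the recursion: the last module constructed, together with the cycles that the next
    differential has to cover. *)
Record stage := Stage {
  st_mod :> gpmod A;
  st_cycle : set st_mod;
  st_subgroup : is_subgroup st_cycle;
  st_scale : forall a x, st_cycle x -> st_cycle (a *: x);
  st_pr : forall n x, st_cycle x -> st_cycle (gp_pr st_mod n x)
}.

Section KernelStage.
Variables (N P : gpmod A) (f : {linear P -> N}).
Hypothesis f_pr : forall n x, f (gp_pr P n x) = gp_pr N n (f x).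

Lemma kernel_subgroup : is_subgroup [set x | f x = 0].
Proof. exact: (subgroup_preimage (raddfB f) (@subgroup_set0 N)). Qed.

Lemma kernel_scale a x : f x = 0 -> f (a *: x) = 0.
Proof. by move=> fx; rewrite linearZ /= fx scaler0. Qed.

Lemma kernel_pr n x : f x = 0 -> f (gp_pr P n x) = 0.
Proof. by move=> fx; rewrite f_pr fx raddf0. Qed.

Definition kernel_stage : stage := Stage kernel_subgroup kernel_scale kernel_pr.

End KernelStage.

Section Next.
Variable st : stage.

(** The next free module has all pairs (n, x) as generators, in degree n. Non-cycles are sent to 0,
    which avoids a type of homogeneous cycles, and each cycle x is the sum of the images of the
    pairs (i, x). *)
Definition cycle_at (z : nat * st) : st :=
  if `[< st_cycle z.2 >] then gp_pr st z.1 z.2 else 0.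

Lemma cycle_at_homog z : homog (gp_pr st) z.1 (cycle_at z).
Proof.
rewrite /cycle_at; case: ifP => _; first exact: (homog_proj (gp_grading st)).
exact: (homog_subgroup _ _).1.
Qed.

Lemma cycle_atP z : st_cycle (cycle_at z).
Proof.
rewrite /cycle_at; case: asboolP => [|_]; first exact: st_pr.
exact: (st_subgroup st).1.
Qed.

Definition next : stage := kernel_stage (free_map_pr cycle_at_homog).

Definition next_d : {linear next -> st} := free_map (fun z : nat * st => z.1) cycle_at.

Lemma next_dU z : next_d << z >> = cycle_at z.
Proof. by rewrite [LHS]freeg_liftU scale1r. Qed.

Lemma next_d_cycle y : st_cycle (next_d y).
Proof.
apply: (@freeg_ind _ _ (next_d @^-1` (@st_cycle st))) => [|a z].
  exact: (subgroup_preimage (raddfB next_d) (st_subgroup st)).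
have -> : << a *g z >> = a *: << z >> :> next by exact: freegZ1.
have -> : (next_d @^-1` (@st_cycle st)) (a *: << z >>) = st_cycle (a *: next_d << z >>).
  by rewrite -linearZ.
by rewrite next_dU; apply: st_scale; exact: cycle_atP.
Qed.

Lemma next_d_surj x : st_cycle x -> exists y, x = next_d y.
Proof.
move=> cx; have [N xN] := (gp_grading st).2 x.
exists (\sum_(i < N) << (val i, x) >>); rewrite raddf_sum [LHS]xN.
by apply: eq_bigr => i _; rewrite [RHS]next_dU /cycle_at asboolT.
Qed.

Lemma next_d_pr n x : next_d (gp_pr next n x) = gp_pr st n (next_d x).
Proof. exact: (free_map_pr cycle_at_homog). Qed.

End Next.

Variables (X : choiceType) (deg : X -> nat) (e : X -> regular_gpmod A).
Hypothesis eP : forall x, homog (pr A) (deg x) (e x).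
Hypothesis e_exact : forall a : A, sr_aug a = 0 <-> exists y, a = free_map deg e y.

(** Stage i carries Q_(i+1) and ker d_i. The map Q_1 -> A is left as a parameter, since the
    comparison with F requires generators that lift to F. *)
Definition stage_seq (i : nat) :
  stage := iter i next (kernel_stage (free_map_pr (N := regular_gpmod A) eP)).

Definition res_mod (i : nat) : gpmod A :=
  if i is i'.+1 then st_mod (stage_seq i') else regular_gpmod A.

Definition res_d (i : nat) : {linear res_mod i.+1 -> res_mod i} :=
  match i with
  | 0%N => free_map deg e
  | i'.+1 => next_d (stage_seq i')
  end.

Lemma res_d_pr i n x :
  res_d i (gp_pr (res_mod i.+1) n x) = gp_pr (res_mod i) n (res_d i x).
Proof.
case: i x => [|i] x; first exact: (free_map_pr (N := regular_gpmod A) eP).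
exact: next_d_pr.
Qed.

Lemma res_exact i x : res_d i x = 0 <-> exists y, x = res_d i.+1 y.
Proof.
have cE j : st_cycle (s := stage_seq j) = [set x | res_d j x = 0] by case: j.
split=> [dx|[y ->]].
  by apply: next_d_surj; rewrite cE.
have := next_d_cycle (st := stage_seq i) y; rewrite cE; exact.
Qed.

Definition res_eps : {additive A -> S} := mk_additive (sr_augB (T := A)).

Lemma res_eps_pr n a : res_eps (pr A n a) = if n == 0%N then res_eps a else 0.
Proof.
have e0 b : sr_unit A (sr_aug b) = pr A 0 b := sr_augK b.
apply: (sr_unit_inj (T := A)); rewrite [LHS]e0 prK eq_sym; case: eqP => [->|_].
  by rewrite [RHS]e0.
by rewrite raddf0.
Qed.

Lemma res_eps_surj s : exists a, res_eps a = s.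
Proof. by exists (sr_unit A s); exact: sr_unitK. Qed.

Definition free_resolution : resolution A :=
  @Resolution _ _ A (fun i => gp_sort (res_mod i)) (fun i => gp_pr (res_mod i))
    (fun i => gp_grading (res_mod i)) (fun i => @gp_scale _ _ _ (res_mod i))
    (fun i => @gp_projective _ _ _ (res_mod i)) res_d res_d_pr res_eps
    (@sr_augM _ _ A) res_eps_pr res_eps_surj e_exact res_exact.

End Resolutions.

(** * Govorov's formula for Tor_3 *)

Section TorVanishing.
Variables (k : fieldType) (S : algType k) (A : gsring S) (Q : resolution A).

(* A_+ Y *)
Definition aug_mul (M : lmodType A) (Y : set M) : set M :=
  gen [set z | exists a x, [/\ sr_aug a = 0, Y x & z = a *: x]].

Lemma cpx_unit i s x : cpx_tens (Q := Q) (i := i) s x = cpx_tens 1 (sr_unit A s *: x).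
Proof.
rewrite -[in LHS](mul1r s) -{1}(@sr_unitK _ _ A s).
exact: (tens_bal (@S_ract _ _ A) (fun (a : A) x => a *: x)).
Qed.

Lemma cpx_tensB i s : zmod_morphism (cpx_tens (Q := Q) (i := i) s).
Proof. by apply: zmod_morphD => y z; exact: tensDr. Qed.

Lemma cpx_tens0 i s : cpx_tens (Q := Q) (i := i) s 0 = 0.
Proof. by have := cpx_tensB (i := i) s 0 0; rewrite !subrr. Qed.

(** S acts on Q_i through A, so s (x) x = 1 (x) s x. This is the first half of S (x)_A Q_i = Q_i /
    A_+ Q_i. *)
Lemma cpx_tens1 i (t : cpx Q i) : exists x, t = cpx_tens 1 x.
Proof.
apply: (@tensor_ind _ _ _ _ _ [set t : cpx Q i | exists x, t = cpx_tens 1 x]).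
  split=> [|_ _ [x ->] [y ->]]; first by exists 0; rewrite cpx_tens0.
  by exists (x - y); rewrite cpx_tensB.
by move=> s x; exists (sr_unit A s *: x); exact: cpx_unit.
Qed.

(** The map to Q_i / A_+ Q_i that sends s (x) x to the class of s x is balanced, because s aug(a) -
    s a has augmentation zero. *)
Lemma cpx_tens1_eq0 i (x : rs_mod Q i) : cpx_tens 1 x = 0 -> aug_mul setT x.
Proof.
set AX := aug_mul setT.
have AXP : is_subgroup AX by exact: gen_subgroup.
pose b s (x : rs_mod Q i) := zproj AX (sr_unit A s *: x).
have bDl s s' y : b (s + s') y = b s y + b s' y.
  by rewrite /b -raddfD -scalerDl raddfD.
have bDr s y y' : b s (y + y') = b s y + b s y'.
  by rewrite /b -raddfD -scalerDr.
have b_bal s a y : b (S_ract s a) y = b s (a *: y).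
  apply/eqP; rewrite -subr_eq0 -raddfB; apply/eqP/zproj_eq0 => //.
  rewrite scalerA -scalerBl; apply: sub_gen.
  exists (sr_unit A (S_ract s a) - sr_unit A s * a), y; split=> //.
  by rewrite sr_augB sr_augM !sr_unitK subrr.
move=> x0; have := tensor_liftE bDl bDr b_bal 1 x.
rewrite -/(cpx_tens 1 x) x0 /b rmorph1 scale1r => e; apply/zproj_eq0 => //.
by rewrite -e; have := tensor_liftB bDl bDr b_bal 0 0; rewrite !subrr.
Qed.

Lemma cpx_tens_aug i (s : S) (x : rs_mod Q i) : aug_mul setT x -> cpx_tens s x = 0.
Proof.
apply: (gen_morph (Y := [set 0])); [|exact: subgroup_set0|].
  exact: cpx_tensB.
move=> _ [a [y [a0 _ ->]]] /=; rewrite /cpx_tens -tens_bal /S_ract a0 mulr0.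
exact: tens0l.
Qed.

(** With u = d y, the tensor 1 (x) y is a cycle because u lies in A_+ Q_2. Being a boundary, it puts
    y in d Q_4 + A_+ Q_3, so that u lies in A_+ d Q_3 = A_+ ker d_1. *)
Lemma Tor3_vanishing n (u : rs_mod Q 2) :
  Tor3_at Q n = [set 0] -> homog (rs_pr Q 2) n u -> rs_d Q 1 u = 0 ->
  aug_mul setT u -> aug_mul [set z | rs_d Q 1 z = 0] u.
Proof.
move=> T0 un du Au.
have [y0 uy0] := (@rs_exact _ _ _ Q 1%N u).1 du.
(* The component of degree n still maps to u, as u is homogeneous. *)
pose y := rs_pr Q 3 n y0.
have dy : rs_d Q 2 y = u by rewrite rs_d_pr -uy0.
have : Tor3_at Q n (zproj (@boundaries3 _ _ _ Q) (cpx_tens 1 y)).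
  exists (cpx_tens 1 y) => //; split.
    by apply: sub_gen; exists 1, y; split=> //; exact: (homog_proj (rs_grading Q 3)).
  by rewrite cpx_dE dy cpx_tens_aug.
rewrite T0 => /=; rewrite -(raddf0 (zproj _)) zproj_eqE subr0 => By.
have [z yz] : exists z, cpx_tens 1 y = cpx_tens 1 (rs_d Q 3 z).
  apply: (@gen_min _ _ [set t | exists z, t = cpx_tens 1 (rs_d Q 3 z)] _ _ _ By) =>
    [|_ [t _ <-]].
    split=> [|_ _ [v ->] [w ->]]; first by exists 0; rewrite raddf0 cpx_tens0.
    by exists (v - w); rewrite raddfB cpx_tensB.
  by have [w ->] := cpx_tens1 t; exists w; rewrite cpx_dE.
have : aug_mul setT (y - rs_d Q 3 z).
  by apply: cpx_tens1_eq0; rewrite cpx_tensB -yz subrr.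
have -> : u = rs_d Q 2 (y - rs_d Q 3 z).
  by rewrite linearB dy; have -> : rs_d Q 2 (rs_d Q 3 z) = 0; [apply/rs_exact;
    exists z|rewrite subr0].
apply: (gen_morph (f := rs_d Q 2)) => [||_ [a [w [a0 _ ->]]]].
- exact: raddfB.
- exact: gen_subgroup.
- apply: sub_gen; exists a, (rs_d Q 2 w); split=> //; last by rewrite linearZ.
  by apply/rs_exact; exists w.
Qed.

End TorVanishing.

Section RestrictionOfScalars.
Variables (k : fieldType) (A : algType k) (M : lmodType A).

(** M as a k-space, under a name of its own since M already carries its A-module structure; linear
    sections and actions of F are taken over k. *)
Definition kres : Type := M.
HB.instance Definition _ := GRing.Zmodule.on kres.

Let scale (c : k) (x : kres) : kres := c%:A *: (x : M).

Let scaleA a b v : scale a (scale b v) = scale (a * b) v.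
Proof. by rewrite /scale scalerA -scalerAl mul1r scalerA. Qed.
Let scale1 : left_id 1 scale.
Proof. by move=> v; rewrite /scale !scale1r. Qed.
Let scaleDr : right_distributive scale +%R.
Proof. by move=> c x y; rewrite /scale scalerDr. Qed.
Let scaleDl v : {morph scale^~ v : a b / a + b}.
Proof. by move=> a b; rewrite /scale scalerDl scalerDl. Qed.

HB.instance Definition _ :=
  GRing.Zmodule_isLmodule.Build k kres scaleA scale1 scaleDr scaleDl.

Lemma kresZ (c : k) (x : kres) : c *: x = c%:A *: (x : M) :> M.
Proof. by []. Qed.

End RestrictionOfScalars.

Section GradedMaps.
Variables (k : fieldType) (S : algType k) (F A : gsring S).
Variables (r : {lrmorphism F -> A}) (rP : is_gsring_map r).

Lemma sr_aug_map x : sr_aug (r x) = sr_aug x.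
Proof. by apply: (sr_unit_inj (T := A)); rewrite sr_augK -rP.2 -sr_augK rP.1. Qed.

Lemma sr_aug_pr (T : gsring S) n (x : T) :
  sr_aug (pr T n x) = if n == 0%N then sr_aug x else 0.
Proof.
apply: (sr_unit_inj (T := T)); rewrite sr_augK prK eq_sym.
by case: eqP => [->|_]; [rewrite sr_augK|rewrite raddf0].
Qed.

Lemma homog_map n x : homog (pr F) n x -> homog (pr A) n (r x).
Proof. by move=> xn; rewrite /homog /= -rP.2 xn. Qed.

End GradedMaps.

Section CoefficientLift.
Variables (k : fieldType) (S : algType k) (F A : gsring S).
Variables (r : {lrmorphism F -> A}) (r_surj : forall a, exists t, r t = a).
Variables (X : choiceType) (h : X -> F) (M : set F).
Hypotheses (MP : is_subgroup M) (Ml : forall a x, M x -> M (a * x)).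
Hypothesis rM : forall a x, r a = 0 -> M (a * h x).

(* When J h(X) is contained in M, the map (a x) |-> a h(x) from the free
   F-module on X to F / M factors through the free A-module on X. *)
Lemma coefficient_lift : exists f : {freeg X / A} -> zquot M,
  [/\ zmod_morphism f, forall a x, f << r a *g x >> = zproj M (a * h x)
    & forall a D t, f D = zproj M t -> f (r a *: D) = zproj M (a * t)].
Proof.
have [l lP] := choice r_surj.
pose phi x (b : A) := zproj M (l b * h x).
have phiB x : zmod_morphism (phi x).
  move=> a b; rewrite /phi -raddfB; apply/zproj_eq => //.
  by rewrite -!mulrBl; apply: rM; rewrite !rmorphB /= !lP subrr.
pose f := freeg_alift phi; have fB : zmod_morphism f := freeg_alift_is_additive phiB.
have f0 : f 0 = 0 by have := fB 0 0; rewrite !subrr.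
have fU a x : f << r a *g x >> = zproj M (a * h x).
  rewrite /f freeg_aliftU//; apply/zproj_eq => //.
  by rewrite -mulrBl; apply: rM; rewrite rmorphB /= lP subrr.
exists f; split=> // a D t fD.
(* One suitable representative t' of f D is enough: t - t' lies in M, which is stable under F. *)
have [t' [fD' faD]] : exists t', f D = zproj M t' /\ f (r a *: D) = zproj M (a * t').
  apply: (@freeg_ind _ _ [set D |
    exists t', f D = zproj M t' /\ f (r a *: D) = zproj M (a * t')]).
    split=> [|D1 D2 [t1 [e1 e1']] [t2 [e2 e2']]].
      by exists 0; rewrite scaler0 mulr0 raddf0 f0.
    by exists (t1 - t2); rewrite fB e1 e2 scalerBr fB e1' e2' mulrBr !raddfB.
  move=> b x; exists (l b * h x); split; first by rewrite -{1}(lP b) fU.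
  by rewrite freegZ -{1}(lP b) -rmorphM fU mulrA.
rewrite faD; apply/zproj_eq => //; rewrite -mulrBr; apply: Ml.
by apply/zproj_eq; rewrite // -fD -fD'.
Qed.

End CoefficientLift.

Section Govorov.
Variables (k : fieldType) (S : algType k) (sepS : separable_algebra S).
Variables (F A : gsring S) (Ff : free_gsring F).
Variables (r : {lrmorphism F -> A}) (rP : is_gsring_map r).
Hypothesis r_surj : forall a, exists t, r t = a.

Local Notation J := [set x | r x = 0].
Local Notation Fp := [set x : F | sr_aug x = 0].

Let JP : is_subgroup J.
Proof. exact: (subgroup_preimage (rmorphB r) (@subgroup_set0 A)). Qed.

Let augB := sr_augB (T := F).

Let FpP : is_subgroup Fp.
Proof. exact: (subgroup_preimage augB (@subgroup_set0 S)). Qed.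

Let JFp : J `<=` Fp.
Proof. by move=> x /= rx;
  rewrite -(sr_aug_map rP) rx -(subrr 0) (sr_augB (T := A)) subrr. Qed.

Let Fp_homog x : homog (pr F) 1 x -> Fp x.
Proof. by move=> x1; apply/sr_aug_eq0; rewrite (pr_homog _ x1). Qed.

Lemma aug_ideal_prods : Fp `<=` prods setT (homog (pr F) 1).
Proof.
move=> x /= x0; have [n /(deg_leW (leqnSn n)) xn] := deg_finite x.
have [gen1 _ _ _] := Ff.
have [s [y [Py xE]]] := deg_leS_right gen1 xn.
have y0 : sr_aug y = 0.
  apply: (prods_min FpP _ Py) => a b _ /Fp_homog /= b0.
  by rewrite sr_augM b0 mulr0.
have s0 : s = 0.
  have := augB x y; rewrite x0 y0 subr0 xE addrK sr_unitK; exact.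
rewrite xE s0 raddf0 add0r.
apply: (prods_min _ _ Py) => [|a b _ b1]; first exact: prods_subgroup.
exact: mem_prods.
Qed.

(** The generators of Q_1 come with a lift to F. In degree 0 the value is 0 rather than the
    component, which keeps the image in the augmentation ideal. *)
Let h1 (z : nat * F) : F := if z.1 == 0%N then 0 else pr F z.1 z.2.
Let e1 (z : nat * F) : regular_gpmod A := r (h1 z).

Let h1_homog z : homog (pr F) z.1 (h1 z).
Proof.
rewrite /h1; case: eqP => _; last exact: homog_pr.
exact: (homog_subgroup _ _).1.
Qed.

Let h1_aug z : sr_aug (h1 z) = 0.
Proof.
rewrite /h1; case: ifP => [_|z1]; first by rewrite -(subrr 0) augB subrr.
by rewrite sr_aug_pr z1.
Qed.

Let e1_homog z : homog (pr A) z.1 (e1 z).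
Proof. exact/homog_map/h1_homog. Qed.

Let e1_exact (a : A) :
  sr_aug a = 0 <-> exists y, a = free_map (fun z : nat * F => z.1) e1 y.
Proof.
split=> [/sr_aug_eq0 a0|[y ->]].
  have [t ta] := r_surj a; have [N aN] := (pr_grading A).2 a.
  exists (\sum_(i < N) << (val i, t) >>); rewrite raddf_sum [LHS]aN.
  apply: eq_bigr => i _; rewrite [RHS]liftU scale1r /e1 /h1 /=.
  by case: eqP => [->|_]; [rewrite a0 raddf0|rewrite rP.2 ta].
apply: (@freeg_ind _ _ [set y | sr_aug (free_map (fun z : nat * F => z.1) e1 y : A) = 0]).
  apply: (subgroup_preimage (Y := [set 0]) (f := fun y =>
    sr_aug (free_map (fun z : nat * F => z.1) e1 y : A))).
    by move=> x x'; rewrite raddfB (sr_augB (T := A)).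
  exact: subgroup_set0.
move=> b x; rewrite /mkset [free_map _ _ _]liftU [_ *: _]/(b * e1 x).
by rewrite sr_augM /e1 (sr_aug_map rP) h1_aug mulr0.
Qed.

Let Q := free_resolution e1_homog e1_exact.
Let Q1 : lmodType A := rs_mod Q 1.
Let d0 : {linear Q1 -> A^o} := rs_d Q 0.
Let d1 : {linear rs_mod Q 2 -> Q1} := rs_d Q 1.

Let JF := prods J Fp.
Let JJ := prods J J.
Let JF_P : is_subgroup JF. Proof. exact: prods_subgroup. Qed.
Let JJ_P : is_subgroup JJ. Proof. exact: prods_subgroup. Qed.

Let prodsJl (Y : set F) a x : prods J Y x -> prods J Y (a * x).
Proof.
apply: (prods_morph (f := fun x => a * x)) => [y z||y z /= ry Yz];
  first by rewrite mulrBr.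
  exact: prods_subgroup.
by rewrite mulrA; apply: mem_prods => //=; rewrite rmorphM /= ry mulr0.
Qed.

Let prodsJ_J (Y : set F) x : prods J Y x -> r x = 0.
Proof.
by apply: (prods_min JP) => y z /= ry _; rewrite rmorphM /= ry mul0r.
Qed.

Let JJF : JJ `<=` JF.
Proof.
by apply: prods_min => // y z ry rz; apply: mem_prods => //; exact: JFp.
Qed.

Let d0B x y : d0 (x - y) = d0 x - d0 y. Proof. exact: linearB. Qed.
Let d1B x y : d1 (x - y) = d1 x - d1 y. Proof. exact: linearB. Qed.
Let d1Z a x : d1 (a *: x) = a *: d1 x. Proof. exact: linearZ. Qed.

(* f1 and, below, f2 compare the resolution Q with the beginning
   J/J^2 -> F_+/JF_+ -> A of the Gruenberg resolution of S. *)
Section Comparison.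
Variable f1 : Q1 -> zquot JF.
Hypothesis f1B : zmod_morphism f1.
Hypothesis f1U : forall a z, f1 << r a *g z >> = zproj JF (a * h1 z).
Hypothesis f1Z : forall a D t, f1 D = zproj JF t -> f1 (r a *: D) = zproj JF (a * t).

Let d0U a z : d0 << a *g z >> = a * r (h1 z).
Proof. exact: liftU. Qed.

Lemma comparison_d0 D t : f1 D = zproj JF t -> d0 D = r t.
Proof.
move=> fD; have [t' [fD' dD]] : exists t', f1 D = zproj JF t' /\ d0 D = r t'.
  apply: (@freeg_ind _ _ [set D : Q1 | exists t', f1 D = zproj JF t' /\ d0 D = r t']).
    split=> [|D1 D2 [t1 [e1' e2]] [t2 [e3 e4]]].
      by exists 0; rewrite !raddf0; split=> //; have := f1B 0 0; rewrite !subrr.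
    by exists (t1 - t2); rewrite f1B e1' e3 d0B e2 e4 rmorphB raddfB.
  move=> b z; have [a <-] := r_surj b; exists (a * h1 z).
  by rewrite f1U; split=> //; rewrite [LHS]d0U rmorphM.
have : JF (t' - t) by apply/zproj_eq; rewrite // -fD -fD'.
by move=> /prodsJ_J/eqP; rewrite rmorphB subr_eq0 dD => /eqP.
Qed.

Let lift2 (z : nat * Q1) :
  exists t, r t = 0 /\ f1 (cycle_at (st := stage_seq e1_homog 0) z) = zproj JF t.
Proof.
have [t ft] := zproj_surj (f1 (cycle_at (st := stage_seq e1_homog 0) z)).
exists t; split=> //; rewrite -(comparison_d0 (esym ft)).
exact: (@cycle_atP _ _ _ (stage_seq e1_homog 0) z).
Qed.

(** By [comparison_d0], f1 maps cycles to J/JF_+, whose elements lift to J/J^2. As Q_2 is free,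
    lifts h2 of the values on generators define f2; coefficients may be taken in A because J h2 is
    contained in J^2. *)
Lemma comparison_syzygy : exists (h2 : nat * Q1 -> F) (f2 : rs_mod Q 2 -> zquot JJ),
  [/\ zmod_morphism f2,
      forall a D t, f2 D = zproj JJ t -> f2 (r a *: D) = zproj JJ (a * t),
      forall z, f2 << z >> = zproj JJ (h2 z),
      forall z, f1 (cycle_at (st := stage_seq e1_homog 0) z) = zproj JF (h2 z)
    & forall D t, f2 D = zproj JJ t -> f1 (d1 D) = zproj JF t].
Proof.
have [h2 h2P] := choice lift2.
have h2J a z : r a = 0 -> JJ (a * h2 z).
  by move=> ra; apply: mem_prods => //; exact: (h2P z).1.
have [f2 [f2B f2U f2Z]] := coefficient_lift r_surj JJ_P (@prodsJl J) h2J.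
exists h2, f2; split=> // [z|z|D t fD].
- by have := f2U 1 z; rewrite rmorph1 mul1r.
- exact: (h2P z).2.
have [t' [fD' dD]] : exists t', f2 D = zproj JJ t' /\ f1 (d1 D) = zproj JF t'.
  apply: (@freeg_ind _ _ [set D :
    rs_mod Q 2 | exists t', f2 D = zproj JJ t' /\ f1 (d1 D) = zproj JF t']).
    split=> [|D1 D2 [t1 [e1' e2]] [t2 [e3 e4]]].
      exists 0; rewrite !raddf0; split; first by have := f2B 0 0; rewrite !subrr.
      by have := f1B 0 0; rewrite !subrr.
    by exists (t1 - t2); rewrite f2B e1' e3 d1B f1B e2 e4 !raddfB.
  move=> b z; have [a <-] := r_surj b; exists (a * h2 z); split; first exact: f2U.
  have -> : d1 << r a *g z >> = r a *: cycle_at (st := stage_seq e1_homog 0) z.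
    exact: liftU.
  by apply: f1Z; exact: (h2P z).2.
rewrite dD; apply/zproj_eq => //; apply: JJF.
by apply/zproj_eq; rewrite // -fD -fD'.
Qed.

Let f10 : f1 0 = 0. Proof. by have := f1B 0 0; rewrite !subrr. Qed.

(* F_+/JF_+ = A (x)_S V, and V is projective over S: the map D is a section of
   Q1 -> F_+/JF_+. *)
Lemma splitting : exists D : F -> Q1,
  [/\ zmod_morphism D,
      forall x, Fp x -> f1 (D x) = zproj JF x,
      forall a x, Fp x -> D (a * x) = r a *: D x
    & forall n x, Fp x -> gp_pr (res_mod e1_homog 1) n (D x) = D (pr F n x)].
Proof.
pose prQ := gp_pr (res_mod e1_homog 1).
pose aX (s : S) (x : kres Q1) : kres Q1 := sr_unit A s *: (x : Q1).
pose aY (s : S) (x : F) : F := sr_unit F s * x.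
(* The relation asks for preimages in degree one of the classes of V; it is stable under S, as
   averaging requires. *)
pose rel (y : F) (x : kres Q1) := [/\ homog (pr F) 1 y, homog prQ 1 x & f1 x = zproj JF
  y].
have relD y x y' x' : rel y x -> rel y' x' -> rel (y + y') (x + x').
  move=> [y1 x1 fx] [y1' x1' fx']; split.
  - by apply: subgroupD => //; exact: homog_subgroup.
  - by apply: subgroupD => //; exact: homog_subgroup.
  - rewrite raddfD /= -fx -fx'; have := f1B (x + x') x'; rewrite addrK => ->.
    by rewrite subrK.
have rel_act s y x : rel y x -> rel (aY s y) (aX s x).
  move=> [y1 x1 fx]; split.
  - exact: (pr_mul (homog_unit F s) y1).
  - exact: (gp_scale (homog_unit A s) x1).
  - by rewrite /aX -rP.1; exact: f1Z.
have kr (c : k) (x : kres Q1) : c *: x = aX c%:A x.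
  by rewrite kresZ /aX unit_alg.
have [||||||| t [tl tS trel]] := @left_section k S sepS F (kres Q1) aY aX rel.
- split=> [c s s' x|c s x x']; rewrite /aY.
    by rewrite linearP mulrDl scalerAl.
  by rewrite mulrDr scalerAr.
- split=> [c s s' x|c s x x']; rewrite /aX !kr /aX.
    by rewrite linearP scalerDl unit_alg scalerA -scalerAl mul1r.
  by rewrite scalerDr !scalerA -!rmorphM -scalerAl -scalerAr mul1r mulr1.
- by move=> y; rewrite /aY rmorph1 mul1r.
- by move=> s s' y; rewrite /aY rmorphM mulrA.
- by move=> s s' x; rewrite /aX rmorphM scalerA.
- move=> c y x y' x' yx yx'; apply: relD => //.
  by rewrite kr (unit_mulZ c y); exact: rel_act.
- exact: rel_act.
(* D is y v |-> r(y) t(v), where F acts on Q_1 through r; it is well defined because F_+ = F (x)_S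
   V. *)
have [_ _ _ der] := Ff.
have [|||||D [DB Dv]] := der (kres Q1) (fun x z => r x *: (z : Q1)) t.
- split=> [c x x' z|c x z z'].
    by rewrite kr /aX linearP scalerDl unit_alg scalerA -scalerAl mul1r.
  rewrite !kr /aX scalerDr !scalerA unit_alg.
  by have -> : r x * c%:A = c%:A * r x by rewrite -scalerAl -scalerAr mul1r mulr1.
- by move=> z; rewrite rmorph1 scale1r.
- by move=> x y z; rewrite rmorphM scalerA.
- exact: tl.
- by move=> s x; rewrite rP.1; exact: tS.
(* The generator (1, v) of Q_1 is a preimage of v, so [rel] has a solution at each v of degree
   one. *)
have t_rel v : homog (pr F) 1 v -> rel v (t v).
  move=> v1; apply: (trel v << (1%N, v) >>); split=> //.
    exact: (@free_homogU _ _ A _ (fun z : nat * F => z.1) (1%N, v)).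
  by have := f1U 1 (1%N, v); rewrite rmorph1 mul1r => ->; rewrite /h1 /= v1.
have Fp_ind (Y : set F) : is_subgroup Y ->
    (forall y v, homog (pr F) 1 v -> Y (y * v)) -> Fp `<=` Y.
  move=> YP Yv; apply: subset_trans aug_ideal_prods _.
  by apply: prods_min => // y v _; exact: Yv.
have D0 : D 0 = 0 by have := DB 0 0; rewrite !subrr.
exists D; split=> //.
- apply: (@Fp_ind [set x | f1 (D x) = zproj JF x]) => [|y v v1].
    split=> [|x x' /= e e']; first by rewrite /= D0 f10 raddf0.
    by rewrite /= DB f1B e e' raddfB.
  by rewrite /= Dv//; apply: f1Z; have [_ _] := t_rel v v1.
- move=> a; apply: (@Fp_ind [set x | D (a * x) = r a *: D x]) => [|y v v1].
    split=> [|x x' /= e e']; first by rewrite /= mulr0 D0 scaler0.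
    by rewrite /= mulrBr !DB e e' scalerBr.
  by rewrite /= mulrA !Dv// rmorphM scalerA.
- move=> n; apply: (@Fp_ind [set x | prQ n (D x) = D (pr F n x)]) => [|y v v1].
    split=> [|x x' e e']; first by rewrite /mkset raddf0 D0; exact: (raddf0 (prQ n)).
    rewrite /mkset DB (raddfB (pr F n)) DB -(e : prQ n (D x) = _) -(e' :
      prQ n (D x') = _).
    exact: (raddfB (prQ n)).
  have [_ tv1 _] := t_rel v v1.
  rewrite /mkset Dv// (pr_mulr _ _ v1).
  rewrite (proj_act_homogr (pr_grading A) (gp_grading _) _ (@gp_scale _ _ _ (res_mod
    e1_homog 1)) _ _ tv1); last first.
    by move=> x b c; rewrite scalerBl.
  by case: ifP => _; rewrite ?D0// Dv// rP.2.
Qed.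

End Comparison.

(* Govorov's formula is Tor_3^A(S,S) = (J F_+ /\ F_+ J) / (F_+ J F_+ + J^2). *)
Lemma Govorov_vanishing n w : ~ Tor3_neq0 A n -> homog (pr F) n w ->
  prods J Fp w -> prods Fp J w -> sums (prods Fp (prods J Fp)) (prods J J) w.
Proof.
move=> Tn wn JFw FJw.
have h1J a z : r a = 0 -> JF (a * h1 z).
  by move=> ra; apply: mem_prods => //; exact: h1_aug.
have [f1 [f1B f1U f1Z]] := coefficient_lift r_surj JF_P (@prodsJl Fp) h1J.
have [h2 [f2 [f2B f2Z f2U h2P f21]]] := comparison_syzygy f1B f1U f1Z.
have [D [DB f1D Dl Dpr]] := splitting f1B f1U f1Z.
have D0 : D 0 = 0 by have := DB 0 0; rewrite !subrr.
have f20 : f2 0 = 0 by have := f2B 0 0; rewrite !subrr.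
pose FJF := prods Fp JF.
have FJF_P : is_subgroup FJF by exact: prods_subgroup.
(* D v lifts to some u of degree n in A_+ Q_2 with f2 u equal to v modulo F_+ J F_+ and J^2. For v =
   a j, with homogeneous factors, u is a times the generator that maps to the cycle D j. *)
pose G v := exists (u : rs_mod Q 2) t, [/\ homog (rs_pr Q 2) n u /\ aug_mul setT u,
  d1 u = D v, f2 u = zproj JJ t & FJF (t - v)].
have GP : is_subgroup G.
  split=> [|v v' [u [t [[u1 u2] u3 u4 u5]]] [u' [t' [[u1' u2'] u3' u4' u5']]]].
    exists 0, 0; split.
    - by split; [exact: (homog_subgroup _ _).1|exact: (gen_subgroup _).1].
    - by rewrite D0; exact: (raddf0 d1).
    - by rewrite f20 raddf0.
    - by rewrite subr0; exact: FJF_P.1.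
  exists (u - u'), (t - t'); split.
  - by split; [exact: (homog_subgroup _ _).2|exact: (gen_subgroup _).2].
  - by rewrite d1B DB u3 u3'.
  - by rewrite f2B u4 u4' raddfB.
  - have -> : t - t' - (v - v') = (t - v) - (t' - v').
      by rewrite !opprB addrACA [RHS]addrACA [- v - t']addrC.
    exact: FJF_P.2.
have Gw : G w.
  rewrite -wn; apply: (prods_morph (f := pr F n)) FJw => //; first exact: raddfB.
  move=> a j /= a0 rj; rewrite prM; apply: subgroup_sum => // i _.
  have a0' : sr_aug (pr F i a) = 0 by rewrite sr_aug_pr a0 if_same.
  have rj' : r (pr F (n - i) j) = 0 by rewrite rP.2 rj raddf0.
  set a' := pr F i a in a0' *; set j' := pr F (n - i) j in rj' *.
  have j0' : sr_aug j' = 0 by exact: JFp.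
  pose z := ((n - i)%N, D j').
  have zE : cycle_at (st := stage_seq e1_homog 0) z = D j'.
    rewrite /cycle_at asboolT /=.
      by rewrite [LHS]Dpr// prK eqxx.
    change (d0 (D j') = 0).
    by rewrite (comparison_d0 f1B f1U (f1D _ j0')) rj'.
  exists (r a' *: << z >>), (a' * h2 z); split.
  - split; last first.
      by apply: sub_gen; exists (r a'), << z >>; split=> //; rewrite (sr_aug_map rP).
    have -> : n = (i + (n - i))%N by rewrite subnKC// -ltnS.
    apply: (@gp_scale _ _ _ (res_mod e1_homog 2)).
      by apply: homog_map => //; exact: homog_pr.
    exact: (@free_homogU _ _ A _ (fun z : nat * Q1 => z.1) z).
  - rewrite d1Z Dl//; congr (_ *: _); rewrite -[RHS]zE.
    exact: next_dU.
  - by apply: f2Z; exact: f2U.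
  - rewrite -mulrBr; apply: mem_prods => //; apply/zproj_eq => //.
    by rewrite -h2P zE f1D.
have [u [t [[un Au] d1u f2u tw]]] := Gw.
(* Membership of w in J F_+ enters here, as r kills J; it makes u a cycle. *)
have Dw : D w = 0.
  apply: (prods_morph (f := D) (Z := [set 0])) JFw => // [|j x /= rj x0].
    exact: subgroup_set0.
  by rewrite Dl// rj scale0r.
(* [Tor3_neq0] ranges over all resolutions, so its negation applies to the one constructed here. *)
have TQ : Tor3_at Q n = [set 0].
  by apply: contrapT => TQ; apply: Tn; exists Q.
have := Tor3_vanishing TQ un (etrans d1u Dw) Au.
(* f2 maps A_+ ker d_1 into F_+ J F_+ modulo J^2: if d_1 z = 0, then the representatives of f2 z lie
   in J F_+. *)
move=> /(gen_min (Y := [set u | exists t', f2 u = zproj JJ t' /\ FJF t'])) [].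
- split=> [|u1 u2 [t1 [e1' e2]] [t2 [e3 e4]]].
    by exists 0; rewrite f20 raddf0; split=> //; exact: FJF_P.1.
  exists (t1 - t2); rewrite f2B e1' e3 raddfB; split=> //; exact: FJF_P.2.
- move=> _ [b [z [b0 dz ->]]]; have [a rab] := r_surj b.
  have [g gz] := zproj_surj (f2 z).
  exists (a * g); rewrite -rab; split; first exact: f2Z.
  apply: mem_prods; first by rewrite /= -(sr_aug_map rP) rab.
  apply/zproj_eq0 => //; rewrite -(f21 _ _ (esym gz)) [d1 z]dz.
  by have := f1B 0 0; rewrite !subrr.
move=> t' [f2t' Ft']; exists (t' - (t - w)), (t - t'); split.
- exact: FJF_P.2.
- by apply/zproj_eq; rewrite // -f2u.
- by rewrite addrC addrA subrK opprB addrC subrK.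
Qed.

End Govorov.

(** * Jacobi conditions and PBW-type *)

Section Filtration.
Variables (k : fieldType) (S : algType k) (T : gsring S) (P : set T).
Hypothesis PP : subbimodule P.
Local Notation hom := (homog (pr T)).

Lemma filt_subgroup n : is_subgroup (filt P n).
Proof. exact: gen_subgroup. Qed.

Lemma mem_filt i j l a x b : deg_le i a -> P x -> deg_le j x -> deg_le l b ->
  filt P (i + j + l) (a * x * b).
Proof. by move=> ai Px xj bl; apply: sub_gen; exists i, j, l; split=> //;
  exists a, x, b. Qed.

Lemma filt_base n x : P x -> deg_le n x -> filt P n x.
Proof.
move=> Px xn; have := mem_filt (deg_le1 T) Px xn (deg_le1 T).
by rewrite mul1r mulr1 add0n addn0.
Qed.

Lemma filt_ind (Y : set T) n : is_subgroup Y ->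
  (forall i j l a x b, (i + j + l)%N = n -> deg_le i a -> P x -> deg_le j x ->
     deg_le l b -> Y (a * x * b)) -> filt P n `<=` Y.
Proof.
move=> YP Yn; apply: gen_min => // _ [i [j [l [ijl [a [x [b [ai [Px xj] bl ->]]]]]]]].
exact: Yn ijl ai Px xj bl.
Qed.

Lemma filt_deg_le n : filt P n `<=` deg_le n.
Proof.
apply: filt_ind => [|i j l a x b <- ai _ xj bl]; first exact: deg_le_subgroup.
by apply: deg_leM => //; exact: deg_leM.
Qed.

Lemma filt_mull i n a x : deg_le i a -> filt P n x -> filt P (i + n) (a * x).
Proof.
move=> ai; apply: (filt_ind (Y := [set x | filt P (i + n) (a * x)])).
  exact/subgroup_mull/filt_subgroup.
move=> i' j l a' y b <- ai' Py yj bl; rewrite /= !mulrA -!addnA [in X in filt P X]addnA.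
rewrite addnA; apply: mem_filt => //; exact: deg_leM.
Qed.

Lemma filt_mulr i n a x : deg_le i a -> filt P n x -> filt P (n + i) (x * a).
Proof.
move=> ai; apply: (filt_ind (Y := [set x | filt P (n + i) (x * a)])).
  exact/subgroup_mulr/filt_subgroup.
move=> i' j l a' y b <- ai' Py yj bl; rewrite /= -mulrA -addnA.
apply: mem_filt => //; exact: deg_leM.
Qed.

Lemma filtW m n : (m <= n)%N -> filt P m `<=` filt P n.
Proof.
move=> mn x xm; rewrite -(subnK mn) -[x]mul1r; apply: filt_mull => //.
exact: deg_leW (deg_le1 T).
Qed.

Lemma ideal_gen_ideal (X : set T) : two_sided_ideal (ideal_gen X).
Proof.
split; first split.
- by move=> Y [[[Y0 _] _] _].
- move=> x y gx gy Y YP; have [[[_ YB] _] _] := YP.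
  by apply: YB; [exact: gx|exact: gy].
- move=> a x gx; split=> Y YP; have [[_ Ya] _] := YP.
    by apply: (Ya a x _).1; exact: gx.
  by apply: (Ya a x _).2; exact: gx.
Qed.

Lemma ideal_genP x : ideal_gen P x <-> exists n, filt P n x.
Proof.
split=> [|[n]].
  suff sub : ideal_gen P `<=` [set x | exists n, filt P n x] by exact: sub.
  apply: smallest_sub => [|y Py]; last first.
    by have [n yn] := deg_finite y; exists n; apply: filt_base.
  split=> [|a y [n yn]].
    split=> [|y z [m ym] [n zn]]; first by exists 0%N; exact: (filt_subgroup 0).1.
    exists (maxn m n); apply: (filt_subgroup _).2.
      by apply: filtW ym; exact: leq_maxl.
    by apply: filtW zn; exact: leq_maxr.
  have [i ai] := deg_finite a; split.
    by exists (i + n)%N; exact: filt_mull.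
  by exists (n + i)%N; exact: filt_mulr.
apply: (filt_ind (Y := ideal_gen P)) => [|i j l a y b _ _ Py _ _].
  exact: (ideal_gen_ideal P).1.
apply: ((ideal_gen_ideal P).2 _ _ _).2; apply: ((ideal_gen_ideal P).2 _ _ _).1.
exact: sub_gen_smallest.
Qed.

Lemma filt_leadpart n x : filt P n x -> ideal_gen (lead_part P) (pr T n x).
Proof.
have [iP iM] := ideal_gen_ideal (lead_part P).
apply: (filt_ind (Y := [set x | ideal_gen (lead_part P) (pr T n x)])).
  exact: subgroup_preimage (raddfB (pr T n)) iP.
move=> i j l a y b <- ai Py yj bl; rewrite /= pr_leM//; last exact: deg_leM.
rewrite pr_leM//; apply: (iM _ _ _).2; apply: (iM _ _ _).1.
apply: sub_gen_smallest => m; rewrite prK.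
case: eqP => [->|_]; first by exists y.
exists 0; last by rewrite raddf0.
by split; [exact: PP.1.1|exact: (deg_le_subgroup _ _).1].
Qed.

Lemma lead_part_pr n x : P x -> deg_le n x -> lead_part P (pr T n x).
Proof.
move=> Px xn m; rewrite prK; case: eqP => [->|_]; first by exists x.
exists 0; last by rewrite raddf0.
by split; [exact: PP.1.1|exact: (deg_le_subgroup _ _).1].
Qed.

Section DegreeOne.
Hypothesis T1 : generated_in_degree1 T.

(** In a generator a x b, an outer factor with positive degree bound is split as S + V T^(<= i) or S
    + T^(<= i) V; the part with S has dropped a filtration degree and lies in P_n. If both bounds
    are 0, then a and b lie in S and a x b in P. *)
Lemma filtS n x : filt P n.+1 x -> exists y z t,
  [/\ P y /\ deg_le n.+1 y, prods (hom 1) (filt P n) z, prods (filt P n) (hom 1) t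
    & filt P n (x - (y + (z + t)))].
Proof.
pose Y := [set x | exists y z t,
  [/\ P y /\ deg_le n.+1 y, prods (hom 1) (filt P n) z, prods (filt P n) (hom 1) t
    & filt P n (x - (y + (z + t)))]].
have lP : is_subgroup (prods (hom 1) (filt P n)) by exact: prods_subgroup.
have rP : is_subgroup (prods (filt P n) (hom 1)) by exact: prods_subgroup.
have fP := filt_subgroup n.
have dP := deg_le_subgroup T n.+1.
have P0 := PP.1.
apply: (filt_ind (Y := Y)).
  split=> [|x1 x2 [y1 [z1 [t1 [[Py1 dy1] lz1 rt1 e1]]]] [y2 [z2 [t2 [[Py2 dy2] lz2 rt2
    e2]]]]].
    exists 0, 0, 0; rewrite !addr0 subr0.
    by split; [split; [exact: P0.1|exact: dP.1]|exact: lP.1|exact: rP.1|exact: fP.1].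
  exists (y1 - y2), (z1 - z2), (t1 - t2); split.
  - by split; [exact: P0.2|exact: dP.2].
  - exact: lP.2.
  - exact: rP.2.
  - have -> : x1 - x2 - (y1 - y2 + (z1 - z2 + (t1 - t2))) =
        (x1 - (y1 + (z1 + t1))) - (x2 - (y2 + (z2 + t2))).
      have E (a b c d : T) : (a - b) + (c - d) = (a + c) - (b + d).
        by rewrite opprD addrACA.
      rewrite !E; move: (y1 + _) (y2 + _) => a b.
      by rewrite !opprB !E [a + x2]addrC.
    exact: fP.2.
move=> [|i] j l a y b ijl ai Py yj bl; [case: l => [|l] in ijl bl *|].
- exists (a * y * b), 0, 0; rewrite !addr0 subrr; split;
    [|exact: lP.1|exact: rP.1|exact: fP.1].
  rewrite (deg_le0E ai) (deg_le0E bl); split.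
    by apply: (PP.2 _ _ _).2; apply: (PP.2 _ _ _).1.
  rewrite -ijl; apply: deg_leM; last exact: deg_le_unit.
  by apply: deg_leM => //; exact: deg_le_unit.
- have [s [c [lc ->]]] := deg_leS_right T1 bl.
  exists 0, 0, (a * y * c); rewrite mulrDr !add0r addrK.
  split; [by split; [exact: P0.1|exact: dP.1]|exact: lP.1| |].
    apply: (prods_morph (f := fun c => a * y * c)) lc => // [u v|c' v c'l v1];
      first by rewrite mulrBr.
    rewrite mulrA; apply: mem_prods => //.
    by have := mem_filt ai Py yj c'l; move: ijl; rewrite addnS => -[->].
  apply: filtW (mem_filt ai Py yj (deg_le_unit T s)).
  by move: ijl; rewrite addnS => -[<-]; rewrite addn0 leq_addr.
- have [s [c [lc ->]]] := deg_leS_left T1 ai.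
  exists 0, (c * y * b), 0; rewrite !mulrDl add0r addr0 addrK.
  split; [by split; [exact: P0.1|exact: dP.1]| |exact: rP.1|].
    apply: (prods_morph (f := fun c => c * y * b)) lc => // [u v|v c' v1 c'l];
      first by rewrite !mulrBl.
    rewrite -!mulrA; apply: mem_prods => //; rewrite mulrA.
    by have := mem_filt c'l Py yj bl; move: ijl; rewrite !addSn => -[->].
  apply: filtW (mem_filt (deg_le_unit T s) Py yj bl).
  by move: ijl; rewrite !addSn => -[<-]; rewrite add0n -addnA leq_addl.
Qed.

End DegreeOne.

End Filtration.

(** * From (J_(n-1)) to (J_n) *)

Section JacobiStep.
Variables (k : fieldType) (S : algType k) (T A : gsring S).
Variables (pi : {lrmorphism T -> A}) (R P : set T).
Hypotheses (sepS : separable_algebra S) (piP : is_gsring_map pi).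
Hypothesis pi_surj : forall a, exists t, pi t = a.
Hypothesis R_ge2 : R `<=` deg_ge 2.
Hypothesis R_rel : is_relation_bimodule [set x | pi x = 0] R.
Hypotheses (PP : subbimodule P) (PR : lead_part P = R).

(** R has no components of degree 0 and 1, so the leading term of x vanishes, first in degree 1 and
    then in degree 0. *)
Lemma P_le1 x : P x -> deg_le 1 x -> x = 0.
Proof.
move=> Px x1.
have R0 n y : P y -> deg_le n y -> (n < 2)%N -> pr T n y = 0.
  move=> Py yn n2; have := lead_part_pr PP Py yn; rewrite PR => /R_ge2 /(_ n n2).
  by rewrite prK eqxx.
have x0 : deg_le 0 x.
  have : deg_lt 1 x by apply: deg_le_lt => //; exact: R0 x1 _.
  by [].
apply: deg_lt0; apply: deg_le_lt => //.
exact: R0.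
Qed.

Lemma filt_le1 n x : (n <= 1)%N -> filt P n x -> x = 0.
Proof.
move=> n1; apply: (filt_ind (Y := [set 0])) => [|i j l a y b ijl _ Py yj _].
  exact: subgroup_set0.
have -> : y = 0.
  apply: P_le1 => //; apply: deg_leW yj; apply: leq_trans n1.
  by rewrite -ijl addnAC leq_addl.
by rewrite /= mulr0 mul0r.
Qed.

Lemma ideal_gen_R x : ideal_gen R x -> pi x = 0.
Proof.
suff sub : ideal_gen R `<=` [set x | pi x = 0] by exact: sub.
have [_ _ RI _ _] := R_rel.
apply: smallest_sub => [|y Ry]; last exact: RI.
split=> [|a y /= py]; last by split; rewrite rmorphM /= py ?mulr0 ?mul0r.
exact: (subgroup_preimage (rmorphB pi) (@subgroup_set0 A)).
Qed.

Lemma filt_pi n x : filt P n x -> pi (pr T n x) = 0.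
Proof. by move=> /(filt_leadpart PP); rewrite PR; exact: ideal_gen_R. Qed.

(** Induction along I = R + T^1 I + I T^1: elements of R are leading terms of P, and the rest comes
    from I in degree n-1. Together with [filt_pi], the top components of P_n are exactly the degree
    n part of I. *)
Lemma lift_filt n x : pi x = 0 -> homog (pr T) n x ->
  exists y, filt P n y /\ pr T n y = x.
Proof.
elim: n x => [|n IH] x px xn; have [_ _ _ IE _] := R_rel;
  have : [set x | pi x = 0] x by []; rewrite IE => -[s [d [Rs dd xE]]];
  have Ls : lead_part P s by [rewrite PR];
  [have [y [Py yn] yE] := Ls 0%N|have [y [Py yn] yE] := Ls n.+1];
  rewrite -xn xE raddfD /= -yE.
- exists y; split; first exact: filt_base.
  suff -> : pr T 0 d = 0 by rewrite addr0.
  apply: (gen_morph (f := pr T 0) (Y := [set 0])) dd;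
    [exact: raddfB|exact: subgroup_set0|].
  move=> _ [t [z [t1 _ [->|->]]]] /=; first by rewrite (pr_mull _ _ t1).
  by rewrite (pr_mulr _ _ t1).
have [z [fz <-]] : exists z, filt P n.+1 z /\ pr T n.+1 z = pr T n.+1 d.
  apply: (gen_morph (f := pr T n.+1) (Y := [set d |
    exists z, filt P n.+1 z /\ pr T n.+1 z = d])) dd.
  - exact: raddfB.
  - split=> [|_ _ [z [fz <-]] [w [fw <-]]].
      by exists 0; split; [exact: (filt_subgroup _ _).1|rewrite raddf0].
    by exists (z - w); split; [exact: (filt_subgroup _ _).2|rewrite raddfB].
  move=> d' [t [z [t1 pz zE]]].
  have [w [fw wE]] := IH (pr T n z) (etrans (piP.2 n z) (etrans (congr1 _ pz) (raddf0
    _))) (homog_pr n z).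
  have [->|->] := zE.
    exists (t * w); split; first exact: filt_mull (homog_deg_le t1) fw.
    by rewrite !(pr_mull _ _ t1) /= subn1 /= wE.
  exists (w * t); split; first by rewrite -addn1; exact: filt_mulr (homog_deg_le t1) fw.
  by rewrite !(pr_mulr _ _ t1) /= subn1 /= wE.
exists (y + z); split; last by rewrite raddfD.
by apply: (subgroupD (filt_subgroup P n.+1)) => //; exact: filt_base.
Qed.

Variables (F : gsring S) (q : {lrmorphism F -> T}).
Hypotheses (Ff : free_gsring F) (qP : is_gsring_map q).
Hypothesis q_surj : forall y, exists x, q x = y.
Hypothesis qK : forall n x, (1 < n)%N -> homog (pr F) n.+1 x -> q x = 0 ->
  let K := [set x | homog (pr F) n x /\ q x = 0] in
  sums (prods (homog (pr F) 1) K) (prods K (homog (pr F) 1)) x.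

Let r : {lrmorphism F -> A} := (pi \o q).
Let rP : is_gsring_map r.
Proof. by split=> [s|n x]; rewrite /= ?qP.1 ?piP.1// qP.2 piP.2. Qed.
Let r_surj a : exists t, r t = a.
Proof.
by have [y <-] := pi_surj a; have [x <-] := q_surj y; exists x.
Qed.

Let rM x y : r (x * y) = r x * r y. Proof. exact: rmorphM. Qed.
Let rD x y : r (x + y) = r x + r y. Proof. exact: rmorphD. Qed.

Local Notation hom1 := (homog (pr F) 1).

Let F1 : generated_in_degree1 F. Proof. by case: Ff. Qed.

Lemma generated_image : generated_in_degree1 T.
Proof.
move=> Y YP Yu Yt y; have [x <-] := q_surj y.
apply: (F1 (Y := q @^-1` Y)).
- exact: (subgroup_preimage (rmorphB q) YP).
- by move=> s; rewrite /preimage /= qP.1.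
- move=> t z t1 Yz; rewrite /preimage /= rmorphM; apply: Yt => //.
  exact: homog_map.
Qed.

(** The Phi_n of the overview. The bound on the degree of x is part of it, since q x controls x only
    modulo ker q. *)
Definition pfilt n : set F := [set x | deg_le n x /\ filt P n (q x)].

Lemma pfilt_subgroup n : is_subgroup (pfilt n).
Proof.
apply: subgroup_setI; first exact: deg_le_subgroup.
exact: (subgroup_preimage (rmorphB q) (filt_subgroup P n)).
Qed.

Lemma map_deg_le n x : deg_le n x -> deg_le n (q x).
Proof. by move=> xn m nm; rewrite -qP.2 xn// raddf0. Qed.

Lemma pfilt_mull i n a x : deg_le i a -> pfilt n x -> pfilt (i + n) (a * x).
Proof.
move=> ai [xn fx]; split; first exact: deg_leM.
by rewrite rmorphM; apply: filt_mull => //; exact: map_deg_le.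
Qed.

Lemma pfilt_mulr i n a x : deg_le i a -> pfilt n x -> pfilt (n + i) (x * a).
Proof.
move=> ai [xn fx]; split; first exact: deg_leM.
by rewrite rmorphM; apply: filt_mulr => //; exact: map_deg_le.
Qed.

Lemma pfilt_pr n x : pfilt n x -> r (pr F n x) = 0.
Proof. by move=> [_ /filt_pi]; rewrite /r /= qP.2. Qed.

Lemma lift_deg_le n y : deg_le n y -> exists x, q x = y /\ deg_le n x.
Proof.
move=> yn; have [x xy] := q_surj y; exists (\sum_(i < n.+1) pr F i x); split.
  rewrite rmorph_sum [RHS](sum_proj (pr_grading T) (N := n.+1)) => [|m /yn//].
  by apply: eq_bigr => i _; rewrite /= -xy qP.2.
apply: subgroup_sum => [|i _]; first exact: deg_le_subgroup.
by apply: (@deg_leW _ _ _ i); [rewrite -ltnS|exact: pr_deg_le].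
Qed.

(** An element of P_n with top component q x is lifted to F, and the top component of the lift is
    replaced by x, which does not change the image under q. *)
Lemma lift_pfilt n x : r x = 0 -> homog (pr F) n x -> exists y, pfilt n y /\ pr F n y = x.
Proof.
move=> rx xn; have [y [fy yE]] := lift_filt rx (homog_map qP xn).
have [z [zy zn]] := lift_deg_le (filt_deg_le fy).
exists (z - pr F n z + x); split;
  last by rewrite raddfD raddfB /= prK eqxx subrr add0r xn.
split.
  apply: (subgroupD (deg_le_subgroup F n)); last exact: homog_deg_le.
  by apply: (deg_le_subgroup _ _).2 => //; exact: pr_deg_le.
by rewrite rmorphD rmorphB /= qP.2 zy yE subrK.
Qed.

Section Step.
Variable m : nat.
Hypothesis Jm : jacobi P m.

Lemma pfilt_symbol0 x : pfilt m.+1 x -> pr F m.+1 x = 0 -> pfilt m x.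
Proof.
move=> [xm fx] x0; have xm' : deg_le m x by exact: deg_le_lt.
by split=> //; apply: Jm; split=> //; exact: map_deg_le.
Qed.

Let section_rel (y x :
  F) := [/\ homog (pr F) m.+1 y, r y = 0, pfilt m.+1 x & pr F m.+1 x = y].

Let section_relD y x y' x' :
  section_rel y x -> section_rel y' x' -> section_rel (y + y') (x + x').
Proof.
move=> [y1 ry fx xy] [y1' ry' fx' xy']; split.
- by apply: (subgroupD (homog_subgroup _ m.+1)).
- by rewrite rD ry ry' addr0.
- by apply: (subgroupD (pfilt_subgroup m.+1)).
- by rewrite raddfD /= xy xy'.
Qed.

Let section_rel_l s y x :
  section_rel y x -> section_rel (sr_unit F s * y) (sr_unit F s * x).
Proof.
move=> [y1 ry fx xy]; split.
- exact: (pr_mul (homog_unit F s) y1).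
- by rewrite rM ry mulr0.
- exact: pfilt_mull (deg_le_unit F s) fx.
- by rewrite pr_unitl xy.
Qed.

Let section_rel_r s y x :
  section_rel y x -> section_rel (y * sr_unit F s) (x * sr_unit F s).
Proof.
move=> [y1 ry fx xy]; split.
- by have := pr_mul y1 (homog_unit F s); rewrite addn0.
- by rewrite rM ry mul0r.
- by have := pfilt_mulr (deg_le_unit F s) fx; rewrite addn0.
- by rewrite pr_unitr xy.
Qed.

Let section_rel_lin c y x y' x' :
  section_rel y x -> section_rel y' x' -> section_rel (c *: y + y') (c *: x + x').
Proof.
move=> yx yx'; apply: section_relD => //.
by rewrite !unit_mulZ; exact: section_rel_l.
Qed.

(* The symbol map is injective on V (pfilt m+1) modulo V (pfilt m): a right inverse t
   of pfilt m+1 -> J^(m+1) that is left S-linear induces one, D, in degree m+2. *)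
Lemma symbol_injective_left x :
  prods hom1 (pfilt m.+1) x -> pr F m.+2 x = 0 -> pfilt m.+1 x.
Proof.
have [||||||| t [tl tS tD]] := @left_section k S sepS F F
  (fun s x => sr_unit F s * x) (fun s x => sr_unit F s * x) section_rel.
- split=> [c s s' y|c s y y']; first by rewrite linearP mulrDl scalerAl.
  by rewrite mulrDr scalerAr.
- split=> [c s s' y|c s y y']; first by rewrite linearP mulrDl scalerAl.
  by rewrite mulrDr scalerAr.
- by move=> y; rewrite rmorph1 mul1r.
- by move=> s s' y; rewrite rmorphM mulrA.
- by move=> s s' y; rewrite rmorphM mulrA.
- by move=> c y z y' z'; exact: section_rel_lin.
- by move=> s y z; exact: section_rel_l.
have [_ + _ _] := Ff; move=> /(_ t tl tS) [D [DB Dv]] Lx x0.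
have D0 : D 0 = 0 by have := DB 0 0; rewrite !subrr.
(* For x = v y the difference is v (y - t(y')), with y' the top component of y. As y - t(y') has no
   top component, it lies in Phi_m by [pfilt_symbol0]. *)
suff : pfilt m.+1 (x - D (pr F m.+2 x)) by rewrite x0 D0 subr0.
apply: (prods_morph (f := fun x => x - D (pr F m.+2 x))) Lx => [y z||v y v1 fy].
- rewrite raddfB DB !opprB addrACA [RHS]addrACA; congr (_ + _).
  by rewrite addrC.
- exact: pfilt_subgroup.
rewrite (pr_mull _ _ v1) /= subn1 /= Dv// -mulrBr.
have [_ _ ft tE] : section_rel (pr F m.+1 y) (t (pr F m.+1 y)).
  by apply: (tD _ y); split=> //; [exact: homog_pr|exact: pfilt_pr].
rewrite -add1n; apply: pfilt_mull; first exact: homog_deg_le.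
apply: pfilt_symbol0; first by apply: (pfilt_subgroup _).2.
by rewrite raddfB /= tE subrr.
Qed.

Lemma symbol_injective_right x :
  prods (pfilt m.+1) hom1 x -> pr F m.+2 x = 0 -> pfilt m.+1 x.
Proof.
have [||||||| t [tl tS tD]] := @right_section k S sepS F F
  (fun s x => x * sr_unit F s) (fun s x => x * sr_unit F s) section_rel.
- split=> [c s s' y|c s y y']; first by rewrite linearP mulrDr scalerAr.
  by rewrite mulrDl scalerAl.
- split=> [c s s' y|c s y y']; first by rewrite linearP mulrDr scalerAr.
  by rewrite mulrDl scalerAl.
- by move=> y; rewrite rmorph1 mulr1.
- by move=> s s' y; rewrite rmorphM mulrA.
- by move=> s s' y; rewrite rmorphM mulrA.
- by move=> c y z y' z'; exact: section_rel_lin.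
- by move=> s y z; exact: section_rel_r.
have [_ _ + _] := Ff; move=> /(_ t tl tS) [D [DB Dv]] Lx x0.
have D0 : D 0 = 0 by have := DB 0 0; rewrite !subrr.
suff : pfilt m.+1 (x - D (pr F m.+2 x)) by rewrite x0 D0 subr0.
apply: (prods_morph (f := fun x => x - D (pr F m.+2 x))) Lx => [y z||y v fy v1].
- rewrite raddfB DB !opprB addrACA [RHS]addrACA; congr (_ + _).
  by rewrite addrC.
- exact: pfilt_subgroup.
rewrite (pr_mulr _ _ v1) /= subn1 /= Dv// -mulrBl.
have [_ _ ft tE] : section_rel (pr F m.+1 y) (t (pr F m.+1 y)).
  by apply: (tD _ y); split=> //; [exact: homog_pr|exact: pfilt_pr].
have -> : pfilt m.+1 = pfilt (m + 1) by rewrite addn1.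
apply: pfilt_mulr; first exact: homog_deg_le.
apply: pfilt_symbol0; first by apply: (pfilt_subgroup _).2.
by rewrite raddfB /= tE subrr.
Qed.

(** From here on (J_(n-1)) is the hypothesis and (J_n) the goal. *)
Let n := m.+1.
Local Notation J := [set x | r x = 0].
Local Notation Fp := [set x : F | sr_aug x = 0].
Local Notation L := (prods hom1 (pfilt n)).
Local Notation Rt := (prods (pfilt n) hom1).

Definition liftable (w : F) := exists w1 w2,
  [/\ L w1, Rt w2, pfilt n (w1 - w2), pr F n.+1 w1 = w & pr F n.+1 w2 = w].

Let LP : is_subgroup L. Proof. exact: prods_subgroup. Qed.
Let RtP : is_subgroup Rt. Proof. exact: prods_subgroup. Qed.

Lemma liftable_subgroup : is_subgroup liftable.
Proof.
split=> [|w w' [w1 [w2 [Lw Rw fw e1 e2]]] [w1' [w2' [Lw' Rw' fw' e1' e2']]]].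
  exists 0, 0; rewrite subr0 raddf0; split=> //; [exact: LP.1|exact: RtP.1|].
  exact: (pfilt_subgroup _).1.
exists (w1 - w1'), (w2 - w2'); split; [exact: LP.2|exact: RtP.2| | |]; last 2 first.
- by rewrite raddfB /= e1 e1'.
- by rewrite raddfB /= e2 e2'.
have -> : w1 - w1' - (w2 - w2') = (w1 - w2) - (w1' - w2').
  by rewrite !opprB addrACA [RHS]addrACA [- w1' - w2]addrC.
exact: (pfilt_subgroup _).2.
Qed.

Lemma aug_left i a : deg_le i.+1 a -> sr_aug a = 0 -> prods hom1 (deg_le i) a.
Proof.
move=> ai a0; have [s [y [Py aE]]] := deg_leS_left F1 ai.
have y0 : sr_aug y = 0.
  apply: (prods_morph (f := @sr_aug _ _ F) (Z := [set 0])) Py => [||b c b1 _].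
  - exact: sr_augB.
  - exact: subgroup_set0.
  by rewrite /= sr_augM; have -> : sr_aug b = 0; [apply/sr_aug_eq0;
    rewrite (pr_homog _ b1)|rewrite mul0r].
have := @sr_augB _ _ F a y; rewrite a0 y0 subr0 aE addrK sr_unitK => ->.
by rewrite raddf0 add0r.
Qed.

Lemma aug_right i a : deg_le i.+1 a -> sr_aug a = 0 -> prods (deg_le i) hom1 a.
Proof.
move=> ai a0; have [s [y [Py aE]]] := deg_leS_right F1 ai.
have y0 : sr_aug y = 0.
  apply: (prods_morph (f := @sr_aug _ _ F) (Z := [set 0])) Py => [||b c _ c1].
  - exact: sr_augB.
  - exact: subgroup_set0.
  by rewrite /= sr_augM; have -> : sr_aug c = 0; [apply/sr_aug_eq0;
    rewrite (pr_homog _ c1)|rewrite mulr0].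
have := @sr_augB _ _ F a y; rewrite a0 y0 subr0 aE addrK sr_unitK => ->.
by rewrite raddf0 add0r.
Qed.

Lemma homog0_aug a : homog (pr F) 0 a -> sr_aug a = 0 -> a = 0.
Proof. by move=> /homog0E -> ; rewrite sr_unitK => ->; rewrite raddf0. Qed.

Lemma prods_pfilt_left i j a x : deg_le i.+1 a -> sr_aug a = 0 -> pfilt j x ->
  (i + j)%N = n -> L (a * x).
Proof.
move=> ai a0 fx ij; apply: (prods_morph (f := fun a => a * x)) (aug_left ai a0) => //.
  by move=> b c; rewrite mulrBl.
move=> v b v1 bi; rewrite -mulrA; apply: mem_prods => //.
by rewrite -ij; exact: pfilt_mull.
Qed.

Lemma prods_pfilt_right i j a x : deg_le i.+1 a -> sr_aug a = 0 -> pfilt j x ->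
  (i + j)%N = n -> Rt (x * a).
Proof.
move=> ai a0 fx ij; apply: (prods_morph (f := fun a => x * a)) (aug_right ai a0) => //.
  by move=> b c; rewrite mulrBr.
move=> b v bi v1; rewrite mulrA; apply: mem_prods => //.
by rewrite -ij addnC; exact: pfilt_mulr.
Qed.

Let J_aug x : r x = 0 -> sr_aug x = 0.
Proof. by move=> rx; rewrite -(sr_aug_map rP) rx -(subrr 0) (sr_augB (T := A)) subrr. Qed.

(** With lifts a', b' of the factors, w1 = a b' and w2 = a' b. Then w1 - w2 = (a - a') b' + a' (b' -
    b), where a - a' and b' - b have lost their top components. Factors of degree 0 vanish since J
    lies in F_+. *)
Lemma liftable_JJ i j a b : homog (pr F) i a -> homog (pr F) j b ->
  r a = 0 -> r b = 0 -> (i + j)%N = n.+1 -> liftable (a * b).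
Proof.
move=> ai bj ra rb; have [a0 b0] := (J_aug ra, J_aug rb).
case: i ai => [|i] ai ij.
  by rewrite (homog0_aug ai a0) mul0r; exact: liftable_subgroup.1.
case: j bj ij => [|j] bj ij.
  by rewrite (homog0_aug bj b0) mulr0; exact: liftable_subgroup.1.
have [a' [fa aE]] := lift_pfilt ra ai; have [b' [fb bE]] := lift_pfilt rb bj.
have ijn : (i + j.+1)%N = n by move: ij; rewrite addSn => -[].
have jin : (j + i.+1)%N = n by rewrite addnC -ijn addSnnS.
have [da db] := (homog_deg_le ai, homog_deg_le bj).
exists (a * b'), (a' * b); split.
- exact: (prods_pfilt_left da a0 fb ijn).
- exact: (prods_pfilt_right db b0 fa jin).
- have -> : a * b' - a' * b = (a - a') * b' + a' * (b' - b).
    by rewrite mulrBl mulrBr addrA subrK.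
  apply: (subgroupD (pfilt_subgroup n)).
    rewrite -ijn; apply: pfilt_mull => //; rewrite -opprB.
    apply: (subgroupN (deg_le_subgroup F i)).
    by rewrite -aE; apply: (@deg_le_subpr _ _ F i.+1); exact: fa.1.
  rewrite -jin addnC; apply: pfilt_mulr => //.
  by rewrite -bE; apply: (@deg_le_subpr _ _ F j.+1); exact: fb.1.
- by rewrite -ij pr_leM ?bE ?(pr_homog _ ai) ?eqxx//; exact: fb.1.
- by rewrite -ij pr_leM ?aE ?(pr_homog _ bj) ?eqxx//; exact: fa.1.
Qed.

(** Only the middle factor is lifted: a y' b lies in V Phi_n and in Phi_n V at once, so that w1 =
    w2. *)
Lemma liftable_FJF i j l a y b : homog (pr F) i a -> homog (pr F) j y ->
  homog (pr F) l b -> sr_aug a = 0 -> r y = 0 -> sr_aug b = 0 ->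
  (i + j + l)%N = n.+1 -> liftable (a * y * b).
Proof.
move=> ai yj bl a0 ry b0.
case: i ai => [|i] ai ijl.
  by rewrite (homog0_aug ai a0) !mul0r; exact: liftable_subgroup.1.
case: l bl ijl => [|l] bl ijl.
  by rewrite (homog0_aug bl b0) mulr0; exact: liftable_subgroup.1.
have [y' [fy yE]] := lift_pfilt ry yj.
have [da db] := (homog_deg_le ai, homog_deg_le bl).
have w : pr F n.+1 (a * y' * b) = a * y * b.
  rewrite -ijl pr_leM//; last by apply: deg_leM => //; exact: fy.1.
  by rewrite pr_leM//; [rewrite yE (pr_homog _ ai) (pr_homog _ bl) !eqxx|exact: fy.1].
exists (a * y' * b), (a * y' * b); split=> //.
- rewrite -mulrA; apply: (prods_pfilt_left (j := (j + l.+1)%N) da a0).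
    exact: pfilt_mulr.
  by move: ijl; rewrite -addnA addSn => -[].
- apply: (prods_pfilt_right (j := (i.+1 + j)%N) db b0).
    exact: pfilt_mull.
  by move: ijl; rewrite addnC addSn => -[].
- by rewrite subrr; exact: (pfilt_subgroup _).1.
Qed.

Lemma liftable_sums w : sums (prods Fp (prods J Fp)) (prods J J) w ->
  liftable (pr F n.+1 w).
Proof.
have GP := liftable_subgroup.
have Jpr i x : r x = 0 -> r (pr F i x) = 0 by move=> rx; rewrite rP.2 rx raddf0.
have Fpr i (x : F) : sr_aug x = 0 -> sr_aug (pr F i x) = 0.
  by move=> x0; rewrite sr_aug_pr x0 if_same.
move=> [x [y [Fx Jy ->]]]; rewrite raddfD; apply: (subgroupD GP).
  apply: (prods_morph (f := pr F n.+1)) Fx => //; first exact: raddfB.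
  move=> a z /= a0 JFz; rewrite prM; apply: subgroup_sum => // i _.
  apply: (prods_morph (f := fun z => pr F i a * pr F (n.+1 - i) z)) JFz => //.
    by move=> u v; rewrite raddfB mulrBr.
  move=> u b /= ru b0; rewrite prM mulr_sumr; apply: subgroup_sum => // l _.
  rewrite mulrA; apply: liftable_FJF (homog_pr _ _) (homog_pr _ _) (homog_pr _ _) _ _ _ _.
  - exact: Fpr.
  - exact: Jpr.
  - exact: Fpr.
  - by rewrite -addnA (subnKC (ltn_ord l : l <= _)%N) (subnKC (ltn_ord i : i <= _)%N).
apply: (prods_morph (f := pr F n.+1)) Jy => //; first exact: raddfB.
move=> a b /= ra rb; rewrite prM; apply: subgroup_sum => // i _.
apply: liftable_JJ (homog_pr _ _) (homog_pr _ _) _ _ _; [exact: Jpr|exact: Jpr|].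
exact: (subnKC (ltn_ord i : i <= _)%N).
Qed.

Lemma lift_prods_left z : prods (homog (pr T) 1) (filt P n) z ->
  exists x, L x /\ q x = z.
Proof.
apply: (@prods_min _ _ _ [set z | exists x, L x /\ q x = z]) => [|v w v1 fw].
  split=> [|_ _ [x [Lx <-]] [y [Ly <-]]].
    by exists 0; split; [exact: LP.1|rewrite raddf0].
  by exists (x - y); split; [exact: LP.2|rewrite rmorphB].
have [x xv] := q_surj v; have [y [yw yn]] := lift_deg_le (filt_deg_le fw).
exists (pr F 1 x * y); split; last by rewrite rmorphM /= qP.2 xv v1 yw.
by apply: mem_prods; [exact: homog_pr|split=> //; rewrite yw].
Qed.

Lemma lift_prods_right z : prods (filt P n) (homog (pr T) 1) z ->
  exists x, Rt x /\ q x = z.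
Proof.
apply: (@prods_min _ _ _ [set z | exists x, Rt x /\ q x = z]) => [|w v fw v1].
  split=> [|_ _ [x [Lx <-]] [y [Ly <-]]].
    by exists 0; split; [exact: RtP.1|rewrite raddf0].
  by exists (x - y); split; [exact: RtP.2|rewrite rmorphB].
have [x xv] := q_surj v; have [y [yw yn]] := lift_deg_le (filt_deg_le fw).
exists (y * pr F 1 x); split; last by rewrite rmorphM /= qP.2 xv v1 yw.
by apply: mem_prods; [split=> //; rewrite yw|exact: homog_pr].
Qed.

Hypothesis m0 : (0 < m)%N.
Hypothesis Tor0 : ~ Tor3_neq0 A n.+1.

Let prods_symbol x1 x2 : L x1 -> Rt x2 -> pr F n.+1 (x1 + x2) = 0 -> pfilt n (x1 + x2).
Proof.
move=> Lx1 Rx2; rewrite raddfD /= => e.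
set w := pr F n.+1 x1 in e.
have FJw : prods Fp J w.
  apply: (prods_morph (f := pr F n.+1)) Lx1; [exact: raddfB|exact: prods_subgroup|].
  move=> v y v1 fy; rewrite (pr_mull _ _ v1) /= subn1; apply: mem_prods;
    last exact: pfilt_pr.
  by apply/sr_aug_eq0; rewrite (pr_homog _ v1).
have JFw : prods J Fp w.
  have -> : w = - pr F n.+1 x2 by apply/eqP; rewrite -addr_eq0 e.
  apply: (subgroupN (prods_subgroup _ _)).
  apply: (prods_morph (f := pr F n.+1)) Rx2; [exact: raddfB|exact: prods_subgroup|].
  move=> y v fy v1; rewrite (pr_mulr _ _ v1) /= subn1; apply: mem_prods;
    first exact: pfilt_pr.
  by apply/sr_aug_eq0; rewrite (pr_homog _ v1).
have := Govorov_vanishing sepS Ff rP r_surj Tor0 (homog_pr _ _) JFw FJw.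
move=> /liftable_sums; rewrite prK eqxx => -[w1 [w2 [Lw1 Rw2 fw e1 e2]]].
have -> : x1 + x2 = (x1 - w1) + (x2 + w2) + (w1 - w2).
  by rewrite addrACA subrK addrK.
apply: (subgroupD (pfilt_subgroup n)) => //.
apply: (subgroupD (pfilt_subgroup n)).
  apply: symbol_injective_left; first exact: LP.2.
  by rewrite raddfB /= [X in _ - X]e1 subrr.
apply: symbol_injective_right; first exact: (subgroupD RtP).
by rewrite raddfD /= [X in _ + X]e2 addrC.
Qed.

Lemma jacobi_step : jacobi P n.
Proof.
move=> x [fx xn].
have [y [z [t [[Py yn] lz rt fe]]]] := filtS PP generated_image fx.
have fP := filt_subgroup P n.
have dP : is_subgroup (decomposables [set x | pi x = 0]) by exact: gen_subgroup.
have dz : decomposables [set x | pi x = 0] (pr T n.+1 z).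
  apply: (prods_morph (f := pr T n.+1)) lz => //; first exact: raddfB.
  move=> v w v1 fw; rewrite (pr_mull _ _ v1) /= subn1.
  apply: sub_gen; exists v, (pr T n w); split=> //; first exact: filt_pi.
  by left.
have dt : decomposables [set x | pi x = 0] (pr T n.+1 t).
  apply: (prods_morph (f := pr T n.+1)) rt => //; first exact: raddfB.
  move=> w v fw v1; rewrite (pr_mulr _ _ v1) /= subn1.
  apply: sub_gen; exists v, (pr T n w); split=> //; first exact: filt_pi.
  by right.
have e0 : pr T n.+1 y + (pr T n.+1 z + pr T n.+1 t) = 0.
  have := filt_deg_le fe (ltnSn n); rewrite raddfB (xn n.+1 (ltnSn n)) sub0r => /eqP.
  by rewrite oppr_eq0 => /eqP; rewrite !raddfD.
(* The top component of y lies in R and, being opposite to that of z + t, among the decomposables of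
   I; the two meet in 0. *)
have y0 : pr T n.+1 y = 0.
  have [_ _ _ _ Rd] := R_rel; apply: Rd; split.
    by rewrite -PR; exact: lead_part_pr.
  have -> : pr T n.+1 y = - (pr T n.+1 z + pr T n.+1 t) by apply/eqP;
    rewrite -addr_eq0 e0.
  by apply: (subgroupN dP); exact: (subgroupD dP).
have fy : filt P n y.
  by apply: filt_base => //; exact: deg_le_lt.
suff fzt : filt P n (z + t).
  rewrite -[x](subrK (y + (z + t))); apply: (subgroupD fP) => //.
  exact: (subgroupD fP).
have [x1 [Lx1 qx1]] := lift_prods_left lz; have [x2 [Rx2 qx2]] := lift_prods_right rt.
have q0 : q (pr F n.+1 (x1 + x2)) = 0.
  by rewrite qP.2 rmorphD /= qx1 qx2 raddfD /= -[LHS]add0r -{1}y0.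
(* This is [m0], which brings degree n + 1 >= 3 into the range of [qK]; the component of x1 + x2 in
   ker q is then removed by u1 and u2. *)
have n1 : (1 < n)%N by [].
have [u1 [u2 [Ku1 Ku2 uE]]] := qK n1 (homog_pr n.+1 _) q0.
have Kf : [set x | homog (pr F) n x /\ q x = 0] `<=` pfilt n.
  move=> u [un qu]; split; first exact: homog_deg_le.
  by rewrite qu; exact: fP.1.
have Lu1 : L u1.
  by apply: (prods_min LP _ Ku1) => v w v1 Kw; apply: mem_prods => //; exact: Kf.
have Ru2 : Rt u2.
  by apply: (prods_min RtP _ Ku2) => w v Kw v1; apply: mem_prods => //; exact: Kf.
have : pfilt n ((x1 - u1) + (x2 - u2)).
  apply: prods_symbol; [exact: LP.2|exact: RtP.2|].
  by rewrite addrACA -opprD -uE raddfB /= prK eqxx subrr.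
rewrite addrACA -opprD -uE => -[_].
by rewrite rmorphB /= q0 subr0 rmorphD /= qx1 qx2.
Qed.

End Step.

End JacobiStep.

(** * PBW-type in terms of leading terms and of Jacobi conditions *)

Section PBWJacobi.
Variables (k : fieldType) (S : algType k) (T A : gsring S).
Variables (pi : {lrmorphism T -> A}) (R P : set T).
Hypothesis piP : is_gsring_map pi.
Hypothesis R_ge2 : R `<=` deg_ge 2.
Hypothesis R_rel : is_relation_bimodule [set x | pi x = 0] R.
Hypotheses (PP : subbimodule P) (PR : lead_part P = R).

Let iP := ideal_gen_ideal P.
Let iL := ideal_gen_ideal (lead_part P).

Let U_projB x y : U_proj P (x - y) = U_proj P x - U_proj P y.
Proof. exact: raddfB. Qed.

Let U_lt_subgroup n : is_subgroup (U_lt P n).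
Proof.
have dP := deg_lt_subgroup T n.
split=> [|_ _ [x xn <-] [y yn <-]]; last first.
  by exists (x - y); [exact: dP.2|rewrite U_projB].
by exists 0; [exact: dP.1|exact: (raddf0 (zproj _))].
Qed.

Let U_ltP n x : U_lt P n (U_proj P x) <-> exists2 y, deg_lt n y & ideal_gen P (x - y).
Proof.
split=> [[y yn xy]|[y yn xy]]; exists y => //.
  by apply/(zproj_eq _ _ iP.1); rewrite [RHS]xy.
by symmetry; apply/(zproj_eq _ _ iP.1).
Qed.

Let lead_ker x : ideal_gen (lead_part P) x -> pi x = 0.
Proof. by rewrite PR; exact: ideal_gen_R. Qed.

(** Phi_P is always well defined and onto, so the condition expresses its injectivity. For
    well-definedness, an element of <R> of degree n is the top component of an element of P_n by
    [lift_filt], hence congruent modulo <P> to an element of lower degree. *)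
Lemma PBW_leading_terms : PBW_type P <-> forall n x y, homog (pr T) n x ->
  deg_lt n y -> ideal_gen P (x - y) -> ideal_gen (lead_part P) x.
Proof.
split=> [PBW n x y xn yn xy|PL n].
  have [phi [phiE [_ phi_inj _]]] := PBW n.
  have h0 : homog (pr T) n 0 by exact: (homog_subgroup _ _).1.
  apply/(zproj_eq0 _ iL.1); rewrite -(raddf0 (zproj (ideal_gen (lead_part P)))).
  apply: phi_inj; [by apply/mem_set; exists x|by apply/mem_set; exists 0|].
  rewrite -/(lead_proj P x) -/(lead_proj P 0) !phiE//;
    apply/(zproj_eq _ _ (U_lt_subgroup n)).
  by rewrite -U_projB subr0; apply/U_ltP; exists y.
have wd x x' : homog (pr T) n x -> homog (pr T) n x' ->
    lead_proj P x = lead_proj P x' ->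
    zproj (U_lt P n) (U_proj P x) = zproj (U_lt P n) (U_proj P x').
  move=> xn xn' /(zproj_eq _ _ iL.1) /lead_ker px.
  apply/(zproj_eq _ _ (U_lt_subgroup n)); rewrite -U_projB; apply/U_ltP.
  have hn : homog (pr T) n (x - x') by exact: (homog_subgroup _ _).2.
  have [y [fy yE]] := lift_filt piP R_rel PR px hn.
  exists (x - x' - y); last by rewrite opprB addrC subrK; apply/(ideal_genP P); exists n.
  apply: deg_le_lt; last by rewrite raddfB /= yE hn subrr.
  apply: (deg_le_subgroup _ _).2; first exact: homog_deg_le.
  exact: filt_deg_le fy.
(* By [wd] the value does not depend on the homogeneous representative; classes without one receive
   the default 0. *)
pose phi (z : lead_quot P) : zquot (U_lt P n) :=
  xget 0 [set w | exists x, [/\ homog (pr T) n x, lead_proj P x = z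
    & w = zproj (U_lt P n) (U_proj P x)]].
have phiE x : homog (pr T) n x -> phi (lead_proj P x) = zproj (U_lt P n) (U_proj P x).
  move=> xn; rewrite /phi;
    case: xgetP => [w _ [x' [xn' xx' ->]]|/(_ (zproj (U_lt P n) (U_proj P x)))].
    exact: wd.
  by case; exists x.
exists phi; split=> //; split.
- move=> _ [x xn <-]; rewrite phiE//; exists (U_proj P x) => //.
  by exists x => //; exact: homog_deg_le.
- move=> _ _ /set_mem[x xn <-] /set_mem[x' xn' <-]; rewrite !phiE//.
  move=> /(zproj_eq _ _ (U_lt_subgroup n)); rewrite -U_projB => /U_ltP[y yn xy].
  apply/(zproj_eq _ _ iL.1); apply: PL yn xy.
  exact: (homog_subgroup _ _).2.
- move=> _ [_ [x xn <-] <-]; exists (lead_proj P (pr T n x)).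
    by exists (pr T n x) => //; exact: homog_pr.
  rewrite phiE; last exact: homog_pr.
  apply/(zproj_eq _ _ (U_lt_subgroup n)); rewrite -U_projB; apply/U_ltP.
  exists (pr T n x - x); last by rewrite subrr; exact: iP.1.1.
  by rewrite -opprB; apply: (subgroupN (deg_lt_subgroup T n)); exact: deg_le_subpr.
Qed.

(** Elements of <P> of degree at most m lie in P_m, by induction on m: their leading term lies in
    <R>, hence is the top component of an element of P_m, and the difference has smaller degree. *)
Lemma PBW_jacobi : PBW_type P -> forall n, jacobi P n.
Proof.
move=> /PBW_leading_terms PL n; suff sub m z : ideal_gen P z -> deg_le m z -> filt P m z.
  by move=> z [fz zn]; apply: sub => //; apply/(ideal_genP P); exists n.+1.
have top i x : ideal_gen P x -> deg_le i x -> exists y, filt P i y /\ deg_lt i (x - y).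
  move=> ix xi.
  have dx : deg_lt i (pr T i x - x).
    by rewrite -opprB; apply: (subgroupN (deg_lt_subgroup T i)); exact: deg_le_subpr.
  have ix' : ideal_gen P (pr T i x - (pr T i x - x)) by rewrite opprB addrC subrK.
  have px := lead_ker (PL _ _ _ (homog_pr i x) dx ix').
  have [y [fy yx]] := lift_filt piP R_rel PR px (homog_pr i x).
  exists y; split=> //; apply: deg_le_lt; last by rewrite raddfB /= yx subrr.
  by apply: (deg_le_subgroup _ _).2 => //; exact: filt_deg_le fy.
elim: m z => [|m IH] z iz zm; have [y [fy zy]] := top _ _ iz zm.
  by rewrite -[z](subrK y) (deg_lt0 zy) add0r.
rewrite -[z](subrK y); apply: (subgroupD (filt_subgroup P m.+1)) => //.
apply: filtW (leqnSn m) _ (IH _ _ zy).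
by apply: iP.1.2 => //; apply/(ideal_genP P); exists m.+1.
Qed.

Lemma jacobi0 : jacobi P 0.
Proof.
by move=> x [/(filt_le1 R_ge2 PP PR (leqnn 1)) -> _]; exact: (filt_subgroup P 0).1.
Qed.

(* (J_1) holds in any case, since P^(<= 1) = 0 gives P_2 = P^(<= 2). *)
Lemma jacobi1 : generated_in_degree1 T -> jacobi P 1.
Proof.
move=> T1 x [fx x1]; have [y [z [t [[Py _] lz rt fe]]]] := filtS PP T1 fx.
have F0 := filt_le1 R_ge2 PP PR (leqnn 1).
have z0 : z = 0.
  apply: (prods_min (subgroup_set0 _) _ lz) => v w _ /F0 ->.
  by rewrite /= mulr0.
have t0 : t = 0.
  apply: (prods_min (subgroup_set0 _) _ rt) => w v /F0 -> _.
  by rewrite /= mul0r.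
move: (F0 _ fe); rewrite z0 t0 !addr0 => /eqP; rewrite subr_eq0 => /eqP xy.
rewrite xy in x1 *; rewrite (P_le1 R_ge2 PP PR Py x1); exact: (filt_subgroup P 1).1.
Qed.

(** An element of <P> lies in some P_m. If its degree is at most n < m, then (J_(m-1)), ..., (J_n)
    bring it down to P_n, whose top components lie in <R_P>. *)
Lemma jacobi_PBW : (forall n, jacobi P n) -> PBW_type P.
Proof.
move=> Jac; apply/PBW_leading_terms => n x y xn yn /(ideal_genP P)[m fxy].
have xyn : deg_le n (x - y).
  apply: (deg_le_subgroup _ _).2; first exact: homog_deg_le.
  exact: deg_lt_le.
suff fn : filt P n (x - y).
  by have := filt_leadpart PP fn; rewrite raddfB /= xn yn// subr0.
have [mn|nm] := leqP m n; first exact: filtW fxy.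
elim: m fxy nm => [//|m IH] fxy; rewrite ltnS leq_eqVlt => /predU1P[nm|nm].
  by rewrite nm in xyn *; apply: Jac.
apply: IH => //; apply: Jac; split=> //; apply: deg_leW xyn; exact: ltnW.
Qed.

End PBWJacobi.

(** The bound requires that a least upper bound exist, so one is exhibited: the largest element if
    the degrees are bounded, and +oo otherwise. *)
Lemma c_inv_ge (k : fieldType) (S : algType k) (A : gsring S) n :
  Tor3_neq0 A n -> ((n%:Z - 1)%:E <= c_inv A)%E.
Proof.
move=> Tn; rewrite /c_inv; case: asboolP => [T0|_]; first by case: (T0 n).
set X := [set _ | _ in _].
apply: ge_supremum_Nmem; last by exists n.
have [[N Nub]|nub] := pselect (exists N, forall i, Tor3_neq0 A i -> (i <= N)%N).
  pose Tb i := `[< Tor3_neq0 A i >].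
  have exT : exists i, Tb i by exists n; apply/asboolP.
  have ubT i : Tb i -> (i <= N)%N by move=> /asboolP; exact: Nub.
  case: (ex_maxnP exT ubT) => i /asboolP Ti imax.
  exists (i%:Z - 1)%:E; split.
    move=> _ [l Tl <-]; rewrite lee_fin lerD2r lez_nat; apply: imax; exact/asboolP.
  by move=> y; apply; exists i.
(* A finite upper bound y would bound all the degrees by |y + 1|. *)
exists +oo%E; split=> [y _|[y| |] yub]; [exact: leey| | exact: lexx |]; last first.
  by have := yub _ (imageP _ Tn).
exfalso; apply: nub; exists `|(y + 1)%R|%N => i Ti.
have := yub _ (imageP _ Ti); rewrite lee_fin lerBlDr => iy.
by rewrite -lez_nat (le_trans iy)// abszE ler_norm.
Qed.

Theorem theorem5p29 (k : fieldType) (S : algType k) (T A : gsring S)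
    (pi : {lrmorphism T -> A}) (R P : set T) :
  separable_algebra S ->
  quadratic T ->
  is_gsring_map pi ->
  (forall a, exists t, pi t = a) ->
  R `<=` deg_ge 2 ->
  is_relation_bimodule [set x | pi x = 0] R ->
  subbimodule P ->
  lead_part P = R ->
  (PBW_type P <->
   (c_inv A = (-1)%:E \/
    forall n : nat, (1 <= n)%N -> ((n%:Z)%:E <= c_inv A)%E -> jacobi P n)).
Proof.
move=> sepS Tquad piP pi_surj R2 R_rel PP PR; split=> [PBW|Jc].
  by right=> n _ _; exact: (PBW_jacobi piP R_rel PR).
have [F [q [Ff qP q_surj qK]]] := quadratic_cover Tquad.
apply: (jacobi_PBW piP R_rel PP PR) => n.
have J0 := jacobi0 R2 PP PR.
elim: n => [//|[_|n IH]]; first exact: (jacobi1 R2 PP PR (generated_image Ff qP q_surj)).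
(* The goal is (J_(n+2)), governed by Tor_(3,n+3). If that is not zero, then n + 2 <= c(A) and the
   condition is assumed; otherwise it follows from (J_(n+1)). *)
have [Tn|Tn] := pselect (Tor3_neq0 A n.+3).
  have := c_inv_ge Tn; rewrite -addn1 PoszD addrK => cn.
  by case: Jc => [c1|]; [rewrite c1 in cn|apply].
exact: (jacobi_step sepS piP pi_surj R_rel PP PR Ff qP q_surj qK IH).
Qed.
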